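(* Let $G$ be a locally reasonable metric group. Let $\mathcal K$ be a compact subset of $G$, let $0<\varepsilon<R$, $K\ge1$, and let $A,B\subseteq\mathcal K$ be non-empty. Then the following four statements are equivalent, in the sense that if one of them holds for one choice of implied constants in the $O()$, $\lesssim$, $\gtrsim$, $\sim$ notation, then the others hold for some (possibly different) choice of implied constants: (i) $\mathrm E_\varepsilon(A,B)\gtrsim_{\mathcal K,R,G}K^{O(1)}\mathcal N_\varepsilon(A)^{3/2}\mathcal N_\varepsilon(B)^{3/2}$. (ii) There exists a subset $E\subseteq A\times B$ with $\mathcal N_\varepsilon(E)\gtrsim_{\mathcal K,R,G}K^{O(1)}\mathcal N_\varepsilon(A)\mathcal N_\varepsilon(B)$ (entropy of $E$ measured in the product metric on $G^2$) such that $\mathcal N_\varepsilon(\{a\cdot b:(a,b)\in E\})\lesssim_{\mathcal K,R,G}K^{O(1)}\mathcal N_\varepsilon(A)^{1/2}\mathcal N_\varepsilon(B)^{1/2}$. (iii) There exist subsets $A'\subseteq A$, $B'\subseteq B$ with $\mathcal N_\varepsilon(A')\sim_{\mathcal K,R,G}K^{O(1)}\mathcal N_\varepsilon(A)$, $\mathcal N_\varepsilon(B')\sim_{\mathcal K,R,G}K^{O(1)}\mathcal N_\varepsilon(B)$ and $\mathcal N_\varepsilon(A'\cdot B')\sim_{\mathcal K,R,G}K^{O(1)}\mathcal N_\varepsilon(A)^{1/2}\mathcal N_\varepsilon(B)^{1/2}$. (iv) There exist an $O(K^{O(1)})$-approximate group $H$ with $\mathcal N_\varepsilon(H)\sim_{\mathcal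 K,R,G}K^{O(1)}\mathcal N_\varepsilon(A)^{1/2}\mathcal N_\varepsilon(B)^{1/2}$ and elements $x,y\in G$ such that $\mathcal N_\varepsilon(A\cap(x\cdot H))\sim_{\mathcal K,R,G}K^{O(1)}\mathcal N_\varepsilon(A)$ and $\mathcal N_\varepsilon(B\cap(H\cdot y))\sim_{\mathcal K,R,G}K^{O(1)}\mathcal N_\varepsilon(B)$; furthermore $H,x,y$ lie in a compact set $\tilde{\mathcal K}=\tilde{\mathcal K}(\mathcal K,R)$ depending only on $\mathcal K$ and $R$.
   Context: A multiplicative group is a topological group $G$ with a non-negative Radon measure $\mu$ invariant under left and right translation and inversion, with every non-empty open set of positive measure; a multiplicative set is a non-empty open precompact subset. A multiplicative set $H$ is an $L$-approximate group if $H^{-1}=H$ and there is a finite symmetric $X\subseteq H\cdot H$ with $|X|\le L$ and $H\cdot H\subseteq X\cdot H$. A multiplicative group with metric $d_G$ is a locally reasonable metric group if: (a) the metric balls generate the topology and all closed balls are compact; (b) for every compact $\mathcal K\subseteq G$ there is $C$ with $C^{-1}d_G(x,y)\le d_G(gx,gy),d_G(xg,yg),d_G(x^{-1},y^{-1})\le Cd_G(x,y)$ for all $x,y,g\in\mathcal K$; (c) for every $R>0$ there is $C_R$ with $\mu(\mathbf B(1,2r))\le C_R\mu(\mathbf B(1,r))$ for $0<r<R$, $\mathbf B(x,r)$ the open ball. $\mathcal N_\varepsilon(X)$ (for a subset $X$ of a metric space) is the least number of open balls of radius $\varepsilon$ covering $X$. Products $G^k$ carry the metric $d((x_i),(y_i))=\sum_i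 d_G(x_i,y_i)$. $Q_\varepsilon(A,B)=\{(a,b,a',b')\in A\times B\times A\times B: d_G(a\cdot b,a'\cdot b')\le\varepsilon\}\subseteq G^4$ and $\mathrm E_\varepsilon(A,B)=\mathcal N_\varepsilon(Q_\varepsilon(A,B))$. Notation: $X\lesssim_{\mathcal K,R,G}K^{O(1)}Y$ means $X\le CK^CY$, $\gtrsim$ means $X\ge C^{-1}K^{-C}Y$, $\sim$ means both, with $C$ depending only on $\mathcal K,R,G$; $O(K^{O(1)})$ denotes a quantity at most $CK^C$. *)

(* Defs.v *)
From HB Require Import structures.
From mathcomp Require Import all_boot all_order all_algebra finmap.
From mathcomp Require Import all_classical all_reals all_analysis.

Set Implicit Arguments.
Unset Strict Implicit.
Unset Printing Implicit Defensive.

Import Order.TTheory GRing.Theory Num.Theory.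

Local Open Scope classical_set_scope.
Local Open Scope ring_scope.

HB.mixin Record Group_isTopological G of Topological G & Group G := {
  mulg_continuous : continuous (fun p : G * G => (p.1 * p.2)%g : G) ;
  invg_continuous : continuous (fun x : G => (x^-1)%g : G)
}.

#[short(type="topologicalGroupType")]
HB.structure Definition TopologicalGroup :=
  {G of Topological G & Group G & Group_isTopological G}.

(* In a metricType the topology is the one generated by the balls of mdist. *)
#[short(type="metricGroupType")]
HB.structure Definition MetricGroup (R : numDomainType) :=
  {G of Metric R G & TopologicalGroup G}.

Definition mulset {G : groupType} (A B : set G) : set G :=
  [set (a * b)%g | a in A & b in B].

Definition invset {G : groupType} (A : set G) : set G :=
  [set (a^-1)%g | a in A].

(* G pointed at 1, as the library requires measurable types to be pointed. *)
Definition pointed_group (G : topologicalGroupType) : Type := G.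
HB.instance Definition _ (G : topologicalGroupType) :=
  Choice.on (pointed_group G).
HB.instance Definition _ (G : topologicalGroupType) :=
  isPointed.Build (pointed_group G) (1%g : G).

Definition borelType (G : topologicalGroupType) :=
  @g_sigma_algebraType (pointed_group G) (@open G).

Section multiplicative_group.
Context {R : realType} {G : topologicalGroupType}.
Variable mu : {measure set (borelType G) -> \bar R}.

Definition radon : Prop :=
  [/\ forall C : set G, compact C -> (mu C < +oo)%E,
      forall B : set (borelType G), measurable B ->
        mu B = ereal_inf [set mu U | U in [set U : set G | open U /\ B `<=` U]]
    & forall U : set G, open U ->
        mu U = ereal_sup [set mu C | C in [set C : set G | compact C /\ C `<=` U]]].

Definition multiplicative_group : Prop :=
  [/\ radon,
      forall (g : G) (B : set (borelType G)), measurable B ->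
        mu (mulset [set g] B) = mu B /\ mu (mulset B [set g]) = mu B,
      forall B : set (borelType G), measurable B -> mu (invset B) = mu B
    & forall U : set G, open U -> U !=set0 -> (0 < mu U)%E].

End multiplicative_group.

Definition multiplicative_set {G : topologicalGroupType} (H : set G) : Prop :=
  [/\ H !=set0, open H & precompact H].

Definition approximate_group {R : realType} {G : topologicalGroupType}
    (L : R) (H : set G) : Prop :=
  [/\ multiplicative_set H, invset H = H
    & exists X : {fset G},
        [/\ invset [set` X] = [set` X], [set` X] `<=` mulset H H,
            #|` X|%:R <= L & mulset H H `<=` mulset [set` X] H]].

(* closed_ball of the library is the closure of the open ball, which may be
   strictly smaller than the metric closed ball below. *)
Definition locally_reasonable {R : realType} {G : metricGroupType R}
    (mu : {measure set (borelType G) -> \bar R}) : Prop :=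
  [/\ multiplicative_group mu,
      forall (x : G) (r : R), compact [set y : G | mdist x y <= r],
      forall Kc : set G, compact Kc -> exists2 C : R, 0 < C &
        forall x y g : G, Kc x -> Kc y -> Kc g ->
          [/\ C^-1 * mdist x y <= mdist (g * x)%g (g * y)%g <= C * mdist x y,
              C^-1 * mdist x y <= mdist (x * g)%g (y * g)%g <= C * mdist x y
            & C^-1 * mdist x y <= mdist (x^-1)%g (y^-1)%g <= C * mdist x y]
    & forall r0 : R, 0 < r0 -> exists C : R, forall r : R, 0 < r < r0 ->
        (mu (ball (1%g : G) (2 * r)) <= C%:E * mu (ball (1%g : G) r))%E].

(* The number of d-balls of radius eps needed to cover X, the centres being
   anywhere in T; it is +oo if no finite family covers X. *)
Definition entropy {R : realType} {T : Type} (d : T -> T -> R) (eps : R)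
    (X : set T) : \bar R :=
  ereal_inf [set (n%:R)%:E | n in [set n : nat | exists c : 'I_n -> T,
    forall x, X x -> exists i, d (c i) x < eps]].

Definition sumdist {R : realType} {S T : Type} (d : S -> S -> R)
    (e : T -> T -> R) (p q : S * T) : R := d p.1 q.1 + e p.2 q.2.

Section entropy_conditions.
Context {R : realType} {G : metricGroupType R}.
Implicit Types (A B H : set G) (E : set (G * G)) (C K eps : R) (X Y : \bar R).

Definition ent1 eps A : \bar R := entropy (@mdist R G) eps A.

Definition ent2 eps E : \bar R :=
  entropy (sumdist (@mdist R G) (@mdist R G)) eps E.

(* G^4 is represented as (G * G) * (G * G), with ((a, b), (a', b')) standing
   for (a, b, a', b'). *)
Definition Qset eps A B : set ((G * G) * (G * G)) :=
  [set q | [/\ (A `*` B) q.1, (A `*` B) q.2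
    & mdist (q.1.1 * q.1.2)%g (q.2.1 * q.2.2)%g <= eps]].

Definition energy eps A B : \bar R :=
  let d2 := sumdist (@mdist R G) (@mdist R G) in
  entropy (sumdist d2 d2) eps (Qset eps A B).

(* C * K `^ C is nondecreasing in C > 0 when K >= 1, so one C can serve for all
   the implied constants and exponents of a statement. *)
Definition lesssim C K X Y : Prop := (X <= (C * K `^ C)%:E * Y)%E.
Definition gtrsim C K X Y : Prop := ((C^-1 * K `^ (- C))%:E * Y <= X)%E.
Definition simeq C K X Y : Prop := lesssim C K X Y /\ gtrsim C K X Y.

Definition geom_mean eps A B : \bar R :=
  (ent1 eps A `^ (1 / 2) * ent1 eps B `^ (1 / 2))%E.

Definition large_energy C eps K A B : Prop :=
  gtrsim C K (energy eps A B)
    (ent1 eps A `^ (3 / 2) * ent1 eps B `^ (3 / 2))%E.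

Definition small_partial_product C eps K A B : Prop :=
  exists E, [/\ E `<=` A `*` B,
    gtrsim C K (ent2 eps E) (ent1 eps A * ent1 eps B)%E
    & lesssim C K (ent1 eps [set (p.1 * p.2)%g | p in E])
        (geom_mean eps A B)].

Definition small_subset_product C eps K A B : Prop :=
  exists A' B', [/\ A' `<=` A, B' `<=` B,
    simeq C K (ent1 eps A') (ent1 eps A),
    simeq C K (ent1 eps B') (ent1 eps B)
    & simeq C K (ent1 eps (mulset A' B')) (geom_mean eps A B)].

Definition approximate_group_control (Kt : set G) C eps K A B : Prop :=
  exists H x y, [/\ approximate_group (C * K `^ C) H,
    simeq C K (ent1 eps H) (geom_mean eps A B),
    simeq C K (ent1 eps (A `&` mulset [set x] H)) (ent1 eps A),
    simeq C K (ent1 eps (B `&` mulset H [set y])) (ent1 eps B)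
    & [/\ H `<=` Kt, Kt x & Kt y]].

End entropy_conditions.

(* Main.v *)
Require Import Defs.
From HB Require Import structures.
From mathcomp Require Import all_boot all_order all_algebra finmap.
From mathcomp Require Import all_classical all_reals all_analysis.
From mathcomp Require Import zify lra.

(** All four conditions are discretized: on a large compact ball the metric is
    bi-Lipschitz invariant and, by comparing volumes, a separated set of bounded
    diameter (in units of [eps]) has boundedly many points, so covering numbers
    behave like cardinalities up to constants.

    The cycle is (i) => (iv) => (iii) => (ii) => (i); only the first step is deep.
    From large energy one extracts a dense graph on nets of [A] and [B] whose
    products have small covering number.  Dependent random choice (Balog,
    Szemeredi and Gowers) gives a large part [X] of the net of [A] such that the
    covering number of [X X^-1] is comparable to [#|X|].  Let [Y] be the
    neighbourhood of the quotients [a^-1 a'] having many representations in [X].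
    Replacing a popular quotient by its representations shows that the covering
    number of [X Y^t X^-1] stays comparable to [#|X|], hence [H = Y Y] is an
    approximate group by the Ruzsa covering argument, which also covers [X] by
    few translates [x H].  A popular product [z = a b] with [a] in [x H] yields
    the coset [H x^-1 z] that catches a large part of [B].  For (ii) => (i) one
    applies the Cauchy-Schwarz inequality to the map taking a pair to its product. *)

Set Implicit Arguments.
Unset Strict Implicit.
Unset Printing Implicit Defensive.

(** * Finite combinatorics *)

(** The obstacle is that rounding to nets respects the group law only up to a change of scale.
    Errors are therefore recorded as levels of [near], and maps between nets are allowed bounded
    fibres, the bound being the packing constant [mult S]. This constant and all numerical factors
    are absorbed into powers of one natural number that is at least 2 and at least [mult S]; the
    exponents are generous rather than sharp.

    An approximate group must nevertheless be exactly symmetric and open. Hence [Y] is a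
    neighbourhood cut out by strict inequalities on [g] and on [g^-1] simultaneously. It occurs at
    two radii: the covering argument yields quotients at a small radius, and the room up to the
    larger one absorbs the error made when a product is replaced by a net point.

    In a noncommutative group, smallness of [X X^-1] does not by itself bound the set of [a^-1 a'].
    What links the two is that [a c^-1 = a' c'^-1] is the same equation as [a^-1 a' = c^-1 c']: few
    values on one side force many representations on the other. *)

Lemma card_le_fibers (T U : finType) (f : T -> U) (A : {set T}) (B : {set U})
    (m : nat) :
  (forall x, x \in A -> f x \in B) ->
  (forall y, y \in B -> #|[set x in A | f x == y]| <= m) -> #|A| <= m * #|B|.
Proof.
move=> fAB hm; rewrite mulnC -sum_nat_const -sum1_card.
rewrite (partition_big f (mem B)) //=; apply: leq_sum => y yB.
by rewrite sum1dep_card; exact: hm.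
Qed.

Lemma card_sum_mem (T : finType) (P : pred T) : #|[set x | P x]| = \sum_x P x.
Proof. by rewrite -sum1dep_card big_mkcond; apply: eq_bigr => x _; case: (P x). Qed.

Lemma card_sum_mem2 (S T : finType) (P : S -> T -> bool) :
  #|[set q : S * T | P q.1 q.2]| = \sum_x \sum_y P x y.
Proof. by rewrite card_sum_mem pair_big. Qed.

(** Summing [2 * (r x * r y) <= r x ^ 2 + r y ^ 2] over all pairs gives Cauchy-Schwarz without
    leaving the natural numbers. *)
Lemma sqrn_sum_le (T : finType) (r : T -> nat) :
  (\sum_x r x) ^ 2 <= #|T| * \sum_x r x ^ 2.
Proof.
have e1 : (\sum_x r x) ^ 2 = \sum_x \sum_y r x * r y.
  by rewrite -mulnn big_distrl; apply: eq_bigr => x _; rewrite big_distrr.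
have e2 : #|T| * (\sum_x r x ^ 2) = \sum_x \sum_(y : T) r x ^ 2.
  by rewrite mulnC big_distrl /=; apply: eq_bigr => x _; rewrite sum_nat_const mulnC.
have e3 : #|T| * (\sum_x r x ^ 2) = \sum_(x : T) \sum_y r y ^ 2.
  by rewrite sum_nat_const.
have : (\sum_x r x) ^ 2 + (\sum_x r x) ^ 2 <=
    #|T| * (\sum_x r x ^ 2) + #|T| * (\sum_x r x ^ 2).
  rewrite {1}e2 e3 e1 -!big_split /=.
  apply: leq_sum => x _; rewrite -!big_split; apply: leq_sum => y _ /=.
  by rewrite addnn -mul2n; exact: nat_Cauchy.
by lia.
Qed.

(** Colliding pairs are counted by the squares of the fibre sizes. This bound supplies both the
    energy of a partial product and the many representations of a quotient. *)
Lemma card_collisions (T U : finType) (f : T -> U) (A : {set T}) :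
  #|A| ^ 2 <=
    #|U| * #|[set q : T * T | [&& q.1 \in A, q.2 \in A & f q.1 == f q.2]]|.
Proof.
have e1 : #|A| = \sum_y #|[set x in A | f x == y]|.
  rewrite -sum1_card (partition_big f predT) //=.
  by apply: eq_bigr => y _; rewrite sum1dep_card.
rewrite {1}e1; apply: leq_trans (sqrn_sum_le _) _; rewrite leq_mul2l.
apply/orP; right; rewrite -[X in _ <= X]sum1_card.
rewrite [X in _ <= X](partition_big (fun q => f q.1) predT) //=.
apply: leq_sum => y _; rewrite sum1dep_card -mulnn -cardsX; apply: subset_leq_card.
apply/fintype.subsetP => -[a b]; rewrite !inE /= => /andP[/andP[-> /eqP ->] /andP[-> /eqP ->]].
by rewrite !eqxx.
Qed.

Lemma pigeonhole (T : finType) (n : nat) (f : T -> 'I_n) (A : {set T}) :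
  0 < n -> exists k, #|A| <= n * #|[set x in A | f x == k]|.
Proof.
move=> n0; have [->|A0] := posnP #|A|; first by exists (Ordinal n0).
apply/existsP; rewrite -[X in is_true X]negbK negb_exists; apply/negP => /forallP hn.
have e : #|A| = \sum_k #|[set x in A | f x == k]|.
  rewrite -sum1_card (partition_big f predT) //=.
  by apply: eq_bigr => k _; rewrite sum1dep_card.
have : \sum_(k < n) n * #|[set x in A | f x == k]| <= \sum_(k < n) #|A|.-1.
  by apply: leq_sum => k _; rewrite -ltnS prednK // ltnNge.
rewrite -big_distrr /= -e sum_nat_const card_ord leq_pmul2l //.
by rewrite -{1}(prednK A0) ltnn.
Qed.

(** Values below [h / (2 * k)] contribute at most [#|A| * h / (2 * k)], which the hypothesis makes
    at most half of the sum. *)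
Lemma popular_sum (T : finType) (A : {set T}) (r : T -> nat) (h k : nat) :
  0 < k -> #|A| * h <= k * \sum_(x in A) r x ->
  \sum_(x in A) r x <= 2 * \sum_(x in A | h <= 2 * k * r x) r x.
Proof.
move=> k0 hA; rewrite (bigID (fun x => h <= 2 * k * r x)) /=.
set P := \sum_(x in A | h <= _) _; set N := \sum_(x in A | ~~ _) _.
have hN : 2 * k * N <= #|A| * h.
  rewrite big_distrr /= -sum_nat_const big_mkcond [X in _ <= X]big_mkcond.
  by apply: leq_sum => x _; case: (x \in A) => //=; case: ifP => //; rewrite -ltnNge => /ltnW.
have := leq_trans hN hA; rewrite (bigID (fun x => h <= 2 * k * r x)) /= -/P -/N.
rewrite -mulnA mulnCA leq_pmul2l //; lia.
Qed.

(** * Dense bipartite graphs: the Balog-Szemeredi-Gowers argument *)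

Section dependent_random_choice.
Variables (I J : finType).
Implicit Types (E : {set I * J}).

Definition nbrs E (i : I) : {set J} := [set j | (i, j) \in E].
Definition common_nbrs E (i i' : I) : {set J} := nbrs E i :&: nbrs E i'.

Lemma sum_nbrs E : \sum_i #|nbrs E i| = #|E|.
Proof.
rewrite (eq_bigr (fun i => \sum_j ((i, j) \in E))).
  by rewrite -card_sum_mem2; apply: eq_card => -[i j]; rewrite inE.
by move=> i _; rewrite card_sum_mem.
Qed.

(** Average over [j]. By Cauchy-Schwarz the mean of [#|I'| ^ 2] is at least [#|I| ^ 2 / k ^ 2]. A
    pair with few common neighbours lies in [I'] for less than one in [32 * k ^ 2] of all [j], so
    the mean number of such pairs is at most [#|I| ^ 2 / (32 * k ^ 2)]. *)
Lemma dependent_random_choice E (k : nat) : 0 < k -> 0 < #|I| -> 0 < #|J| ->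
  #|I| * #|J| <= k * #|E| ->
  exists j, let I' := [set i | (i, j) \in E] in
    #|I| <= 2 * k * #|I'| /\
    16 * #|[set q : I * I | [&& q.1 \in I', q.2 \in I' &
               32 * k ^ 2 * #|common_nbrs E q.1 q.2| < #|J|]]| <= #|I'| ^ 2.
Proof.
move=> k0 I0 J0 hE.
pose I' j := [set i | (i, j) \in E].
pose bad (q : I * I) := 32 * k ^ 2 * #|common_nbrs E q.1 q.2| < #|J|.
pose badj j := [set q : I * I | [&& q.1 \in I' j, q.2 \in I' j & bad q]].
(* One inequality carries both conclusions. On average over [j] its left side is at most
   [3 * #|I| ^ 2] and its right side at least [4 * #|I| ^ 2], so some [j] satisfies it. *)
suff [j] : exists j, 64 * k ^ 2 * #|badj j| + #|I| ^ 2 <= 4 * k ^ 2 * #|I' j| ^ 2.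
  move=> hj; exists j => /=; rewrite -/(I' j); split.
    rewrite -leq_sqr !expnMn; apply: leq_trans hj; exact: leq_addl.
  have : 64 * k ^ 2 * #|badj j| <= 4 * k ^ 2 * #|I' j| ^ 2 by lia.
  rewrite (_ : 64 * k ^ 2 * #|badj j| = 4 * k ^ 2 * (16 * #|badj j|)); last by lia.
  by rewrite leq_pmul2l // muln_gt0 /= expn_gt0 k0.
apply/existsP; rewrite -[X in is_true X]negbK negb_exists; apply/negP => /forallP hj.
have hsum : #|E| = \sum_j #|I' j|.
  transitivity (\sum_j \sum_i ((i, j) \in E)).
    by rewrite exchange_big -card_sum_mem2; apply: eq_card => -[i j]; rewrite inE.
  by apply: eq_bigr => j _; rewrite card_sum_mem.
have hbad : \sum_j #|badj j| = \sum_(q | bad q) #|common_nbrs E q.1 q.2|.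
  transitivity (\sum_j \sum_q [&& q.1 \in I' j, q.2 \in I' j & bad q] : nat).
    by apply: eq_bigr => j _; rewrite card_sum_mem.
  rewrite exchange_big [RHS]big_mkcond; apply: eq_bigr => q _ /=.
  rewrite -card_sum_mem; case: ifP => hq; last first.
    by apply: eq_card0 => j; rewrite !inE !andbF.
  by apply: eq_card => j; rewrite !inE andbT.
have hb : 32 * k ^ 2 * \sum_j #|badj j| <= #|I| ^ 2 * #|J|.
  rewrite hbad big_distrr /=; apply: (@leq_trans (\sum_(q : I * I) #|J|)).
    rewrite big_mkcond; apply: leq_sum => q _.
    by case: ifP => //; rewrite /bad => /ltnW.
  by rewrite sum_nat_const card_prod -mulnn.
have hc := sqrn_sum_le (fun j => #|I' j|); rewrite -hsum in hc.
have h1 : #|I| ^ 2 * #|J| <= k ^ 2 * \sum_j #|I' j| ^ 2.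
  rewrite -(leq_pmul2l J0) mulnCA [X in _ <= X]mulnCA.
  apply: (@leq_trans (k ^ 2 * #|E| ^ 2)); last by rewrite leq_mul2l hc orbT.
  by rewrite -expnMn mulnn -expnMn leq_sqr.
have h2 : \sum_j (4 * k ^ 2 * #|I' j| ^ 2).+1 <= \sum_j (64 * k ^ 2 * #|badj j| + #|I| ^ 2).
  by apply: leq_sum => j _; have := hj j; rewrite -ltnNge.
have e1 : \sum_j (4 * k ^ 2 * #|I' j| ^ 2).+1 = 4 * (k ^ 2 * \sum_j #|I' j| ^ 2) + #|J|.
  rewrite mulnA big_distrr -[X in _ + X]sum1_card -big_split /=.
  by apply: eq_bigr => j _; rewrite addn1.
have e2 : \sum_j (64 * k ^ 2 * #|badj j| + #|I| ^ 2) =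
    2 * (32 * k ^ 2 * \sum_j #|badj j|) + #|I| ^ 2 * #|J|.
  rewrite big_split /= sum_nat_const [#|J| * _]mulnC; congr (_ + _).
  by rewrite -big_distrr /= !mulnA.
rewrite {}e1 {}e2 in h2; move: h1 h2 hb J0.
move: (k ^ 2 * \sum_j _) (32 * _ * _) (_ ^ 2 * #|J|); lia.
Qed.

(** Bad pairs fill at most a sixteenth of [I' * I'], so at most a quarter of [I'] is bad with more
    than a quarter of [I']; [I''] is the rest. Two points of [I''] together exclude at most half of
    [I'], and each remaining [i] joins them by many paths through [J]. *)
Lemma balog_szemeredi_gowers E (k : nat) : 0 < k -> 0 < #|I| -> 0 < #|J| ->
  #|I| * #|J| <= k * #|E| ->
  exists I' I'' : {set I}, [/\ I'' \subset I', #|I| <= 4 * k * #|I'|,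
    #|I'| <= 2 * #|I''|, forall i, i \in I'' -> #|J| <= 2 * k * #|nbrs E i|
    & forall i1 i2, i1 \in I'' -> i2 \in I'' ->
      #|I'| <= 2 * #|[set i in I' |
        (#|J| <= 128 * k ^ 2 * #|common_nbrs E i1 i|) &&
        (#|J| <= 128 * k ^ 2 * #|common_nbrs E i i2|)]|].
Proof.
move=> k0 I0 J0 hE.
(* Pruning vertices of small degree loses at most half of the edges. It replaces [k] by [2 * k],
   whence the constants 4 and 128 of the statement, and gives every vertex of [I'] a large
   degree. *)
pose E' := [set q in E | #|J| <= 2 * k * #|nbrs E q.1|].
have hE' : #|E| <= 2 * #|E'|.
  have := @popular_sum I [set: I]%SET (fun i => #|nbrs E i|) #|J| k k0.
  rewrite cardsT (eq_bigl predT) => [|i]; last by rewrite inE.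
  rewrite sum_nbrs => /(_ hE) /leq_trans; apply; rewrite leq_mul2l /=.
  rewrite -[#|E'|]sum_nbrs big_mkcond; apply: leq_sum => i _; rewrite inE /=.
  case: ifP => // hi; apply: subset_leq_card; apply/fintype.subsetP => j.
  by rewrite !inE /= => ->.
have k20 : 0 < 2 * k by lia.
have hE2 : #|I| * #|J| <= 2 * k * #|E'|.
  by apply: leq_trans hE _; rewrite -mulnA mulnCA leq_mul2l hE' orbT.
have [j /=] := dependent_random_choice k20 I0 J0 hE2.
set I' := [set i | _]; move=> [hI' hbad].
pose bad i i' := 32 * (2 * k) ^ 2 * #|common_nbrs E' i i'| < #|J|.
have badC i i' : bad i i' = bad i' i by rewrite /bad /common_nbrs finset.setIC.
pose badi i := [set i' in I' | bad i i'].
pose I'' := [set i in I' | 4 * #|badi i| <= #|I'|].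
have good i i' : ~~ bad i i' -> #|J| <= 128 * k ^ 2 * #|common_nbrs E i i'|.
  rewrite /bad -leqNgt => /leq_trans; apply.
  rewrite (_ : 32 * (2 * k) ^ 2 = 128 * k ^ 2); last by lia.
  rewrite leq_mul2l; apply/orP; right; apply: subset_leq_card; apply/fintype.subsetP => l.
  by rewrite !inE => /andP[/andP[-> _] /andP[-> _]].
have sI : I'' \subset I' by apply/fintype.subsetP => i; rewrite inE => /andP[].
exists I', I''; split=> //.
- by apply: leq_trans hI' _; rewrite mulnA.
- have hb : #|[set q : I * I | [&& q.1 \in I', q.2 \in I' & bad q.1 q.2]]| =
      \sum_(i in I') #|badi i|.
    rewrite (card_sum_mem2 (fun a b => [&& a \in I', b \in I' & bad a b])).
    rewrite [RHS]big_mkcond; apply: eq_bigr => i _; rewrite -card_sum_mem.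
    by case: (i \in I') => /=; [|apply: eq_card0 => ?]; rewrite ?inE.
  rewrite hb in hbad.
  have : #|I' :\: I''| * #|I'| <= 4 * \sum_(i in I') #|badi i|.
    rewrite -sum_nat_const big_distrr /= big_mkcond [X in _ <= X]big_mkcond.
    apply: leq_sum => i _; rewrite finset.in_setD [i \in I'']inE; case: (i \in I') => //=.
    by case: ifP => //; rewrite andbT -ltnNge => /ltnW.
  move=> h1; have hc := cardsID I'' I'; rewrite (finset.setIidPr sI) in hc.
  have [->//|p1] := posnP #|I'|.
  have : 4 * (#|I' :\: I''| * #|I'|) <= #|I'| * #|I'| by lia.
  by rewrite mulnA leq_pmul2r //; lia.
- move=> i; rewrite !inE => /andP[/andP[_ /= hi] _]; exact: hi.
- move=> i1 i2; rewrite [i1 \in _]inE [i2 \in _]inE => /andP[_ h1] /andP[_ h2].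
  set S := [set i in I' | _].
  have : I' \subset S :|: (badi i1 :|: badi i2).
    apply/fintype.subsetP => i iI; rewrite !inE in iI *; rewrite iI /=.
    case b1: (bad i1 i); first by rewrite orbT.
    case b2: (bad i2 i); first by rewrite !orbT.
    by rewrite good ?b1 // good ?orbT // badC b2.
  move/subset_leq_card.
  have := (leq_card_setU S (badi i1 :|: badi i2)).1.
  have := (leq_card_setU (badi i1) (badi i2)).1.
  move: h1 h2; lia.
Qed.
End dependent_random_choice.

Local Open Scope classical_set_scope.

(** * Covering numbers at comparable scales *)

(** The device behind all comparisons of covering numbers: each point selects a nearby centre, and
    packing bounds the number of points that can share one. *)
Lemma card_le_related (T U : finType) (r : T -> U -> Prop) (A : {set T})
    (m : nat) :
  (forall x, x \in A -> exists y, r x y) ->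
  (forall (y : U) (F : {set T}), (forall x, x \in F -> x \in A /\ r x y) ->
     #|F| <= m) ->
  #|A| <= m * #|U|.
Proof.
move=> hr hm; have [->|[x0 x0A]] := finset.set_0Vmem A; first by rewrite cards0.
have [y0 _] := hr _ x0A.
have /choice[f hf] : forall x, exists y, x \in A -> r x y.
  move=> x; case xA: (x \in A); last by exists y0.
  by have [y rxy] := hr _ xA; exists y.
rewrite -cardsT; apply: (@card_le_fibers _ _ f) => [x|y _]; first by rewrite inE.
apply: (hm y) => x; rewrite inE => /andP[xA /eqP <-]; split => //; exact: hf.
Qed.

Section covering_number.
Context {T : Type} (b : T -> T -> Prop).
Implicit Types X Y : set T.

Definition covered X n := exists c : 'I_n -> T, forall x, X x -> exists i, b (c i) x.

(** A set without a finite cover gets the default value 0; the sets measured later are bounded and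
    have one. *)
Definition covnum X : nat :=
  if pselect (exists n, `[<covered X n>]) is left h then ex_minn h else 0.

Lemma covnum_le X n : covered X n -> covnum X <= n.
Proof.
move=> h; rewrite /covnum; case: pselect => // h'.
by case: ex_minnP => m _; apply; apply/asboolP.
Qed.

Lemma covered_covnum X n : covered X n -> covered X (covnum X).
Proof.
move=> h; rewrite /covnum; case: pselect => [h'|]; last first.
  by case; exists n; apply/asboolP.
by case: ex_minnP => m /asboolP.
Qed.

Lemma covered_sub X Y n : X `<=` Y -> covered Y n -> covered X n.
Proof. by move=> XY [c hc]; exists c => x /XY /hc. Qed.

Lemma covnum_sub X Y n : X `<=` Y -> covered Y n -> covnum X <= covnum Y.
Proof. by move=> XY /covered_covnum h; apply/covnum_le/(covered_sub XY). Qed.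

Lemma covered_family (I : finType) (c : I -> T) X :
  (forall x, X x -> exists i, b (c i) x) -> covered X #|I|.
Proof.
move=> hc; exists (fun k => c (enum_val k)) => x /hc[i hi].
by exists (enum_rank i); rewrite enum_rankK.
Qed.

Lemma covnum_gt0 X n : X !=set0 -> covered X n -> 0 < covnum X.
Proof.
move=> [x Xx] /covered_covnum[c /(_ x Xx)[i _]].
by case: (covnum X) i => // -[].
Qed.
End covering_number.

(* [near S m x y] stands for [d x y < eps * L ^ (m - 30)], where [L] bounds the
   Lipschitz constants of the group operations on [dom S 16]; so scale 30 is
   the scale [eps] of the covering numbers, and every group operation or
   application of the triangle inequality costs one level. *)
Record multiscale (G : groupType) := Multiscale {
  near : nat -> G -> G -> Prop;
  dom : nat -> set G;
  mult : nat;
  near_refl : forall m x, near m x x;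
  near_sym : forall m x y, near m x y -> near m y x;
  near_le : forall m n x y, m <= n -> near m x y -> near n x y;
  near_trans : forall m x y z, near m x y -> near m y z -> near m.+1 x z;
  dom_le : forall m n x, m <= n -> dom m x -> dom n x;
  dom1 : dom 0 1%g;
  dom_mul : forall m x y, dom m x -> dom m y -> dom m.+1 (x * y)%g;
  dom_inv : forall m x, dom m x -> dom m.+1 (x^-1)%g;
  near_mull : forall m g x y, dom 16 g -> dom 16 x -> dom 16 y ->
    near m x y -> near m.+1 (g * x)%g (g * y)%g;
  near_mulr : forall m g x y, dom 16 g -> dom 16 x -> dom 16 y ->
    near m x y -> near m.+1 (x * g)%g (y * g)%g;
  near_inv : forall m x y, dom 16 x -> dom 16 y ->
    near m x y -> near m.+1 (x^-1)%g (y^-1)%g;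
  dom_covered : exists n, covered (near 0) (dom 16) n;
  packing : forall (I : finType) (p : I -> G) (A : {set I}),
    (forall i, i \in A -> dom 16 (p i)) ->
    (forall i j, i \in A -> j \in A -> i != j -> ~ near 0 (p i) (p j)) ->
    (forall i j, i \in A -> j \in A -> near 60 (p i) (p j)) -> #|A| <= mult }.

(** The levels can be read off the term: a product or an inverse lowers the required level by one
    until a hypothesis on an atom applies. *)
Ltac dom_tac := match goal with
  | |- dom ?S ?k (_ * _)%g => eapply (@dom_mul _ S (k.-1)); dom_tac
  | |- dom ?S ?k (_^-1)%g => eapply (@dom_inv _ S (k.-1)); dom_tac
  | |- dom ?S _ 1%g => eapply (@dom_le _ S 0); [done | exact: dom1]
  | H : dom ?S ?k ?x |- dom ?S ?l ?x => exact: (@dom_le _ S k l x isT H)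
  | H : forall i, dom ?S ?k (?f i) |- dom ?S ?l (?f ?x) =>
      exact: (@dom_le _ S k l _ isT (H x))
  | H : ?X `<=` dom ?S ?k, H' : ?X ?x |- dom ?S ?l ?x =>
      exact: (@dom_le _ S k l _ isT (H _ H'))
  | H : ?X `<=` dom ?S ?k, H' : forall i, ?X (?f i) |- dom ?S ?l (?f ?x) =>
      exact: (@dom_le _ S k l _ isT (H _ (H' x)))
  end.

Definition group_simp (G : groupType) := (@invgM G, @invgK G, @mulgA G,
  @mulgK G, @mulgVK G, @mulgV G, @mulVg G, @mul1g G, @mulg1 G).

(** A family of largest size is a net, for a point close to no member could be added. Only symmetry
    of [close] is asked, so that the relation can also be the overlap of translates in the Ruzsa
    covering argument. *)
Lemma maximal_family (T : Type) (close : T -> T -> Prop) (X : set T) (b : nat) :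
  (forall x y, close x y -> close y x) ->
  (forall n (p : 'I_n -> T), (forall i, X (p i)) ->
     (forall i j, i != j -> ~ close (p i) (p j)) -> n <= b) ->
  exists n (p : 'I_n -> T),
  [/\ forall i, X (p i), forall i j, i != j -> ~ close (p i) (p j)
    & forall x, X x -> exists i, close (p i) x].
Proof.
move=> closeC bd.
pose P n := `[< exists p : 'I_n -> T, (forall i, X (p i)) /\
  (forall i j, i != j -> ~ close (p i) (p j)) >].
have exP : exists n, P n.
  exists 0; apply/asboolP; have p (i : 'I_0) : T by case: i.
  by exists p; split => -[].
have bdP n : P n -> n <= b by move=> /asboolP[p [hp sp]]; exact: bd sp.
case: (ex_maxnP exP bdP) => n /asboolP[p [hp sp]] nmax.
exists n, p; split => // x Xx; apply: contrapT => hx.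
have : P n.+1.
  apply/asboolP.
  exists (fun i => if unlift ord0 i is Some j then p j else x); split.
    by move=> i; case: unliftP.
  move=> i j; case: (unliftP ord0 i) => [i'|] ->; case: (unliftP ord0 j) => [j'|] -> ij.
  - by apply: sp; apply: contraNneq ij => ->.
  - by move=> h; apply: hx; exists i'.
  - by move=> h; apply: hx; exists j'; exact: closeC.
  - by rewrite eqxx in ij.
by move/nmax; rewrite ltnn.
Qed.

(** * Nets, packing and the Ruzsa triangle inequality across scales *)

Section multiscale_theory.
Context {G : groupType} (S : multiscale G).
Local Notation near := (near S).
Local Notation dom := (dom S).
Local Notation M := (mult S).
Local Notation N := (covnum (near 30)).
Implicit Types (X Y U V : set G).

Lemma near_transl m n k x y z : m < k -> n < k ->
  near m x y -> near n y z -> near k x z.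
Proof.
case: k => // k mk nk xy yz.
apply: near_trans; [exact: near_le xy|exact: near_le yz].
Qed.

Lemma near_mullK m g x y : dom 15 g -> dom 15 x -> dom 15 y ->
  near m (g * x)%g (g * y)%g -> near m.+1 x y.
Proof.
move=> hg hx hy /(@near_mull _ _ _ (g^-1)%g); rewrite !mulKg; apply; dom_tac.
Qed.

Lemma near_mulrK m g x y : dom 15 g -> dom 15 x -> dom 15 y ->
  near m (x * g)%g (y * g)%g -> near m.+1 x y.
Proof.
move=> hg hx hy /(@near_mulr _ _ _ (g^-1)%g); rewrite !mulgK; apply; dom_tac.
Qed.

Lemma near_mul m n k x x' y y' : m.+1 < k -> n.+1 < k ->
  dom 16 x -> dom 16 y -> dom 16 x' -> dom 16 y' ->
  near m x x' -> near n y y' -> near k (x * y)%g (x' * y')%g.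
Proof.
move=> mk nk hx hy hx' hy' xx' yy'.
by apply: (near_transl mk nk); [apply: near_mulr xx'|apply: near_mull yy'].
Qed.

Lemma coveredP X : X `<=` dom 16 -> exists n, covered (near 30) X n.
Proof.
move=> hX; have [n [c hc]] := dom_covered S; exists n; exists c => x /hX /hc[i hi].
by exists i; exact: near_le hi.
Qed.

Lemma covnumP X : X `<=` dom 16 -> covered (near 30) X (N X).
Proof. by move=> /coveredP[n]; exact: covered_covnum. Qed.

Lemma N_sub X Y : X `<=` Y -> Y `<=` dom 16 -> N X <= N Y.
Proof. by move=> XY /coveredP[n]; exact: covnum_sub. Qed.

Lemma N_gt0 X : X `<=` dom 16 -> X !=set0 -> 0 < N X.
Proof. by move=> /coveredP[n h] X0; exact: covnum_gt0 h. Qed.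

(** Separated families have bounded size because [dom 16] has a finite cover at scale 0. Two points
    in one ball of that cover are near at scale 1, which is why [s] must be positive. *)
Lemma net X s : 0 < s -> X `<=` dom 16 -> exists n (p : 'I_n -> G),
  [/\ forall i, X (p i), forall i j, i != j -> ~ near s (p i) (p j)
    & forall x, X x -> exists i, near s (p i) x].
Proof.
move=> s0 hX; have [n0 [c hc]] := dom_covered S.
apply: (@maximal_family _ _ _ n0) => [x y|n p hp sp]; first exact: near_sym.
have /choice[f hf] : forall i, exists k, near 0 (c k) (p i).
  by move=> i; apply: hc; exact: hX.
have fI : injective f.
  move=> i j fij; apply: contrapT => /eqP ij; apply: (sp _ _ ij).
  apply: (@near_transl 0 0 _ _ (c (f i))) => //; first exact: near_sym.
  by rewrite fij.
by have := leq_card f fI; rewrite !card_ord.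
Qed.

Lemma N_le_net X s n (p : 'I_n -> G) : s <= 30 ->
  (forall x, X x -> exists i, near s (p i) x) -> N X <= n.
Proof.
by move=> s30 hp; apply: covnum_le; exists p => x /hp[i hi]; exists i; exact: near_le hi.
Qed.

Lemma packed s t (I : finType) (p : I -> G) (A : {set I}) : t <= 60 ->
  (forall i, i \in A -> dom 16 (p i)) ->
  (forall i j, i \in A -> j \in A -> i != j -> ~ near s (p i) (p j)) ->
  (forall i j, i \in A -> j \in A -> near t (p i) (p j)) -> #|A| <= M.
Proof.
move=> t60 hd hs ht; apply: packing hd _ _ => i j iA jA.
  by move=> ij /(near_le (leq0n s)); exact: hs.
exact: near_le (ht _ _ iA jA).
Qed.

Lemma packed_around s t (I : finType) (p : I -> G) (A : {set I}) q : t < 60 ->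
  (forall i, i \in A -> dom 16 (p i)) ->
  (forall i j, i \in A -> j \in A -> i != j -> ~ near s (p i) (p j)) ->
  (forall i, i \in A -> near t q (p i)) -> #|A| <= M.
Proof.
move=> t60 hd hs ht; apply: (packed t60 hd hs) => i j iA jA.
exact: near_trans (near_sym (ht _ iA)) (ht _ jA).
Qed.

Lemma mult_gt0 : 0 < M.
Proof.
have <- : #|[set: unit]%SET| = 1 by rewrite cardsT card_unit.
apply: (@packed 0 0 _ (fun=> 1%g)) => //; last by move=> *; exact: near_refl.
- by move=> *; dom_tac.
Qed.

Lemma card_sep_le s t (I : finType) (p : I -> G) (A : {set I}) X : t <= 40 ->
  X `<=` dom 16 -> (forall i, i \in A -> dom 16 (p i)) ->
  (forall i j, i \in A -> j \in A -> i != j -> ~ near s (p i) (p j)) ->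
  (forall i, i \in A -> exists2 x, X x & near t x (p i)) -> #|A| <= M * N X.
Proof.
move=> t40 hX hd hs ht; have [c hc] := covnumP hX.
rewrite -[N X]card_ord; apply: (card_le_related (r := fun i k =>
  exists2 x, near 30 (c k) x & near t x (p i))).
  move=> i iA; have [x Xx tx] := ht _ iA; have [k kx] := hc _ Xx.
  by exists k, x.
move=> k F hF; apply: (@packed_around s 41 _ p _ (c k)) => //.
- by move=> i /hF[iA _]; exact: hd.
- by move=> i j /hF[iA _] /hF[jA _]; exact: hs.
- by move=> i /hF[_ [x kx xp]]; apply: (near_transl _ _ kx xp) => //.
Qed.

(** A relation that takes nearby points to nearby points cannot increase the covering number by more
    than [M]. Scale 31 is what two points in a common covering ball satisfy, and 59 is within reach
    of [packing]. *)
Lemma N_related (r : G -> G -> Prop) X Y : X `<=` dom 16 -> Y `<=` dom 16 ->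
  (forall y, Y y -> exists2 x, X x & r x y) ->
  (forall x x' y y', X x -> X x' -> Y y -> Y y' -> near 31 x x' -> r x y ->
     r x' y' -> near 59 y y') ->
  N Y <= M * N X.
Proof.
move=> hX hY hr hn.
have [n [p [hp sp cp]]] := net (isT : 0 < 1) hY.
apply: leq_trans (N_le_net (isT : 1 <= 30) cp) _.
rewrite -[n in n <= _]card_ord -cardsT.
have [c hc] := covnumP hX.
rewrite -[N X]card_ord; apply: (card_le_related (r := fun i k =>
  exists x, [/\ X x, near 30 (c k) x & r x (p i)])).
  move=> i _; have [x Xx rx] := hr _ (hp i); have [k kx] := hc _ Xx.
  by exists k, x.
move=> k F hF; apply: (@packed 1 59 _ p _) => //.
- by move=> i _; exact: hY.
- by move=> i j _ _; exact: sp.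
- move=> i j /hF[_ [x [Xx kx xp]]] /hF[_ [x' [Xx' kx' xp']]].
  apply: hn xp xp' => //; apply: near_trans (near_sym kx) kx'.
Qed.

Lemma N_inv X : X `<=` dom 15 -> N [set (x^-1)%g | x in X] <= M * N X.
Proof.
move=> hX; apply: (@N_related (fun x y => y = x^-1)%g).
- by move=> x Xx; dom_tac.
- by move=> _ [x Xx <-]; dom_tac.
- by move=> _ [x Xx <-]; exists x.
- move=> x x' _ _ Xx Xx' _ _ xx' -> ->; apply: (@near_le _ _ 32) => //.
  by apply: near_inv xx'; dom_tac.
Qed.

Lemma N_lmul_ge g X : dom 13 g -> X `<=` dom 13 -> N X <= M * N [set (g * x)%g | x in X].
Proof.
move=> hg hX; apply: (@N_related (fun x y => x = g * y)%g).
- by move=> _ [x Xx <-]; dom_tac.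
- by move=> x Xx; dom_tac.
- by move=> x Xx; exists (g * x)%g => //; exists x.
- move=> x x' y y' _ _ Yy Yy' + ex ex'; rewrite ex ex' => yy'; apply: (@near_le _ _ 32) => //.
  by apply: near_mullK yy'; dom_tac.
Qed.

Lemma N_rmul_ge g X : dom 13 g -> X `<=` dom 13 -> N X <= M * N [set (x * g)%g | x in X].
Proof.
move=> hg hX; apply: (@N_related (fun x y => x = y * g)%g).
- by move=> _ [x Xx <-]; dom_tac.
- by move=> x Xx; dom_tac.
- by move=> x Xx; exists (x * g)%g => //; exists x.
- move=> x x' y y' _ _ Yy Yy' + ex ex'; rewrite ex ex' => yy'; apply: (@near_le _ _ 32) => //.
  by apply: near_mulrK yy'; dom_tac.
Qed.

(** Count pairs of a net point [g] of [W] and a factorization of [g] as [u v]. Each net point has at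
    least [s / d] of them. Conversely the covering balls of [u] and of [v] determine [g] up to [M]
    choices, since [g] is near the product, and then [u] up to [M] choices, since the factors [u]
    are separated. *)
Lemma ruzsa_inequality (I : finType) (s d : nat) (W U V : set G) :
  W `<=` dom 12 -> U `<=` dom 12 -> V `<=` dom 16 ->
  (forall g, W g -> exists (u : I -> G) (A : {set I}), [/\ s <= d * #|A|,
     forall i, i \in A -> U (u i),
     forall i j, i \in A -> j \in A -> i != j -> ~ near 0 (u i) (u j)
   & forall i, i \in A -> exists2 v, V v & near 40 v ((u i)^-1 * g)%g]) ->
  s * N W <= d * M ^ 2 * (N U * N V).
Proof.
move=> hW hU hV h.
have hW' : W `<=` dom 16 by move=> x Wx; dom_tac.
have hU' : U `<=` dom 16 by move=> x Ux; dom_tac.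
have [n [p [hp sp cp]]] := net (isT : 0 < 1) hW'.
have /choice[u hu] : forall k, exists u : I -> G, exists A : {set I}, [/\ s <= d * #|A|,
     forall i, i \in A -> U (u i),
     forall i j, i \in A -> j \in A -> i != j -> ~ near 0 (u i) (u j)
   & forall i, i \in A -> exists2 v, V v & near 40 v ((u i)^-1 * p k)%g].
  by move=> k; exact: h.
have {hu}/choice[A hA] := hu.
pose Q := [set q : 'I_n * I | q.2 \in A q.1]%SET.
have cQ : s * n <= d * #|Q|.
  rewrite -[#|Q|]sum_nbrs big_distrr /= mulnC -[n in n * _]card_ord -sum_nat_const.
  apply: leq_sum => k _; have [sA _ _ _] := hA k; apply: leq_trans sA _.
  rewrite leq_mul2l; apply/orP; right.
  by apply: subset_leq_card; apply/fintype.subsetP => i iA; rewrite !inE.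
apply: (@leq_trans (s * n)); first by rewrite leq_mul2l (N_le_net (isT : 1 <= 30) cp) orbT.
apply: leq_trans cQ _; rewrite -mulnA leq_mul2l; apply/orP; right.
have [c hc] := covnumP hU'; have [c' hc'] := covnumP hV.
have -> : N U * N V = #|{: 'I_(N U) * 'I_(N V)}| by rewrite card_prod !card_ord.
apply: (card_le_related (r := fun q kl => near 30 (c kl.1) (u q.1 q.2) /\
    near 42 (c' kl.2) ((u q.1 q.2)^-1 * p q.1)%g)).
  move=> [k i]; rewrite inE /= => iA; have [_ hUi _ hVi] := hA k.
  have [l hl] := hc _ (hUi _ iA); have [v Vv nv] := hVi _ iA; have [l' hl'] := hc' _ Vv.
  by exists (l, l'); split => //; apply: near_transl hl' nv.
move=> [l l'] F /= hF.
have hQ q : q \in F -> q.2 \in A q.1 by move=> /hF[]; rewrite inE.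
have hUq q : q \in F -> dom 12 (u q.1 q.2).
  by move=> /hQ qA; have [_ + _ _] := hA q.1 => /(_ _ qA); exact: hU.
have hPq k : dom 12 (p k) by exact: hW.
(* For a fixed net point the separated factors in one ball number at most [M]. It remains to bound
   the net points, which are near each other as products of nearby factors. *)
apply: (@leq_trans (M * #|fst @: F|)).
  apply: (@card_le_fibers _ _ fst) => [q qF|k _]; first exact: imset_f.
  apply: (@packed_around 0 30 _ (fun q => u q.1 q.2) _ (c l)) =>
    // [q|[k1 i] [k2 j]|q].
  - by rewrite inE => /andP[/hUq qF _]; dom_tac.
  - rewrite !inE /= => /andP[qF /eqP ek] /andP[q'F /eqP ek'] qq'; subst k1 k2.
    have [_ _ + _] := hA k; apply; [exact: hQ qF|exact: hQ q'F|].
    by apply: contraNneq qq' => ->.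
  - by rewrite inE => /andP[/hF[_ []]].
rewrite -mulnn leq_mul2l; apply/orP; right.
apply: (@packed 1 59 _ p) => // [k _|k k' _ _|k k']; first by dom_tac.
  exact: sp.
move=> /imsetP[q qF ->] /imsetP[q' q'F ->].
have [_ [a1 a2]] := hF _ qF; have [_ [b1 b2]] := hF _ q'F.
have h1 := near_trans (near_sym a1) b1; have h2 := near_trans (near_sym a2) b2.
have d1 := hUq _ qF; have d2 := hUq _ q'F.
have := @near_mul 31 43 59 _ _ _ _ isT isT _ _ _ _ h1 h2.
by rewrite !mulVKg; apply; dom_tac.
Qed.
End multiscale_theory.

(** * Large energy gives an approximate group *)

Section popular_products.
Context {G : groupType} (S : multiscale G) {I J : finType}.
Local Notation near := (near S).
Local Notation dom := (dom S).
Local Notation M := (mult S).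
Local Notation N := (covnum (near 30)).
Variables (a : I -> G) (b : J -> G).
Hypothesis da : forall i, dom 0 (a i).
Hypothesis db : forall j, dom 0 (b j).
Hypothesis sepa : forall i j, i != j -> ~ near 2 (a i) (a j).
Hypothesis sepb : forall i j, i != j -> ~ near 2 (b i) (b j).

(** Scale 33 pays for rounding: products at distance at most [eps] are near at scale 31, and moving
    either side to a product of net points costs one more level each. *)
Definition near_products (x : I * J) : {set I * J} :=
  [set y | `[< near 33 (a x.1 * b x.2)%g (a y.1 * b y.2)%g >]]%SET.

Lemma card_near_products_l x : #|near_products x| <= M * #|I|.
Proof.
rewrite -cardsT; apply: (@card_le_fibers _ _ fst) => // i _.
apply: (@packed_around _ S 1 35 _ (fun y => b y.2) _ ((a i)^-1 * (a x.1 * b x.2))%g) => //.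
- by move=> y _; dom_tac.
- move=> [i1 j1] [i2 j2]; rewrite inE => /andP[_ /eqP /= e1].
    rewrite inE => /andP[_ /eqP /= e2] ij; subst.
  by move=> /(near_le (isT : 1 <= 2)); apply: sepb; apply: contraNneq ij => ->.
- move=> [i1 j1]; rewrite !inE /= => /andP[/asboolP h /eqP e]; subst.
  apply: (@near_le _ _ 34) => //; apply: (@near_mullK _ _ 33 (a i)); try dom_tac.
  by rewrite mulVKg.
Qed.

Lemma card_near_products_r x : #|near_products x| <= M * #|J|.
Proof.
rewrite -cardsT; apply: (@card_le_fibers _ _ snd) => // j _.
apply: (@packed_around _ S 1 35 _ (fun y => a y.1) _ (a x.1 * b x.2 * (b j)^-1)%g) => //.
- by move=> y _; dom_tac.
- move=> [i1 j1] [i2 j2]; rewrite inE => /andP[_ /eqP /= e1].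
    rewrite inE => /andP[_ /eqP /= e2] ij; subst.
  by move=> /(near_le (isT : 1 <= 2)); apply: sepa; apply: contraNneq ij => ->.
- move=> [i1 j1]; rewrite !inE /= => /andP[/asboolP h /eqP e]; subst.
  apply: (@near_le _ _ 34) => //; apply: (@near_mulrK _ _ 33 (b j)); try dom_tac.
  by rewrite mulgVK.
Qed.

(** Fixing one coordinate of a near product determines the other up to [M] choices, so a pair has at
    most [M * #|I|] and at most [M * #|J|] near products. Large energy therefore makes [#|I|] and
    [#|J|] comparable. [E] collects the pairs with many near products: each point of a net of the
    products over [E] is near many of the [#|I| * #|J|] products, and each of those is near at most
    [M] net points. *)
Lemma popular_products k : 0 < #|I| -> 0 < #|J| -> 0 < k ->
  #|I| ^ 3 * #|J| ^ 3 <= k ^ 2 * (\sum_x #|near_products x|) ^ 2 ->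
  [/\ #|J| <= k ^ 2 * M ^ 2 * #|I|, #|I| <= k ^ 2 * M ^ 2 * #|J|
    & exists E : {set I * J}, #|I| * #|J| <= 2 * k ^ 2 * M ^ 2 * #|E| /\
        N [set (a x.1 * b x.2)%g | x in [set` E]] <= 2 * k ^ 2 * M ^ 2 * #|J|].
Proof.
move=> I0 J0 k0; set Q := \sum_x _ => hQ.
have M0 := mult_gt0 S.
have QI : Q <= #|I| * #|J| * (M * #|I|).
  apply: (@leq_trans (\sum_(x : I * J) M * #|I|)).
    by apply: leq_sum => x _; exact: card_near_products_l.
  by rewrite sum_nat_const card_prod.
have QJ : Q <= #|I| * #|J| * (M * #|J|).
  apply: (@leq_trans (\sum_(x : I * J) M * #|J|)).
    by apply: leq_sum => x _; exact: card_near_products_r.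
  by rewrite sum_nat_const card_prod.
move: I0 J0 hQ QI QJ; set n := #|I|; set m := #|J| => I0 J0 hQ QI QJ.
have nm : m <= k ^ 2 * M ^ 2 * n.
  have c0 : 0 < n ^ 3 * m ^ 2 by rewrite muln_gt0 !expn_gt0 I0 J0.
  rewrite -(leq_pmul2l c0) (_ : _ * m = n ^ 3 * m ^ 3); last by lia.
  apply: leq_trans hQ _.
  rewrite (_ : _ * (_ * n) = k ^ 2 * (n * m * (M * n)) ^ 2); last by lia.
  by rewrite leq_mul2l leq_sqr QI orbT.
have mn : n <= k ^ 2 * M ^ 2 * m.
  have c0 : 0 < n ^ 2 * m ^ 3 by rewrite muln_gt0 !expn_gt0 I0 J0.
  rewrite -(leq_pmul2l c0) (_ : _ * n = n ^ 3 * m ^ 3); last by lia.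
  apply: leq_trans hQ _.
  rewrite (_ : _ * (_ * m) = k ^ 2 * (n * m * (M * m)) ^ 2); last by lia.
  by rewrite leq_mul2l leq_sqr QJ orbT.
split => //.
(* The energy bound is symmetric in [n] and [m]; [mn] turns it into an average of at least
   [n / (k ^ 2 * M)] near products per pair, the form needed by [popular_sum]. *)
have hp : n * m * n <= k ^ 2 * M * Q.
  rewrite -leq_sqr; apply: (@leq_trans (k ^ 2 * M ^ 2 * (n ^ 3 * m ^ 3))).
    rewrite (_ : (n * m * n) ^ 2 = n ^ 3 * m ^ 2 * n); last by lia.
    rewrite (_ : _ * (_ * _) = n ^ 3 * m ^ 2 * (k ^ 2 * M ^ 2 * m)); last by lia.
    by rewrite leq_mul2l mn orbT.
  rewrite (_ : (k ^ 2 * M * Q) ^ 2 = k ^ 2 * M ^ 2 * (k ^ 2 * Q ^ 2)); last by lia.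
  by rewrite leq_mul2l hQ orbT.
pose E := [set x | n <= 2 * (k ^ 2 * M) * #|near_products x|]%SET.
have k20 : 0 < k ^ 2 * M by rewrite muln_gt0 expn_gt0 k0.
have := @popular_sum _ [set: I * J]%SET (fun x => #|near_products x|) n _ k20.
rewrite cardsT card_prod -/n -/m (eq_bigl predT); last by move=> x; rewrite inE.
move=> /(_ hp) hE.
have {}hE : Q <= 2 * (#|E| * (M * n)).
  apply: leq_trans hE _; rewrite leq_mul2l /= -sum_nat_const big_mkcond /=.
  rewrite [X in _ <= X]big_mkcond; apply: leq_sum => x _; rewrite !inE /=.
  by case: ifP => // _; exact: card_near_products_l.
exists E; split.
  rewrite -(leq_pmul2r I0); apply: leq_trans hp _.
  rewrite [X in _ <= X](_ : _ = k ^ 2 * M * (2 * (#|E| * (M * n)))); last first.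
    move: (#|E|) => e; move: (n) (M) => n1 M1. lia.
  by rewrite leq_mul2l hE orbT.
set P := (X in N X).
have hP : P `<=` dom 16 by move=> _ [x _ <-]; dom_tac.
have [l [p [pP sp cp]]] := net (isT : 0 < 1) hP.
apply: leq_trans (N_le_net (isT : 1 <= 30) cp) _.
have /choice[x hx] : forall t, exists x, x \in E /\ (a x.1 * b x.2)%g = p t.
  by move=> t; have [x xE <-] := pP t; exists x.
pose Z := [set z : 'I_l * (I * J) | z.2 \in near_products (x z.1)]%SET.
have Z1 : l * n <= 2 * (k ^ 2 * M) * #|Z|.
  rewrite -[#|Z|]sum_nbrs big_distrr /= -[l in l * _]card_ord -sum_nat_const.
  apply: leq_sum => t _; have [+ _] := hx t; rewrite inE => /leq_trans; apply.
  rewrite leq_mul2l; apply/orP; right.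
  by apply: subset_leq_card; apply/fintype.subsetP => y yp; rewrite !inE in yp *.
have Z2 : #|Z| <= M * (n * m).
  rewrite -card_prod -cardsT; apply: (@card_le_fibers _ _ snd) => // y _.
  apply: (@packed_around _ S 1 35 _ (fun z => p z.1) _ (a y.1 * b y.2)%g) => //.
  - by move=> z _; apply: hP.
  - move=> [i1 j1] [i2 j2]; rewrite inE => /andP[_ /eqP /= e1].
    rewrite inE => /andP[_ /eqP /= e2] ij; subst.
    by apply: sp; apply: contraNneq ij => ->.
  - move=> [i1 j1]; rewrite !inE /= => /andP[/asboolP h /eqP e]; subst.
    have [_ <-] := hx i1; apply: (@near_le _ _ 33) => //; exact: near_sym.
rewrite -(leq_pmul2r I0); apply: leq_trans Z1 _.
rewrite (_ : _ * n = 2 * (k ^ 2 * M) * (M * (n * m))); last by lia.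
by rewrite leq_mul2l Z2 orbT.
Qed.

End popular_products.

(** * A large part of the net with few differences *)

Section small_difference_set.
Context {G : groupType} (S : multiscale G) {I J : finType}.
Local Notation near := (near S).
Local Notation dom := (dom S).
Local Notation M := (mult S).
Local Notation N := (covnum (near 30)).
Variables (a : I -> G) (b : J -> G).
Hypothesis da : forall i, dom 0 (a i).
Hypothesis db : forall j, dom 0 (b j).
Hypothesis sepa : forall i j, i != j -> ~ near 2 (a i) (a j).
Hypothesis sepb : forall i j, i != j -> ~ near 2 (b i) (b j).

Definition differences (Q : set (I * I)) : set G :=
  [set (a q.1 * (a q.2)^-1)%g | q in Q].

Lemma difference_sub Q : differences Q `<=` dom 2.
Proof. by move=> _ [q _ <-]; dom_tac. Qed.

(** The Ruzsa inequality is used twice. A common neighbour [j] of [i] and [i'] factors the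
    difference as [(a i * b j) * (a i' * b j)^-1], so differences of pairs with many common
    neighbours form a small set [D]. For two indices of [X], many intermediate [t] factor the
    difference through [D] on both sides. The degrees in [J] are kept because they later produce the
    part of [B]. *)
Lemma small_difference_set (E : {set I * J}) (K : nat) :
  M <= K -> 1 < K -> 0 < #|I| -> 0 < #|J| ->
  #|I| * #|J| <= K * #|E| -> #|I| <= K * #|J| ->
  N [set (a x.1 * b x.2)%g | x in [set` E]] <= K * #|I| ->
  exists X : {set I}, [/\ #|I| <= K ^ 4 * #|X|,
    forall i, i \in X -> #|J| <= 2 * K * #|nbrs E i|
    & N (differences [set q | q.1 \in X /\ q.2 \in X]) <= K ^ 40 * #|X| ].
Proof.
move=> MK K1 I0 J0 hE IJ; set P := [set _ | _ in _] => hP.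
have K0 : 0 < K by exact: ltnW.
have [X' [X [XX' cX' cX dX gX]]] := balog_szemeredi_gowers K0 I0 J0 hE.
have P1 : P `<=` dom 1 by move=> _ [x _ <-]; dom_tac.
have pow e1 e2 : e1 <= e2 -> K ^ e1 <= K ^ e2 by move=> ?; rewrite leq_exp2l.
pose good i i' := #|J| <= 128 * K ^ 2 * #|common_nbrs E i i'|.
pose D := differences [set q | good q.1 q.2].
have hD : N D <= K ^ 15 * #|I|.
  have h : #|J| * N D <= 128 * K ^ 2 * M ^ 2 * (N P * N [set (x^-1)%g | x in P]).
    apply: (@ruzsa_inequality _ S J).
    - by move=> x /difference_sub h; dom_tac.
    - by move=> x Px; dom_tac.
    - by move=> _ [x Px <-]; dom_tac.
    - move=> _ [[i i'] /= gi <-]; exists (fun j => a i * b j)%g, (common_nbrs E i i').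
      split => // [j|j j' _ _|j].
      + by rewrite !inE => /andP[jE _]; exists (i, j).
      + move=> jj' h; apply: (sepb jj'); apply: (@near_le _ _ 1) => //.
        by apply: near_mullK h; dom_tac.
      + rewrite !inE => /andP[_ jE]; exists ((a i' * b j)^-1)%g.
          by exists (a i' * b j)%g => //; exists (i', j).
        by rewrite !group_simp; exact: near_refl.
  rewrite -(leq_pmul2l J0).
  have hP' : N [set (x^-1)%g | x in P] <= M * N P.
    by apply: N_inv => x Px; dom_tac.
  have h1 : N P * N [set (x^-1)%g | x in P] <= K * #|I| * (K * (K * #|I|)).
    by apply: leq_mul => //; apply: leq_trans hP' _; exact: leq_mul.
  (* As [K] is at least 2, [128] is absorbed by [K ^ 7]. One factor [#|I|] is traded for [#|J|] in
     order to cancel the multiplicity on the left. *)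
  apply: (@leq_trans (K ^ 7 * K ^ 2 * K ^ 2 * (K * #|I| * (K * (K * #|J| * K))))).
    apply: leq_trans h _; apply: leq_mul.
      rewrite !leq_mul ?leq_sqr //.
      by rewrite (_ : 128 = 2 ^ 7) // leq_exp2r.
    apply: leq_trans h1 _; rewrite leq_mul2l; apply/orP; right.
    by rewrite leq_mul2l mulnC; apply/orP; right; rewrite leq_mul2r IJ orbT.
  rewrite [X in X <= _](_ : _ = K ^ 15 * (#|I| * #|J|)); last first.
    move: (#|I|) (#|J|) => x y; lia.
  by rewrite mulnA [X in X <= _]mulnC.
exists X; split => //.
  apply: leq_trans cX' _; apply: (@leq_trans (4 * K * (2 * #|X|))).
    by rewrite leq_mul2l cX orbT.
  rewrite [X in X <= _](_ : _ = 2 ^ 3 * K * #|X|); last by lia.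
  by rewrite leq_mul2r (expnSr K 3) leq_mul2r leq_exp2r // K1 !orbT.
have X'0 : 0 < #|X'|.
  by move: cX'; case: (#|X'|) => // ; rewrite muln0 leqNgt I0.
set A2 := differences _.
have h : #|X'| * N A2 <= 2 * M ^ 2 * (N D * N D).
  apply: (@ruzsa_inequality _ S I).
  - by move=> x /difference_sub h; dom_tac.
  - by move=> x /difference_sub h; dom_tac.
  - by move=> x /difference_sub h; dom_tac.
  - move=> _ [[i i'] /= [iX i'X] <-].
    exists (fun t => a i * (a t)^-1)%g, [set t in X' | good i t && good t i']%SET.
    split => [|t|t t' _ _|t]; first exact: gX.
    + by rewrite inE => /and3P[_ g1 _]; exists (i, t).
    + move=> tt' h; apply: (sepa tt').
      have := @near_inv _ _ 1 (a t)^-1%g (a t')^-1%g; rewrite !invgK; apply; try dom_tac.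
      by apply: near_mullK h; dom_tac.
    + rewrite inE => /and3P[_ _ g2]; exists (a t * (a i')^-1)%g; first by exists (t, i').
      by rewrite !group_simp; exact: near_refl.
rewrite -(leq_pmul2l X'0); apply: leq_trans h _.
apply: (@leq_trans (K * K ^ 2 * (K ^ 15 * #|I| * (K ^ 15 * (4 * K * #|X'|))))).
  apply: leq_mul; first by rewrite leq_mul // leq_sqr.
  by apply: leq_mul => //; apply: leq_trans hD _; rewrite leq_mul2l cX' orbT.
have hI : 4 * #|I| <= K ^ 6 * #|X|.
  rewrite (_ : 6 = 5 + 1) //.
  have h1 : 4 * #|I| <= 4 * (4 * K * (2 * #|X|)).
    by rewrite leq_mul2l; apply: leq_trans cX' _; rewrite leq_mul2l cX orbT.
  apply: leq_trans h1 _.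
  rewrite [X in X <= _](_ : _ = 2 ^ 5 * K * #|X|); last by lia.
  by rewrite leq_mul2r (expnSr K 5) leq_mul2r leq_exp2r // K1 !orbT.
rewrite [X in X <= _](_ : _ = K ^ 34 * (4 * #|I|) * #|X'|); last first.
  move: (#|I|) (#|X'|) => x y; lia.
rewrite [X in _ <= X]mulnC leq_mul2r; apply/orP; right.
rewrite (_ : 40 = 34 + 6) // expnD -mulnA leq_mul2l; exact/orP/or_intror.
Qed.
End small_difference_set.

Lemma mulsetS (G : groupType) (A A' B B' : set G) :
  A `<=` A' -> B `<=` B' -> mulset A B `<=` mulset A' B'.
Proof. by move=> AA BB _ [x Ax [y By <-]]; exists x; [exact: AA|exists y; [exact: BB|]]. Qed.

(** * Popular quotients and the approximate group built from them *)

Section popular_quotients.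
Context {G : groupType} (S : multiscale G) {I : finType}.
Local Notation near := (near S).
Local Notation dom := (dom S).
Local Notation M := (mult S).
Local Notation N := (covnum (near 30)).
Variables (a : I -> G) (X : {set I}) (K : nat).
Hypothesis da : forall i, dom 0 (a i).
Hypothesis sepa : forall i j, i != j -> ~ near 2 (a i) (a j).
Hypotheses (MK : M <= K) (K1 : 1 < K) (X0 : 0 < #|X|).
Hypothesis hX : N (differences a [set q | q.1 \in X /\ q.2 \in X]) <= K * #|X|.

Definition quot (q : I * I) : G := ((a q.1)^-1 * a q.2)%g.
Definition swap (q : I * I) : I * I := (q.2, q.1).

(** Closeness is required of the swapped quotients too, so that [q] and its swap have exactly
    equally many representations. Scale 34 is the level reached in [card_popular] after one
    inversion. *)
Definition reps (q : I * I) : {set I * I} :=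
  [set p | [&& p.1 \in X, p.2 \in X & `[< near 34 (quot q) (quot p) /\
    near 34 (quot (swap q)) (quot (swap p)) >]]]%SET.

Definition popular (q : I * I) : bool :=
  [&& q.1 \in X, q.2 \in X & #|X| <= 2 * K * #|reps q|].

(** The condition on [g^-1] makes this set exactly closed under inversion; closeness of [g] alone
    would lose a level. Both conditions are open. *)
Definition popular_quot (r : nat) : set G :=
  [set g | exists2 q, popular q & near r g (quot q) /\ near r (g^-1)%g (quot (swap q))].

Hypothesis dY : popular_quot 20 `<=` dom 0.

Let Y := popular_quot 20.
Let A := [set a i | i in [set` X]].
Let Ai := [set (a i)^-1%g | i in [set` X]].

Lemma quot_swap q : quot (swap q) = ((quot q)^-1)%g.
Proof. by rewrite /quot /= !group_simp. Qed.

Lemma dquot q : dom 2 (quot q).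
Proof. by rewrite /quot; dom_tac. Qed.

Lemma sep_quot i t t' : t != t' -> ~ near 1 (quot (i, t)) (quot (i, t')).
Proof.
move=> tt' h; apply: (sepa tt'); apply: near_mullK h; rewrite /=; dom_tac.
Qed.

Lemma card_reps q : #|reps q| <= M * #|X|.
Proof.
apply: (@card_le_fibers _ _ fst) => [p|l _]; first by rewrite inE => /andP[].
apply: (@packed_around _ S 2 36 _ (fun p => a p.2) _ (a l * quot q)%g) => //.
- by move=> p _; dom_tac.
- move=> [i1 j1] [i2 j2]; rewrite inE => /andP[_ /eqP /= e1].
  rewrite inE => /andP[_ /eqP /= e2] ij; subst.
  by apply: sepa; apply: contraNneq ij => ->.
- move=> [i1 j1]; rewrite inE => /andP[+ /eqP /= e]; subst.
  rewrite inE => /and3P[_ _ /asboolP[h _]].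
  have hq := dquot q; apply: (@near_le _ _ 35) => //.
  rewrite -[a j1](mulVKg (a l)); apply: near_mull h; rewrite /quot /=; dom_tac.
Qed.

Lemma reps_swap q : #|reps (swap q)| = #|reps q|.
Proof.
have e p : reps p \subset swap @: reps (swap p).
  apply/fintype.subsetP => -[l l']; rewrite inE => /and3P[hl hl' /asboolP[h1 h2]].
  by apply/imsetP; exists (l', l) => //; rewrite inE /= hl hl' /=; apply/asboolP.
apply/eqP; rewrite eqn_leq; apply/andP; split.
  by apply: leq_trans (subset_leq_card (e _)) _; apply: leq_trans (leq_imset_card _ _) _; case: q.
by apply: leq_trans (subset_leq_card (e _)) _; exact: leq_imset_card.
Qed.

Lemma popular_swap q : popular (swap q) = popular q.
Proof. by rewrite /popular reps_swap /= andbCA. Qed.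

Lemma popular_quot_inv r g : popular_quot r g -> popular_quot r (g^-1)%g.
Proof.
by move=> [q pq [h1 h2]]; exists (swap q); rewrite ?popular_swap ?invgK //; case: q pq h1 h2.
Qed.

Lemma popular_quot_le r s : r <= s -> popular_quot r `<=` popular_quot s.
Proof.
by move=> rs g [q pq [h1 h2]]; exists q => //; split; [exact: near_le h1|exact: near_le h2].
Qed.

Lemma popular_quot_near r s t g w : popular_quot r g -> r < t -> s < t ->
  near s w g -> near s (w^-1)%g (g^-1)%g -> popular_quot t w.
Proof.
move=> [q pq [h1 h2]] rt st e1 e2; exists q => //; split.
  exact: (near_transl st rt e1 h1).
exact: (near_transl st rt e2 h2).
Qed.

(** Round the differences of pairs in [X] to at most [K * #|X|] centres. Cauchy-Schwarz gives at
    least [#|X| ^ 3 / K] collisions [a l (a i)^-1 ~ a l' (a i')^-1], and each says that [(l, l')]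
    represents the quotient of [(i, i')]. On average a pair thus has [#|X| / K] representations. *)
Lemma card_popular : #|X| ^ 2 <= 2 * K * M * #|[set q | popular q]%SET|.
Proof.
have hX' := hX; set A2 := differences _ _ in hX'.
have dA2 : A2 `<=` dom 16 by move=> x /(@difference_sub _ S _ a da) h; dom_tac.
have [c hc] := covnumP dA2.
have [i0 i0X] := card_gt0P X0.
have [l0 _] : exists l, near 30 (c l) (a i0 * (a i0)^-1)%g.
  by apply: hc; exists (i0, i0).
have /choice[f hf] : forall q : I * I, exists l, q.1 \in X /\ q.2 \in X ->
    near 30 (c l) (a q.1 * (a q.2)^-1)%g.
  move=> q; case: (pselect (q.1 \in X /\ q.2 \in X)) => hq; last by exists l0.
  by have [|l hl] := hc (a q.1 * (a q.2)^-1)%g; [exists q|exists l].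
have := card_collisions f (finset.setX X X); rewrite card_ord cardsX.
set Q := [set q | [&& _, _ & _]]%SET => hQ.
have hQ2 : #|Q| <= \sum_(q in finset.setX X X) #|reps q|.
  pose Z := [set z : (I * I) * (I * I) | (z.1 \in finset.setX X X) && (z.2 \in reps z.1)]%SET.
  have <- : #|Z| = \sum_(q in finset.setX X X) #|reps q|.
    rewrite -[#|Z|]sum_nbrs [RHS]big_mkcond; apply: eq_bigr => q _.
    case: ifP => qX; rewrite inE in qX.
      by apply: eq_card => p; rewrite !inE /= qX.
    by apply: eq_card0 => p; rewrite !inE /= qX.
  (* Regroups a collision of [(l, i)] with [(l', i')] as the pair [(i, i')] together with its
     representation [(l, l')]. *)
  pose g (z : (I * I) * (I * I)) := ((z.1.2, z.2.2), (z.1.1, z.2.1)).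
  have gI : injective g by move=> [[? ?] [? ?]] [[? ?] [? ?]] [-> -> -> ->].
  rewrite -(card_imset _ gI); apply: subset_leq_card; apply/fintype.subsetP => _ /imsetP[[[l i] [l' i']] + ->].
  rewrite inE /= => /and3P[]; rewrite !finset.in_setX /= => /andP[lX iX] /andP[l'X i'X] /eqP ff.
  rewrite inE /= !finset.in_setX /= iX i'X inE /= lX l'X /=; apply/asboolP.
  have h1 := hf (l, i) (conj lX iX); have h2 := hf (l', i') (conj l'X i'X).
  rewrite ff in h1; have /= h := near_trans (near_sym h1) h2.
  have h3 : near 33 (quot (i, i')) (quot (l, l')).
    apply: (@near_mullK _ _ 32 (a l)); try (rewrite /quot /=; dom_tac).
    have : near 32 (a l * (a i)^-1 * a i')%g (a l' * (a i')^-1 * a i')%g.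
      by apply: near_mulr h; dom_tac.
    by rewrite /quot /= mulgVK mulVKg mulgA.
  split; first exact: near_le h3.
  by rewrite !quot_swap; apply: near_inv h3; rewrite /quot /=; dom_tac.
have hsum : #|finset.setX X X| * #|X| <= K * \sum_(q in finset.setX X X) #|reps q|.
  rewrite cardsX -(leq_pmul2l X0); apply: (@leq_trans ((#|X| * #|X|) ^ 2)).
    by rewrite -mulnn !mulnA.
  apply: leq_trans hQ _; apply: (leq_trans (leq_mul hX' hQ2)).
  by rewrite mulnA [#|X| * K]mulnC.
have K0 : 0 < K by exact: ltnW.
have := popular_sum K0 hsum.
set R := \sum_(q in _ | _) _ => hR.
have hR2 : R <= #|[set q | popular q]%SET| * (M * #|X|).
  rewrite -sum_nat_const /R big_mkcond [X in _ <= X]big_mkcond; apply: leq_sum => q _.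
  by rewrite [q \in finset.setX _ _]inE inE /popular andbA; case: ifP => // _; exact: card_reps.
rewrite -(leq_pmul2r X0) -mulnn; rewrite cardsX in hsum; apply: leq_trans hsum _.
apply: (@leq_trans (K * (2 * (#|[set q | popular q]%SET| * (M * #|X|))))).
  by rewrite leq_mul2l; apply/orP; right; apply: leq_trans hR _; rewrite leq_mul2l hR2.
by move: (#|_|) (#|X|) => x y; lia.
Qed.

(** Popular quotients with a common first index are left translates of net points, hence separated.
    Such a family bounds [H] from below and serves as the test set in the covering argument. *)
Lemma popular_star : exists i0, #|X| <= 2 * K * M * #|[set t | popular (i0, t)]%SET|.
Proof.
apply: contrapT => /forallNP h.
have : \sum_(i in X) #|X| > \sum_(i in X) 2 * K * M * #|[set t | popular (i, t)]%SET|.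
  have [i iX] := card_gt0P X0.
  rewrite (bigD1 i iX) [X in _ < X](bigD1 i iX) /= -addSn; apply: leq_add.
    by rewrite ltnNge; apply/negP/h.
  by apply: leq_sum => j _; apply: ltnW; rewrite ltnNge; apply/negP/h.
rewrite sum_nat_const mulnn ltnNge => /negP; apply; apply: leq_trans card_popular _.
rewrite -big_distrr /= leq_mul2l; apply/orP; right.
have -> : #|[set q | popular q]%SET| = \sum_i #|[set t | popular (i, t)]%SET|.
  transitivity #|[set q : I * I | popular (q.1, q.2)]%SET|.
    by apply: eq_card => -[i t]; rewrite !inE.
  rewrite (card_sum_mem2 (fun i t => popular (i, t))); apply: eq_bigr => i _.
  by rewrite card_sum_mem.
rewrite [X in _ <= X]big_mkcond; apply: leq_sum => i _; case: ifP => // iX.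
by rewrite leqn0; apply/eqP/eq_card0 => t; rewrite inE /popular /= iX.
Qed.

(* For popular [q], [v * quot q * w^-1] factors as [(v * a_l^-1) * (a_l' * w^-1)]
   for many [(l, l')], so multiplication by [Y] is cheap. *)
Lemma covnum_mul_popular V : V `<=` dom 6 ->
  N (mulset (mulset V Y) Ai) <= K ^ 6 * N (mulset V Ai).
Proof.
move=> dV; have dAi : Ai `<=` dom 1 by move=> _ [i _ <-]; dom_tac.
have dVA : mulset V Ai `<=` dom 7.
  by move=> _ [v Vv [w Aw <-]]; dom_tac.
have hX' := hX; set A2 := differences _ _ in hX'.
have dA2 : A2 `<=` dom 2 by exact: difference_sub.
have h : #|X| * N (mulset (mulset V Y) Ai) <= 2 * K * M * M ^ 2 * (N (mulset V Ai) * N A2).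
  apply: (@ruzsa_inequality _ S I).
  - by move=> _ [_ [v Vv [y Yy <-]] [w Aw <-]]; have Yy' := dY Yy; dom_tac.
  - by move=> x h; dom_tac.
  - by move=> x h; dom_tac.
  move=> _ [_ [v Vv [y Yy <-]] [_ [w wX <-] <-]].
  have dy := dY Yy; have [q pq [yq _]] := Yy.
  (* Only the first index of a representation labels the factorization; it determines the second up
     to [M] choices. *)
  exists (fun l => v * (a l)^-1)%g, (fst @: reps q); split.
  - have /and3P[_ _ /leq_trans] := pq; apply; rewrite -[2 * K * M * _]mulnA leq_mul2l.
    apply/orP; right; apply: (@card_le_fibers _ _ fst) => [p|l _]; first exact: imset_f.
    apply: (@packed_around _ S 2 36 _ (fun p => a p.2) _ (a l * quot q)%g) => //.
    + by move=> p _; dom_tac.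
    + move=> [i1 j1] [i2 j2]; rewrite inE => /andP[_ /eqP /= e1].
      rewrite inE => /andP[_ /eqP /= e2] ij; subst.
      by apply: sepa; apply: contraNneq ij => ->.
    + move=> [i1 j1]; rewrite inE => /andP[+ /eqP /= e]; subst.
      rewrite inE => /and3P[_ _ /asboolP[h _]].
      have hq := dquot q; apply: (@near_le _ _ 35) => //.
      rewrite -[a j1](mulVKg (a l)); apply: near_mull h; rewrite /quot /=; dom_tac.
  - move=> _ /imsetP[[l l'] + ->]; rewrite inE => /and3P[lX _ _].
    by exists v => //; exists (a l)^-1%g => //; exists l.
  - move=> l l' _ _ ll' h; apply: (sepa ll').
    have := @near_inv _ _ 1 (a l)^-1%g (a l')^-1%g; rewrite !invgK; apply; try dom_tac.
    by apply: near_mullK h; dom_tac.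
  - move=> _ /imsetP[[l l'] + ->]; rewrite inE => /and3P[/= lX l'X /asboolP[h _]].
    exists (a l' * (a w)^-1)%g; first by exists (l', w).
    have h1 := near_transl (isT : 20 < 35) (isT : 34 < 35) yq h.
    have dq := dquot (l, l').
    have : near 37 (a l * (quot (l, l') * (a w)^-1))%g (a l * (y * (a w)^-1))%g.
      apply: near_mull; try dom_tac; apply: near_mulr; try dom_tac; exact: near_sym.
    by move=> h2; apply: (@near_le _ _ 37) => //; move: h2; rewrite /quot /= !group_simp.
rewrite -(leq_pmul2l X0); apply: leq_trans h _.
apply: (@leq_trans (K * K * K * K ^ 2 * (N (mulset V Ai) * (K * #|X|)))).
  apply: leq_mul; last by rewrite leq_mul2l hX' orbT.
  by rewrite !leq_mul // leq_sqr.
by move: (N _) (#|X|) => x y; lia.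
Qed.

Let dA : A `<=` dom 0. Proof. by move=> _ [i _ <-]; dom_tac. Qed.

Fixpoint mul_quots (t : nat) : set G :=
  if t is t'.+1 then mulset (mul_quots t') Y else A.

Lemma mul_quots_dom t : mul_quots t `<=` dom t.
Proof.
elim: t => //= t IH _ [x Vx [y Yy <-]]; apply: dom_mul; first exact: IH.
by apply: (@dom_le _ _ 0) => //; exact: dY.
Qed.

Lemma covnum_mul_quots t : t <= 6 ->
  N (mulset (mul_quots t) Ai) <= K ^ (6 * t).+1 * #|X|.
Proof.
elim: t => [_|t IH t6] /=.
  apply: leq_trans hX; apply: N_sub => /=; last first.
    by move=> x /(@difference_sub _ S _ a da) h; dom_tac.
  by move=> _ [_ [i iX <-] [_ [j jX <-] <-]]; exists (i, j).
apply: leq_trans (covnum_mul_popular _) _.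
  by move=> x /mul_quots_dom; apply: dom_le; exact: ltnW.
rewrite mulnS -[(6 + _).+1]addnS expnD -mulnA leq_mul2l IH ?orbT //; exact: ltnW.
Qed.

(** With one fixed index [i], left multiplication by [a i] and right multiplication by [(a i)^-1]
    place [Z] inside [X Y^t X^-1], each at the cost of a factor [M]. *)
Lemma covnum_between Z t : t <= 6 ->
  (forall i j z, i \in X -> j \in X -> Z z ->
    mulset (mul_quots t) Ai (a i * z * (a j)^-1)%g) ->
  Z `<=` dom 10 -> N Z <= K ^ (6 * t + 3) * #|X|.
Proof.
move=> t6 hZ dZ; have [i iX] := card_gt0P X0.
have dV : mulset (mul_quots t) Ai `<=` dom 16.
  move=> _ [x /mul_quots_dom Vx [_ [j _ <-] <-]].
  have Vx' : dom 6 x by apply: dom_le Vx.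
  by dom_tac.
have := covnum_mul_quots t6.
have h : N Z <= M * (M * N (mulset (mul_quots t) Ai)).
  apply: leq_trans (@N_lmul_ge _ S (a i) Z _ _) _.
  - by dom_tac.
  - by move=> z Zz; dom_tac.
  rewrite leq_mul2l; apply/orP; right.
  apply: leq_trans (@N_rmul_ge _ S (a i)^-1%g _ _ _) _.
  - by dom_tac.
  - by move=> _ [z Zz <-]; dom_tac.
  rewrite leq_mul2l; apply/orP; right; apply: N_sub => //.
  by move=> _ [_ [z Zz <-] <-]; exact: hZ.
move=> h2; apply: leq_trans h _; apply: (@leq_trans (K * (K * (K ^ (6 * t).+1 * #|X|)))).
  by rewrite !leq_mul.
by rewrite addn3 !expnS !mulnA.
Qed.

(** Ruzsa covering with the star of popular quotients [y t]. Translates [x * y t] over a family with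
    no two members close stay separated inside [Z Y], which bounds the family. For a maximal family
    any [g] has [g * y t'] near some [x * y t], so [x^-1 * g] is nearly [y t * (y t')^-1]. The
    radius 6, well below 20, leaves room for a later error. *)
Lemma cover_by_popular_quots Z c : Z `<=` dom 6 ->
  N (mulset Z Y) <= c * #|X| ->
  exists n (x : 'I_n -> G), [/\ n <= K ^ 4 * c, forall i, Z (x i)
    & forall g, Z g -> exists i, mulset (popular_quot 6) (popular_quot 6) ((x i)^-1 * g)%g].
Proof.
move=> dZ hZ; have [i0] := popular_star; set F := [set t | _]%SET => hF.
have F0 : 0 < #|F| by move: X0 hF; case: (#|F|) => //; rewrite muln0; case: (#|X|).
pose y t := quot (i0, t).
have Yy r t : t \in F -> popular_quot r (y t).
  rewrite inE => tF; exists (i0, t) => //; rewrite quot_swap; split; exact: near_refl.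
have dy t : dom 2 (y t) by exact: dquot.
have dZY : mulset Z Y `<=` dom 7.
  by move=> _ [z Zz [u Yu <-]]; have du := dY Yu; dom_tac.
pose close x x' := exists t t', [/\ t \in F, t' \in F &
  near 3 (x * y t)%g (x' * y t')%g].
have bd n (p : 'I_n -> G) : (forall i, Z (p i)) ->
    (forall i j, i != j -> ~ close (p i) (p j)) -> n <= K ^ 4 * c.
  move=> Zp sp; pose Q := finset.setX [set: 'I_n]%SET F.
  have : #|Q| <= M * N (mulset Z Y).
    apply: (@card_sep_le _ S 0 0 _ (fun q => p q.1 * y q.2)%g) => //.
    - by move=> x h; dom_tac.
    - by move=> q _; have := Zp q.1 => /dZ h; have h2 := dy q.2; dom_tac.
    - move=> [k t] [k' t']; rewrite !inE /= => tF t'F kt h.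
      have [ek|kk'] := eqVneq k k'; last first.
        apply: (sp _ _ kk'); exists t, t'; rewrite !inE; split => //.
        exact: near_le h.
      subst k'; have tt' : t != t' by apply: contraNneq kt => ->.
      have dp := dZ _ (Zp k); have d1 := dy t; have d2 := dy t'.
      by apply: (@sep_quot i0 _ _ tt'); apply: near_mullK h; dom_tac.
    - move=> [k t]; rewrite inE /= => /andP[_ tF].
      exists (p k * y t)%g; last exact: near_refl.
      by exists (p k) => //; exists (y t) => //; exact: Yy.
  rewrite cardsX cardsT card_ord => h; rewrite -(leq_pmul2r F0).
  apply: leq_trans h _; apply: (@leq_trans (K * (c * (K * K * K * #|F|)))).
    apply: leq_mul => //; apply: leq_trans hZ _; rewrite leq_mul2l; apply/orP; right.
    by apply: leq_trans hF _; rewrite !leq_mul.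
  by rewrite [X in X <= _](_ : _ = K ^ 4 * c * #|F|) //; move: (#|F|) => f; lia.
have [|n [x [Zx sx cx]]] := maximal_family _ bd.
  by move=> x x' [t [t' [tF t'F h]]]; exists t', t; split => //; exact: near_sym.
exists n, x; split => //; first exact: bd sx.
move=> g Zg; have [k [t [t' [tF t'F h]]]] := cx _ Zg; exists k.
have dxk := dZ _ (Zx k); have dg := dZ _ Zg; have d1 := dy t; have d2 := dy t'.
have h1 : near 4 (y t) ((x k)^-1 * g * y t')%g.
  apply: (@near_mullK _ _ 3 (x k)); try dom_tac.
  by rewrite -mulgA mulVKg.
(* The whole error goes into the first factor, so that the factorization of [x^-1 * g] is exact. *)
exists ((x k)^-1 * g * y t')%g.
  apply: (popular_quot_near (Yy 0 _ tF) (isT : 0 < 6) (isT : 5 < 6)).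
    by apply: near_sym; exact: near_le h1.
  by apply: near_inv (near_sym h1); dom_tac.
exists (y t')^-1%g; first by apply: popular_quot_inv; exact: Yy.
by rewrite mulgK.
Qed.

(** [H] is [Y Y] rather than [Y] because the covering argument covers by translates of a product of
    two neighbourhoods. The last clause covers [X] itself in this way and keeps the fullest
    translate. *)
Lemma popular_group (H := mulset Y Y) :
  [/\ H `<=` dom 1, forall h, H h -> H (h^-1)%g,
    H !=set0 /\ (exists n (x : 'I_n -> G), [/\ n <= K ^ 40,
      forall i, mulset H H (x i)
      & forall g, mulset H H g -> exists i, H ((x i)^-1 * g)%g]),
    #|X| <= K ^ 4 * N H /\ N H <= K ^ 15 * #|X|
    & exists i0 (X1 : {set I}), [/\ i0 \in X, X1 \subset X, #|X| <= K ^ 12 * #|X1|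
      & forall i, i \in X1 ->
          mulset (popular_quot 6) (popular_quot 6) ((a i0)^-1 * a i)%g]].
Proof.
have dH : H `<=` dom 1.
  by move=> _ [x Yx [y Yy <-]]; have d1 := dY Yx; have d2 := dY Yy; dom_tac.
have dHH : mulset H H `<=` dom 2.
  by move=> _ [x Yx [y Yy <-]]; dom_tac.
have Y6 : popular_quot 6 `<=` Y by exact: popular_quot_le.
have dAi : Ai `<=` dom 1 by move=> _ [i _ <-]; dom_tac.
have mqM t v y : mul_quots t v -> Y y -> mul_quots t.+1 (v * y)%g.
  by move=> hv hy; exists v => //; exists y.
have mqA i : i \in X -> mul_quots 0 (a i) by move=> iX; exists i.
have mqE t v j : mul_quots t v -> j \in X -> mulset (mul_quots t) Ai (v * (a j)^-1)%g.
  by move=> hv jX; exists v => //; exists (a j)^-1%g => //; exists j.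
have [i0] := popular_star; set F := [set t | _]%SET => hF.
have Yq r t : t \in F -> popular_quot r (quot (i0, t)).
  rewrite inE => tF; exists (i0, t) => //; rewrite quot_swap; split; exact: near_refl.
have [t0 t0F] : exists t0, t0 \in F.
  by apply/card_gt0P; move: X0 hF; case: (#|F|) => //; rewrite muln0; case: (#|X|).
split => //.
- move=> _ [x Yx [y Yy <-]]; exists (y^-1)%g; first exact: popular_quot_inv.
  by exists (x^-1)%g; [exact: popular_quot_inv|rewrite invgM].
- split.
    exists (quot (i0, t0) * quot (i0, t0))%g; exists (quot (i0, t0)); first exact: Yq.
    by exists (quot (i0, t0)) => //; exact: Yq.
  (* [H H Y] has five factors [Y], and [6 * 5 + 3 = 33]; the covering adds 4 to the exponent. *)
  have h : N (mulset (mulset H H) Y) <= K ^ 33 * #|X|.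
    apply: (@covnum_between _ 5) => //; last first.
      by move=> _ [x Hx [y Yy <-]]; have d1 := dHH _ Hx; have d2 := dY Yy; dom_tac.
    move=> i j _ iX jX [_ [_ [x1 h1 [x2 h2 <-]] [_ [x3 h3 [x4 h4 <-]] <-]] [x5 h5 <-]].
    by rewrite !mulgA; apply/mqE => //; do 5![apply/mqM => //]; exact: mqA.
  have [|n [x [nx Hx cx]]] := cover_by_popular_quots _ h.
    by move=> x /dHH hx; dom_tac.
  exists n, x; split => //.
    by apply: leq_trans nx _; rewrite -expnD leq_exp2l.
  by move=> g /cx[i hi]; exists i; apply: mulsetS hi.
- split.
    apply: leq_trans hF _; apply: (@leq_trans (K * K * K * (K * N H))); last first.
      by rewrite [X in X <= _](_ : _ = K ^ 4 * N H) //; move: (N H) => f; lia.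
    apply: leq_mul; first by rewrite !leq_mul.
    apply: (@leq_trans (M * N H)); last by rewrite leq_mul2r MK orbT.
    have d0 := dquot (i0, t0).
    have dq t : dom 2 (quot (i0, t)) by exact: dquot.
    apply: (@card_sep_le _ S 0 0 _ (fun t => quot (i0, t0) * quot (i0, t))%g) => //.
    + by move=> x hx; dom_tac.
    + by move=> t _; have := dq t => h; dom_tac.
    + move=> t t' _ _ tt' h; apply: (@sep_quot i0 _ _ tt').
      have d1 := dq t; have d2 := dq t'; apply: near_mullK h; dom_tac.
    + move=> t tF; exists (quot (i0, t0) * quot (i0, t))%g; last exact: near_refl.
      by exists (quot (i0, t0)); [exact: Yq|exists (quot (i0, t)) => //; exact: Yq].
  apply: (@covnum_between _ 2) => //; last by move=> x hx; dom_tac.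
  move=> i j _ iX jX [x1 h1 [x2 h2 <-]].
  by rewrite !mulgA; apply/mqE => //; do 2![apply/mqM => //]; exact: mqA.
(* Here [A] is the set of net points indexed by [X]. Covering it costs [8 + 4 = 12] in the exponent,
   and the pigeonhole principle loses the same factor. *)
have h : N (mulset A Y) <= K ^ 8 * #|X|.
  have [i1 i1X] := card_gt0P X0.
  apply: leq_trans (@N_rmul_ge _ S (a i1)^-1%g _ _ _) _.
  - by dom_tac.
  - by move=> _ [_ [i _ <-] [y Yy <-]]; have d2 := dY Yy; dom_tac.
  apply: (@leq_trans (K * (K ^ 7 * #|X|))); last by rewrite mulnA -expnS.
  apply: leq_mul => //; apply: leq_trans (covnum_mul_quots (isT : 1 <= 6)).
  apply: N_sub; last first.
    move=> _ [x hx [z hz <-]]; have := mul_quots_dom hx => d1; dom_tac.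
  move=> _ [x hx <-]; exists x => //.
  by exists (a i1)^-1%g => //; exists i1.
have [|n [x [nx Ax cx]]] := cover_by_popular_quots _ h.
  by move=> z hz; dom_tac.
have n0 : 0 < n.
  have [i iX] := card_gt0P X0.
  by have [|[k kn] _] := cx (a i); [exists i|apply: leq_ltn_trans kn].
have /choice[f hf] : forall i, exists k, i \in X ->
    mulset (popular_quot 6) (popular_quot 6) ((x k)^-1 * a i)%g.
  move=> i; case iX: (i \in X); last by exists (Ordinal n0).
  by have [|k hk] := cx (a i); [exists i|exists k].
have [k hk] := pigeonhole f X n0.
have [i1 i1X xk] := Ax k.
exists i1, [set i in X | f i == k]; split => //.
- by apply/fintype.subsetP => i; rewrite inE => /andP[].
- apply: leq_trans hk _; rewrite leq_mul2r; apply/orP; right; apply: leq_trans nx _.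
  by rewrite -expnD.
- by move=> i; rewrite inE => /andP[iX /eqP fi]; have := hf i iX; rewrite fi xk.
Qed.
End popular_quotients.

Lemma covered_in (T : Type) (U : finType) (b : T -> T -> Prop) (c : U -> T)
    (Z : {set U}) (X : set T) :
  (forall x, X x -> exists2 z, z \in Z & b (c z) x) -> covered b X #|Z|.
Proof.
move=> h; exists (fun k => c (enum_val k)) => x /h[z zZ hz].
by exists (enum_rank_in zZ z); rewrite enum_rankK_in.
Qed.

Lemma card_le_projections (T U : finType) (F : {set T * U}) (a b : nat) :
  #|fst @: F| <= a -> #|snd @: F| <= b -> #|F| <= a * b.
Proof.
move=> Fa Fb; apply: leq_trans (leq_mul Fa Fb); rewrite -cardsX.
apply: subset_leq_card; apply/fintype.subsetP => x xF.
by rewrite inE !imset_f.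
Qed.

(** * The single implications, for abstract product balls sandwiched between scales 20 and 30 *)

Section implications.
Context {G : groupType} (S : multiscale G).
Local Notation near := (near S).
Local Notation dom := (dom S).
Local Notation M := (mult S).
Local Notation N := (covnum (near 30)).
Variables (b2 : G * G -> G * G -> Prop)
  (b4 : (G * G) * (G * G) -> (G * G) * (G * G) -> Prop) (cl : G -> G -> Prop).
Hypothesis b2_near : forall c p, b2 c p -> near 30 c.1 p.1 /\ near 30 c.2 p.2.
Hypothesis near_b2 : forall c p, near 20 c.1 p.1 -> near 20 c.2 p.2 -> b2 c p.
Hypothesis b4_near : forall c p, b4 c p ->
  [/\ near 30 c.1.1 p.1.1, near 30 c.1.2 p.1.2, near 30 c.2.1 p.2.1
    & near 30 c.2.2 p.2.2].
Hypothesis near_b4 : forall c p, near 20 c.1.1 p.1.1 -> near 20 c.1.2 p.1.2 ->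
  near 20 c.2.1 p.2.1 -> near 20 c.2.2 p.2.2 -> b4 c p.
Hypothesis cl_near : forall x y, cl x y -> near 31 x y.
Hypothesis near_cl : forall x y, near 20 x y -> cl x y.
Variables (A B : set G) (K : nat).
Hypotheses (dA : A `<=` dom 0) (dB : B `<=` dom 0) (A0 : A !=set0) (B0 : B !=set0).
Hypotheses (MK : M <= K) (K1 : 1 < K).

Let Q := [set q | [/\ (A `*` B) q.1, (A `*` B) q.2
    & cl (q.1.1 * q.1.2)%g (q.2.1 * q.2.2)%g]].

Let K0 : 0 < K. Proof. exact: ltnW. Qed.

Lemma net_size X s : 0 < s -> s <= 30 -> X `<=` dom 0 -> exists n (p : 'I_n -> G),
  [/\ forall i, X (p i), forall i j, i != j -> ~ near s (p i) (p j),
      forall x, X x -> exists i, near s (p i) x & N X <= n <= M * N X].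
Proof.
move=> s0 s30 dX; have dX' : X `<=` dom 16 by move=> x Xx; dom_tac.
have [n [p [Xp sp cp]]] := net s0 dX'; exists n, p; split => //.
rewrite (N_le_net s30 cp) /= -[n in n <= _]card_ord -cardsT.
apply: (@card_sep_le _ S s 0 _ p) => // [i _|i j _ _|i _]; first exact: dX'.
  exact: sp.
by exists (p i) => //; exact: near_refl.
Qed.

Lemma energy_nets n m (p : 'I_n -> G) (q : 'I_m -> G) :
  (forall i, dom 0 (p i)) -> (forall i, dom 0 (q i)) ->
  (forall x, A x -> exists i, near 2 (p i) x) ->
  (forall x, B x -> exists i, near 2 (q i) x) ->
  covered b4 Q (\sum_x #|near_products S p q x|).
Proof.
move=> dp dq cp cq.
pose Z := [set z : ('I_n * 'I_m) * ('I_n * 'I_m) | z.2 \in near_products S p q z.1]%SET.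
have <- : #|Z| = \sum_x #|near_products S p q x|.
  rewrite -[#|Z|]sum_nbrs; apply: eq_bigr => x _.
  by apply: eq_card => y; rewrite !inE.
apply: (@covered_in _ _ _ (fun z => ((p z.1.1, q z.1.2), (p z.2.1, q z.2.2)))).
move=> [[x y] [x' y']] [/= [/= Ax By] [/= Ax' By'] /cl_near h].
have [i hi] := cp _ Ax; have [j hj] := cq _ By.
have [i' hi'] := cp _ Ax'; have [j' hj'] := cq _ By'.
exists ((i, j), (i', j')); last first.
  by apply: near_b4 => /=; [exact: near_le hi|exact: near_le hj|exact: near_le hi'|exact: near_le hj'].
rewrite !inE /=; do 2 apply/asboolP.
have h1 : near 4 (p i * q j)%g (x * y)%g.
  by apply: (@near_mul _ _ 2 2) => //; dom_tac.
have h2 : near 4 (p i' * q j')%g (x' * y')%g.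
  by apply: (@near_mul _ _ 2 2) => //; dom_tac.
apply: (@near_transl _ S 4 32 33 _ (x * y)%g) => //.
apply: (@near_transl _ S 31 4 32 _ (x' * y')%g) => //; exact: near_sym.
Qed.

(** Condition (iv) over the natural numbers. Comparisons with the geometric mean are squared to
    avoid roots, and the covering family is not asked to be symmetric; adding inverses at the end
    doubles it. *)
Definition controlled (k : nat) (A B H : set G) (x y : G) : Prop :=
  [/\ H !=set0 /\ (forall h, H h -> H (h^-1)%g),
   exists n (p : 'I_n -> G), [/\ n <= k, forall i, mulset H H (p i)
      & forall g, mulset H H g -> exists i, H ((p i)^-1 * g)%g],
   N H ^ 2 <= k * (N A * N B) /\ N A * N B <= k * N H ^ 2,
   N A <= k * N (A `&` mulset [set x] H)
   & N B <= k * N (B `&` mulset H [set y])].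

Lemma covered_energy_set : exists n, covered b4 Q n.
Proof.
have [n [p [Ap _ cp _]]] := net_size (isT : 0 < 2) (isT : 2 <= 30) dA.
have [m [q [Bq _ cq _]]] := net_size (isT : 0 < 2) (isT : 2 <= 30) dB.
by eexists; apply: energy_nets cp cq => i; [exact: dA|exact: dB].
Qed.

Definition small_product (k : nat) (A B A' B' : set G) : Prop :=
  [/\ A' `<=` A, B' `<=` B, N A <= k * N A', N B <= k * N B'
    & N (mulset A' B') ^ 2 <= k * (N A * N B) /\
      N A * N B <= k * N (mulset A' B') ^ 2].

Definition partial_product (k : nat) (A B : set G) (E : set (G * G)) : Prop :=
  [/\ E `<=` A `*` B, N A * N B <= k * covnum b2 E
    & N [set (e.1 * e.2)%g | e in E] ^ 2 <= k * (N A * N B)].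

(** The product of [x H] and [H y] is [x (H H) y], hence lies in the [n] sets [x (p i) H y]. *)
Lemma covnum_mul_coset H V x y n (p : 'I_n -> G) :
  H `<=` dom 0 -> dom 0 x -> dom 0 y ->
  (forall i, mulset H H (p i)) ->
  (forall g, mulset H H g -> exists i, H ((p i)^-1 * g)%g) ->
  V `<=` mulset (mulset [set x] H) (mulset H [set y]) ->
  N V <= M * (n * N H).
Proof.
move=> dH dx dy Hp cp hV.
have dp i : dom 1 (p i) by have [h Hh [h' Hh' <-]] := Hp i; dom_tac.
have dV : V `<=` dom 2.
  move=> g /hV[_ [_ -> [h Hh <-]] [_ [h' Hh' [_ -> <-]] <-]]; dom_tac.
have dV' : V `<=` dom 16 by move=> g Vg; dom_tac.
have dH' : H `<=` dom 16 by move=> g Vg; dom_tac.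
have [l [z [Vz sz cz]]] := net (isT : 0 < 1) dV'.
apply: leq_trans (N_le_net (isT : 1 <= 30) cz) _.
have [c hc] := covnumP dH'.
have -> : n * N H = #|{: 'I_n * 'I_(N H)}| by rewrite card_prod !card_ord.
rewrite -[l in l <= _]card_ord -cardsT.
apply: (card_le_related (r := fun t ik =>
    near 30 (c ik.2) ((p ik.1)^-1 * (x^-1 * z t * y^-1))%g)).
  move=> t _; have [_ [_ -> [h Hh <-]] [_ [h' Hh' [_ -> <-]] e]] := hV _ (Vz t).
  have [i hi] := cp (h * h')%g (ex_intro2 _ _ h Hh (ex_intro2 _ _ h' Hh' erefl)).
  by have [k hk] := hc _ hi; exists (i, k); move: hk; rewrite /= -e !group_simp.
move=> [i k] F hF /=; have dpi := dp i.
apply: (@packed _ S 1 35 _ z) => // [t _|t t' _ _|t t' tF t'F].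
- exact: dV'.
- exact: sz.
have [_ /= h] := hF _ tF; have [_ /= h'] := hF _ t'F.
have dt := dV _ (Vz t); have dt' := dV _ (Vz t').
have := near_trans (near_sym h) h'.
move=> /(@near_mull _ _ _ (x * p i)%g) h1.
have /(@near_mulr _ _ _ y) h2 : near 32 (x * p i * ((p i)^-1 * (x^-1 * z t * y^-1)))%g
    (x * p i * ((p i)^-1 * (x^-1 * z t' * y^-1)))%g by apply: h1; dom_tac.
apply: (@near_le _ _ 33) => //.
have : near 33 (x * p i * ((p i)^-1 * (x^-1 * z t * y^-1)) * y)%g
    (x * p i * ((p i)^-1 * (x^-1 * z t' * y^-1)) * y)%g by apply: h2; dom_tac.
by rewrite !group_simp.
Qed.

Lemma N_gt0_nonempty X : 0 < N X -> X !=set0.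
Proof.
move=> N0; apply/set0P/eqP => e; move: N0; rewrite e ltnNge => /negP; apply.
by apply: covnum_le; exists (fun=> 1%g).
Qed.

Lemma covnum_mulset_ge A' B' : A' `<=` A -> B' `<=` B -> A' !=set0 -> B' !=set0 ->
  N A' <= M * N (mulset A' B') /\ N B' <= M * N (mulset A' B').
Proof.
move=> AA BB [a Aa] [b Bb].
have dA' : A' `<=` dom 0 by move=> z /AA; exact: dA.
have dB' : B' `<=` dom 0 by move=> z /BB; exact: dB.
have dAB : mulset A' B' `<=` dom 16.
  by move=> _ [u Au [v Bv <-]]; dom_tac.
split.
  apply: leq_trans (@N_rmul_ge _ S b _ _ _) _; first by dom_tac.
    by move=> u Au; dom_tac.
  rewrite leq_mul2l; apply/orP; right; apply: N_sub => // _ [u Au <-].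
  by exists u => //; exists b.
apply: leq_trans (@N_lmul_ge _ S a _ _ _) _; first by dom_tac.
  by move=> u Au; dom_tac.
rewrite leq_mul2l; apply/orP; right; apply: N_sub => // _ [u Au <-].
by exists a => //; exists u.
Qed.

Let NA0 : 0 < N A. Proof. by apply: N_gt0 => // u Au; dom_tac. Qed.
Let NB0 : 0 < N B. Proof. by apply: N_gt0 => // u Au; dom_tac. Qed.

(** Take the parts of [A] and [B] in the cosets. Their product is bounded above by
    [covnum_mul_coset], and below because it contains a translate of each part. *)
Lemma small_product_of_controlled H x y : H `<=` dom 0 -> dom 0 x -> dom 0 y ->
  controlled K A B H x y -> exists A' B', small_product (K ^ 5) A B A' B'.
Proof.
move=> dH dx dy [_ [n [p [nK Hp cp]]] [NH1 NH2] NA NB].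
set A' := A `&` _ in NA; set B' := B `&` _ in NB.
have A'0 : A' !=set0.
  by apply: N_gt0_nonempty; move: NA; case: (N A') => //; rewrite muln0 leqNgt NA0.
have B'0 : B' !=set0.
  by apply: N_gt0_nonempty; move: NB; case: (N B') => //; rewrite muln0 leqNgt NB0.
have sA : A' `<=` A by move=> u [].
have sB : B' `<=` B by move=> u [].
have [gA gB] := covnum_mulset_ge sA sB A'0 B'0.
have KK : K <= K ^ 5 by rewrite -{1}(expn1 K) leq_exp2l.
exists A', B'; split => //.
- by apply: leq_trans NA _; rewrite leq_mul2r KK orbT.
- by apply: leq_trans NB _; rewrite leq_mul2r KK orbT.
split.
  have h : N (mulset A' B') <= M * (n * N H).
    apply: (@covnum_mul_coset H _ x y) => //.
    by apply: mulsetS => u [].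
  apply: (@leq_trans ((K * (K * N H)) ^ 2)).
    by rewrite leq_sqr; apply: leq_trans h _; rewrite !leq_mul.
  rewrite [X in X <= _](_ : _ = K ^ 4 * N H ^ 2); last first.
    by move: (N H) => c; lia.
  by rewrite (expnSr K 4) -mulnA leq_mul2l NH1 orbT.
apply: (@leq_trans (K * (K * N (mulset A' B')) * (K * (K * N (mulset A' B'))))).
  apply: leq_mul; [apply: leq_trans NA _|apply: leq_trans NB _]; rewrite leq_mul //.
    by apply: leq_trans gA _; rewrite leq_mul2r MK orbT.
  by apply: leq_trans gB _; rewrite leq_mul2r MK orbT.
rewrite [X in X <= _](_ : _ = K ^ 4 * N (mulset A' B') ^ 2); last first.
  by move: (N (mulset A' B')) => c; lia.
by rewrite leq_mul2r leq_exp2l ?orbT.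
Qed.

Lemma covered_b2 E : E `<=` A `*` B -> exists n, covered b2 E n.
Proof.
move=> hE.
have [n [p [_ _ cp _]]] := net_size (isT : 0 < 2) (isT : 2 <= 30) dA.
have [m [q [_ _ cq _]]] := net_size (isT : 0 < 2) (isT : 2 <= 30) dB.
exists #|{: 'I_n * 'I_m}|; apply: (@covered_family _ _ _ (fun ij => (p ij.1, q ij.2))).
move=> e /hE[/= /cp[i hi] /cq[j hj]]; exists (i, j).
by apply: near_b2; [exact: near_le hi|exact: near_le hj].
Qed.

Lemma partial_product_of_small A' B' : small_product K A B A' B' ->
  partial_product (K ^ 4) A B (A' `*` B').
Proof.
move=> [sA sB NA NB [NAB _]].
have dA' : A' `<=` dom 0 by move=> z /sA; exact: dA.
have dB' : B' `<=` dom 0 by move=> z /sB; exact: dB.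
have sE : A' `*` B' `<=` A `*` B by move=> e [/sA e1 /sB e2].
split => //; last first.
  rewrite (_ : [set _ | _ in _] = mulset A' B').
    by apply: leq_trans NAB _; rewrite leq_mul2r -{1}(expn1 K) leq_exp2l ?orbT.
  apply/seteqP; split => [_ [[u v] [/= Au Bv] <-]|_ [u Au [v Bv <-]]].
    by exists u => //; exists v.
  by exists (u, v).
have [n [p [Ap sp cp /andP[nA _]]]] := net_size (isT : 0 < 2) (isT : 2 <= 30) dA'.
have [m [q [Bq sq cq /andP[mB _]]]] := net_size (isT : 0 < 2) (isT : 2 <= 30) dB'.
have h : n * m <= M * M * covnum b2 (A' `*` B').
  have [c0 /covered_covnum[c hc]] := covered_b2 sE.
  rewrite -[n in n * _]card_ord -[m in _ * m]card_ord -card_prod -cardsT.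
  rewrite -[covnum b2 _]card_ord; apply: (card_le_related (r := fun ij k =>
    b2 (c k) (p ij.1, q ij.2))).
    by move=> [i j] _; apply: hc; split; [exact: Ap|exact: Bq].
  move=> k F hF; apply: card_le_projections.
    apply: (@packed_around _ S 2 30 _ p _ (c k).1) => // [i _|i j _ _|_ /imsetP[[i j] ijF ->]].
    - by have := dA' _ (Ap i) => h; dom_tac.
    - exact: sp.
    - by have [_ /b2_near[]] := hF _ ijF.
  apply: (@packed_around _ S 2 30 _ q _ (c k).2) => // [i _|i j _ _|_ /imsetP[[i j] ijF ->]].
  - by have := dB' _ (Bq i) => h; dom_tac.
  - exact: sq.
  - by have [_ /b2_near[]] := hF _ ijF.
apply: (@leq_trans (K * n * (K * m))).
  apply: leq_mul; [apply: leq_trans NA _|apply: leq_trans NB _]; exact: leq_mul.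
rewrite mulnACA; apply: (@leq_trans (K * K * (K * K * covnum b2 (A' `*` B')))).
  by rewrite leq_mul2l; apply/orP; right; apply: leq_trans h _; rewrite !leq_mul.
by rewrite mulnA leq_mul2r; apply/orP; right; rewrite !expnS expn0 muln1 !mulnA.
Qed.

(** Net pairs near [E] are mapped to a net of the products. Two pairs with the same image come from
    points of [E] whose products are close, hence give a point of [Q], and a ball of [b4] receives
    at most [M ^ 4] of these. *)
Lemma energy_of_partial_product E : partial_product K A B E ->
  (N A) ^ 3 * (N B) ^ 3 <= (K ^ 8) ^ 2 * covnum b4 Q ^ 2.
Proof.
move=> [sE NE NP].
have [n [p [Ap sp cp _]]] := net_size (isT : 0 < 2) (isT : 2 <= 30) dA.
have [m [q [Bq sq cq _]]] := net_size (isT : 0 < 2) (isT : 2 <= 30) dB.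
have dp i : dom 0 (p i) by exact: dA.
have dq i : dom 0 (q i) by exact: dB.
pose T := [set ij : 'I_n * 'I_m | `[< exists2 e, E e &
  near 2 (p ij.1) e.1 /\ near 2 (q ij.2) e.2 >]]%SET.
have TP ij : ij \in T -> exists2 e, E e & near 2 (p ij.1) e.1 /\ near 2 (q ij.2) e.2.
  by rewrite inE => /asboolP.
have NT : covnum b2 E <= #|T|.
  apply: covnum_le; apply: (@covered_in _ _ _ (fun ij => (p ij.1, q ij.2))).
  move=> e Ee; have [/= /cp[i hi] /cq[j hj]] := sE _ Ee; exists (i, j).
    by rewrite inE; apply/asboolP; exists e.
  by apply: near_b2; [exact: near_le hi|exact: near_le hj].
(* The product of a net pair need not lie in [P]; that of a point of [E] near the pair does. *)
have /choice[e he] : forall ij, exists e, ij \in T ->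
    [/\ E e, near 2 (p ij.1) e.1 & near 2 (q ij.2) e.2].
  move=> ij; case ijT: (ij \in T); last by exists (1%g, 1%g).
  by have [e Ee [h1 h2]] := TP _ ijT; exists e.
set P := [set _ | _ in E] in NP.
have dP : P `<=` dom 1.
  move=> _ [[u v] /sE[/= Au Bv] <-]; have d1 := dA Au; have d2 := dB Bv.
  exact: dom_mul.
have dP' : P `<=` dom 16 by move=> z Pz; dom_tac.
have [l [z [Pz sz cz]]] := net (isT : 0 < 1) dP'.
have lP : l <= M * N P.
  rewrite -[l in l <= _]card_ord -cardsT; apply: (@card_sep_le _ S 1 0 _ z) => //.
  - by move=> i _; exact: dP'.
  - by move=> i j _ _; exact: sz.
  - by move=> i _; exists (z i) => //; exact: near_refl.
have NE0 : 0 < #|T|.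
  apply: leq_trans NT; have : 0 < N A * N B by rewrite muln_gt0 NA0 NB0.
  by move=> /leq_trans /(_ NE); case: (covnum b2 E) => //; rewrite muln0.
have eP ij : ij \in T -> P ((e ij).1 * (e ij).2)%g.
  by move=> /he[Ee _ _]; exists (e ij).
have [ij0 ij0T] := card_gt0P NE0.
have [t0 _] := cz _ (eP _ ij0T).
have /choice[f hf] : forall ij, exists t, ij \in T -> near 1 (z t) ((e ij).1 * (e ij).2)%g.
  move=> ij; case ijT: (ij \in T); last by exists t0.
  by have [t ht] := cz _ (eP _ ijT); exists t.
have := card_collisions f T; rewrite card_ord; set C := [set _ | _]%SET => hC.
have CE : #|C| <= M * M * (M * M) * covnum b4 Q.
  have [c hc] := covered_covnum (energy_nets dp dq cp cq).
  rewrite -[covnum b4 Q]card_ord; apply: (card_le_related (r := fun t k =>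
    b4 (c k) (e t.1, e t.2))).
    move=> [t t']; rewrite inE => /and3P[/= tT t'T /eqP ff]; apply: hc.
    have [Et _ _] := he _ tT; have [Et' _ _] := he _ t'T.
    split; [exact: sE|exact: sE|apply: near_cl => /=].
    have h1 := hf _ tT; have h2 := hf _ t'T; rewrite -ff in h2.
    exact: (@near_transl _ S 1 1 20 _ _ _ isT isT (near_sym h1) h2).
  move=> k F hF.
  have hF1 t : t \in F -> t.1 \in T /\ t.2 \in T.
    by move=> /hF[]; rewrite inE => /and3P[].
  have n1 u v w : near 30 u v -> near 2 w v -> near 31 u w.
    by move=> h1 h2; apply: near_trans h1 _; apply: near_sym; exact: near_le h2.
  apply: card_le_projections; apply: card_le_projections.
  - apply: (@packed_around _ S 2 31 _ p _ (c k).1.1) => // [i _|i j _ _|].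
    + by dom_tac.
    + exact: sp.
    + move=> _ /imsetP[_ /imsetP[t tF ->] ->]; have [_ /b4_near[b _ _ _]] := hF _ tF.
      by have [/he[_ h _] _] := hF1 _ tF; exact: n1 b h.
  - apply: (@packed_around _ S 2 31 _ q _ (c k).1.2) => // [i _|i j _ _|].
    + by dom_tac.
    + exact: sq.
    + move=> _ /imsetP[_ /imsetP[t tF ->] ->]; have [_ /b4_near[_ b _ _]] := hF _ tF.
      by have [/he[_ _ h] _] := hF1 _ tF; exact: n1 b h.
  - apply: (@packed_around _ S 2 31 _ p _ (c k).2.1) => // [i _|i j _ _|].
    + by dom_tac.
    + exact: sp.
    + move=> _ /imsetP[_ /imsetP[t tF ->] ->]; have [_ /b4_near[_ _ b _]] := hF _ tF.
      by have [_ /he[_ h _]] := hF1 _ tF; exact: n1 b h.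
  - apply: (@packed_around _ S 2 31 _ q _ (c k).2.2) => // [i _|i j _ _|].
    + by dom_tac.
    + exact: sq.
    + move=> _ /imsetP[_ /imsetP[t tF ->] ->]; have [_ /b4_near[_ _ _ b]] := hF _ tF.
      by have [_ /he[_ _ h]] := hF1 _ tF; exact: n1 b h.
have h1 : (N A * N B) ^ 2 <= K ^ 7 * (N P * covnum b4 Q).
  apply: (@leq_trans ((K * #|T|) ^ 2)).
    by rewrite leq_sqr; apply: leq_trans NE _; rewrite leq_mul2l NT orbT.
  rewrite expnMn (expnD K 2 5) -mulnA leq_mul2l; apply/orP; right.
  apply: leq_trans hC _; apply: (leq_trans (leq_mul lP CE)).
  rewrite [X in X <= _](_ : _ = M ^ 5 * (N P * covnum b4 Q)); last first.
    by move: (N P) (covnum b4 Q) => c d; lia.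
  by rewrite leq_mul2r leq_exp2r // MK orbT.
(* The bound [NP] concerns [N P ^ 2], so [h1] is squared, and one surplus factor [N A * N B] is
   cancelled. *)
have NN0 : 0 < N A * N B by rewrite muln_gt0 NA0 NB0.
rewrite -expnMn -(leq_pmul2r NN0) -expnSr.
rewrite (expnM _ 2 2 : (N A * N B) ^ 4 = _).
apply: (@leq_trans ((K ^ 7 * (N P * covnum b4 Q)) ^ 2)); first by rewrite leq_sqr.
rewrite [X in X <= _](_ : _ = K ^ 14 * covnum b4 Q ^ 2 * N P ^ 2); last first.
  by move: (N P) (covnum b4 Q) => c d; lia.
apply: (@leq_trans (K ^ 14 * covnum b4 Q ^ 2 * (K * (N A * N B)))).
  by rewrite leq_mul2l NP orbT.
rewrite mulnA leq_mul2r; apply/orP; right.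
rewrite mulnAC -expnSr -expnM leq_mul2r leq_exp2l ?orbT //.
Qed.

(** [op] stands for openness. [Y0] contains every possible [Y] and [Kt] every possible [H], [x],
    [y]; both are to depend on the compact set only, not on [A], [B] or the scale. *)
Variables (op : set G -> Prop) (Y0 Kt : set G).
Hypothesis op_near : forall (T : Type) (P : T -> bool) (z z' : T -> G) r,
  op [set g | exists2 q, P q & near r g (z q) /\ near r (g^-1)%g (z' q)].
Hypothesis op_mul : forall U V, op U -> op V -> op (mulset U V).
Hypothesis hY0 : forall x y g, A x -> A y -> near 20 g (x^-1 * y)%g ->
  near 20 (g^-1)%g (y^-1 * x)%g -> Y0 g.
Hypothesis dY0 : Y0 `<=` dom 0.
Hypothesis hKt : [/\ A `<=` Kt, mulset Y0 Y0 `<=` Kt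
  & forall x a b, A x -> A a -> B b -> Kt (x^-1 * (a * b))%g].

(** The three nested powers mirror three stages: 21 for the dense graph, 40 for the difference set,
    40 for the group and its cosets. *)
Lemma controlled_of_energy : (N A) ^ 3 * (N B) ^ 3 <= K ^ 2 * covnum b4 Q ^ 2 ->
  exists H x y, [/\ controlled (((K ^ 21) ^ 40) ^ 40) A B H x y, op H, H `<=` Kt, Kt x & Kt y].
Proof.
move=> hE.
have [n [p [Ap sp cp /andP[nA An]]]] := net_size (isT : 0 < 2) (isT : 2 <= 30) dA.
have [m [q [Bq sq cq /andP[mB Bm]]]] := net_size (isT : 0 < 2) (isT : 2 <= 30) dB.
have dp i : dom 0 (p i) by exact: dA.
have dq i : dom 0 (q i) by exact: dB.
have n0 : 0 < #|'I_n|.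
  by rewrite card_ord; apply: leq_trans nA; apply: N_gt0 => // x Ax; dom_tac.
have m0 : 0 < #|'I_m|.
  by rewrite card_ord; apply: leq_trans mB; apply: N_gt0 => // x Bx; dom_tac.
have hE2 : #|'I_n| ^ 3 * #|'I_m| ^ 3 <= (K ^ 4) ^ 2 * (\sum_x #|near_products S p q x|) ^ 2.
  rewrite !card_ord; apply: (@leq_trans ((K * N A) ^ 3 * (K * N B) ^ 3)).
    by apply: leq_mul; rewrite leq_exp2r //; [apply: leq_trans An _|apply: leq_trans Bm _]; rewrite leq_mul2r MK orbT.
  rewrite [X in X <= _](_ : _ = K ^ 6 * (N A ^ 3 * N B ^ 3)); last first.
    by rewrite !expnMn; move: (N A ^ 3) (N B ^ 3) => x y; lia.
  apply: (@leq_trans (K ^ 6 * (K ^ 2 * (\sum_x #|near_products S p q x|) ^ 2))).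
    rewrite leq_mul2l; apply/orP; right; apply: leq_trans hE _.
    by rewrite leq_mul2l leq_sqr covnum_le ?orbT //; exact: energy_nets.
  by rewrite mulnA -expnD -expnM.
have K40 : 0 < K ^ 4 by rewrite expn_gt0 K0.
have [Im In [E0 [cE0 NP]]] := popular_products dp dq sp sq n0 m0 K40 hE2.
(* [popular_products] costs [K ^ 11], and expressing its bound by [#|I|] instead of [#|J|] costs
   [K ^ 10] more. *)
set K2 := K ^ 21.
have K2_gt1 : 1 < K2 by rewrite -(exp1n 21) ltn_exp2r.
have MK2 : M <= K2 by apply: leq_trans MK _; rewrite -{1}(expn1 K) leq_exp2l.
have b10 : (K ^ 4) ^ 2 * M ^ 2 <= K ^ 10.
  by rewrite -expnM (expnD K 8 2) leq_mul2l leq_sqr MK orbT.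
have b11 : 2 * (K ^ 4) ^ 2 * M ^ 2 <= K ^ 11.
  by rewrite -mulnA (expnS K 10) leq_mul.
have cE : #|'I_n| * #|'I_m| <= K2 * #|E0|.
  apply: leq_trans cE0 _; rewrite leq_mul2r; apply/orP; right.
  by apply: leq_trans b11 _; rewrite leq_exp2l.
have {}In : #|'I_n| <= K2 * #|'I_m|.
  apply: leq_trans In _; rewrite leq_mul2r; apply/orP; right.
  by apply: leq_trans b10 _; rewrite leq_exp2l.
have {}NP : N [set (p x.1 * q x.2)%g | x in [set` E0]] <= K2 * #|'I_n|.
  apply: leq_trans NP _; rewrite /K2.
  rewrite [X in _ <= X](_ : _ = K ^ 11 * (K ^ 10 * #|'I_n|)); last by rewrite mulnA -expnD.
  apply: leq_mul => //.
  by apply: leq_trans Im _; rewrite leq_mul2r b10 orbT.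
have {}Im : #|'I_m| <= K2 * #|'I_n|.
  apply: leq_trans Im _; rewrite leq_mul2r; apply/orP; right.
  by apply: leq_trans b10 _; rewrite leq_exp2l.
have [X [nX hX NX]] := small_difference_set dp dq sp sq MK2 K2_gt1 n0 m0 cE In NP.
clearbody K2; clear cE cE0 hE2 b10 b11 K40.
have K20 : 0 < K2 by exact: ltnW.
have X0 : 0 < #|X| by move: nX; case: (#|X|) => //; rewrite muln0 leqNgt n0.
set L := K2 ^ 40; fold L in NX.
have K2L : K2 <= L by rewrite -{1}(expn1 K2) leq_exp2l.
have L1 : 1 < L by exact: leq_trans K2L.
have ML : M <= L by exact: leq_trans K2L.
have K2e e : e <= 40 -> K2 ^ e <= L by move=> e40; rewrite leq_exp2l.
have dY r : r <= 20 -> popular_quot S p X L r `<=` Y0.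
  move=> r20 g [[i i'] _ [h1 h2]]; apply: (hY0 (Ap i) (Ap i')).
    exact: near_le h1.
  exact: near_le h2.
have dY' : popular_quot S p X L 20 `<=` dom 0.
  by move=> g /(dY 20 isT) /dY0.
have [] := popular_group dp sp ML L1 X0 NX dY'.
set H := mulset _ _ => dH Hinv [HN0 Hcov] [XH HX] [i0 [X1 [i0X X1X cX1 hX1]]].
have L0 : 0 < L by exact: ltnW.
have Le a c : a <= c -> L ^ a <= L ^ c by move=> ac; rewrite leq_pexp2l.
have dp0 := dp i0.
have hx5 i : i \in X1 -> exists u v, [/\ popular_quot S p X L 6 u, popular_quot S p X L 6 v
    & p i = (p i0 * (u * v))%g].
  by move=> /hX1[u hu [v hv huv]]; exists u, v; split => //; rewrite huv mulVKg.
have sub20 r : r <= 20 -> popular_quot S p X L r `<=` popular_quot S p X L 20.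
  by move=> r20; exact: popular_quot_le.
have X10 : 0 < #|X1| by move: cX1; case: (#|X1|) => //; rewrite muln0 leqNgt X0.
have nX1 : #|'I_n| <= L ^ 13 * #|X1|.
  apply: leq_trans nX _; apply: (@leq_trans (L * (L ^ 12 * #|X1|))).
    by apply: leq_mul => //; exact: K2e.
  by rewrite mulnA -expnS.
(* The degree bound kept for every index of [X] makes the graph dense over [X1], however [X1] was
   selected. *)
pose E1 := [set e in E0 | e.1 \in X1]%SET.
have cE1 : #|X1| * #|'I_m| <= 2 * K2 * #|E1|.
  rewrite -sum_nat_const -(sum_nbrs E1) big_distrr /= big_mkcond.
  apply: leq_sum => i _; case: ifP => // iX1.
  apply: leq_trans (hX _ (fintype.subsetP X1X _ iX1)) _.
  rewrite leq_mul2l; apply/orP; right; apply: subset_leq_card.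
  by apply/fintype.subsetP => j; rewrite !inE /= iX1 andbT.
set P := [set _ | _ in _] in NP.
have dP : P `<=` dom 1 by move=> _ [e _ <-]; dom_tac.
have dP' : P `<=` dom 16 by move=> z Pz; dom_tac.
have [l [z [Pz sz cz]]] := net (isT : 0 < 1) dP'.
have lP : l <= M * N P.
  rewrite -[l in l <= _]card_ord -cardsT; apply: (@card_sep_le _ S 1 0 _ z) => //.
  - by move=> i _; exact: dP'.
  - by move=> i j _ _; exact: sz.
  - by move=> i _; exists (z i) => //; exact: near_refl.
have [e0 e0E1] : exists e, e \in E1.
  apply/card_gt0P; have : 0 < #|X1| * #|'I_m| by rewrite muln_gt0 X10.
  by move=> /leq_trans /(_ cE1); case: (#|E1|) => //; rewrite muln0.
have E1P e : e \in E1 -> P (p e.1 * q e.2)%g.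
  by rewrite inE => /andP[eE0 _]; exists e.
have l0 : 0 < l.
  by have [t _] := cz _ (E1P _ e0E1); apply: leq_ltn_trans (ltn_ord t).
have /choice[f hf] : forall e, exists t, e \in E1 -> near 1 (z t) (p e.1 * q e.2)%g.
  move=> e; case eE1 : (e \in E1); last by exists (Ordinal l0).
  by have [t ht] := cz _ (E1P _ eE1); exists t.
(* The products over [E0] need few net points, so many edges over [X1] have nearly the same product
   [z t]. *)
have [t ht] := pigeonhole f E1 l0.
set F := [set x in E1 | f x == t]%SET in ht.
pose J1 := (snd @: F)%SET.
have dz : dom 1 (z t) by exact: dP.
have hJ1 : #|F| <= M * #|J1|.
  apply: (@card_le_fibers _ _ snd) => [e eF|j _]; first exact: imset_f.
  apply: (@packed_around _ S 2 3 _ (fun e => p e.1) _ (z t * (q j)^-1)%g) => //.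
  - by move=> e _; dom_tac.
  - move=> [i1 j1] [i2 j2]; rewrite inE => /andP[_ /eqP /= e1].
    rewrite inE => /andP[_ /eqP /= e2] ij; subst.
    by apply: sp; apply: contraNneq ij => ->.
  - move=> [i j1]; rewrite inE => /andP[+ /eqP /= e]; subst.
    rewrite inE => /andP[eE1 /eqP et]; have := hf _ eE1; rewrite et /= => h.
    apply: (@near_le _ _ 2) => //; rewrite -[p i](mulgK (q j)).
    by apply: near_mulr h; dom_tac.
have mJ1 : #|'I_m| <= L ^ 18 * #|J1|.
  rewrite -(leq_pmul2l X10); apply: leq_trans cE1 _.
  apply: (@leq_trans (L * L * (L * (L * (L ^ 13 * #|X1|)) * (L * #|J1|)))); last first.
    by rewrite [X in X <= _](_ : _ = #|X1| * (L ^ 18 * #|J1|)) //; move: (#|X1|) (#|J1|) => x y; lia.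
  apply: leq_mul; first by rewrite leq_mul.
  apply: leq_trans ht _; apply: leq_mul.
    apply: leq_trans lP _; apply: leq_mul => //; apply: leq_trans NP _; exact: leq_mul.
  by apply: leq_trans hJ1 _; apply: leq_mul.
pose x := p i0; pose y := (x^-1 * z t)%g.
have hJ j : j \in J1 -> mulset H [set y] (q j).
  move=> /imsetP[[i j'] + ->]; rewrite inE => /andP[eE1 /eqP et] /=.
  have := hf _ eE1; rewrite et /= => /near_sym h.
  have iX1 : i \in X1 by move: eE1; rewrite inE => /andP[].
  have [u [v [hu hv puv]]] := hx5 _ iX1.
  have du : dom 0 u by apply/dY'/(sub20 6).
  have dv : dom 0 v by apply/dY'/(sub20 6).
  exists (v^-1 * (v * (q j' * (z t)^-1 * x)))%g; last first.
    by exists y => //; rewrite /y !group_simp.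
  (* With [p i = x u v] and [p i * q j'] near [z t], the element [q j' * (z t)^-1 * x] is nearly
     [v^-1 * u^-1]. The factor [v^-1] is kept exact, and the other one is within scale 5 of [u^-1],
     so radius 6 grows to less than 20. *)
  exists (v^-1)%g; first by apply: popular_quot_inv; exact: (sub20 6).
  exists (v * (q j' * (z t)^-1 * x))%g => //.
  have e1 : (v * (q j' * (z t)^-1 * x))%g =
      (u^-1 * (x^-1 * (p i * q j' * (z t)^-1) * x))%g.
    by rewrite puv /x !group_simp.
  have dx : dom 0 x by exact: dp.
  have n2 : near 2 (p i * q j' * (z t)^-1)%g 1%g.
    by rewrite -(mulgV (z t)); apply: near_mulr h; dom_tac.
  have n4 : near 4 (x^-1 * (p i * q j' * (z t)^-1) * x)%g (x^-1 * 1 * x)%g.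
    by apply: near_mulr; try dom_tac; apply: near_mull n2; dom_tac.
  have n5 : near 5 (u^-1 * (x^-1 * (p i * q j' * (z t)^-1) * x))%g (u^-1)%g.
    have e : (u^-1 = u^-1 * (x^-1 * 1 * x))%g by rewrite mulg1 mulVg mulg1.
    by rewrite [X in near _ _ X]e; apply: near_mull n4; dom_tac.
  apply: (popular_quot_near (popular_quot_inv hu) (isT : 6 < 20) (isT : 6 < 20)).
    by rewrite e1; exact: near_le n5.
  by rewrite e1; apply: near_inv n5; dom_tac.
have dAx : A `&` mulset [set x] H `<=` dom 16 by move=> g [Ag _]; dom_tac.
have dBy : B `&` mulset H [set y] `<=` dom 16 by move=> g [Bg _]; dom_tac.
have HX1 : #|X1| <= L * N (A `&` mulset [set x] H).
  apply: (@leq_trans (M * N (A `&` mulset [set x] H))); last by rewrite leq_mul2r ML orbT.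
  apply: (@card_sep_le _ S 2 0 _ p) => // [i _|i j _ _|i iX1]; first by dom_tac.
    exact: sp.
  exists (p i); last exact: near_refl.
  split=> //; have [u [v [hu hv ->]]] := hx5 _ iX1.
  exists x => //; exists (u * v)%g => //.
  by exists u; [exact: (sub20 6)|exists v => //; exact: (sub20 6)].
have HJ1 : #|J1| <= L * N (B `&` mulset H [set y]).
  apply: (@leq_trans (M * N (B `&` mulset H [set y]))); last by rewrite leq_mul2r ML orbT.
  apply: (@card_sep_le _ S 2 0 _ q) => // [i _|i j _ _|i iX1]; first by dom_tac.
    exact: sq.
  exists (q i); last exact: near_refl.
  by split=> //; exact: hJ.
have XI : #|X| <= #|'I_n| by exact: max_card.
have nL : #|'I_n| <= L * N A by rewrite card_ord; apply: leq_trans An _; rewrite leq_mul2r ML orbT.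
have mL : #|'I_m| <= L * N B by rewrite card_ord; apply: leq_trans Bm _; rewrite leq_mul2r ML orbT.
have cnt1 : N H ^ 2 <= L ^ 40 * (N A * N B).
  apply: (@leq_trans ((L ^ 15 * #|X|) ^ 2)); first by rewrite leq_sqr.
  apply: (@leq_trans (L ^ 33 * (N A * N B))); last by rewrite leq_mul2r Le ?orbT.
  rewrite expnMn -expnM (expnD L 30 3) -mulnA leq_mul2l -mulnn; apply/orP; right.
  apply: (@leq_trans (L * N A * (L * (L * N B)))).
    apply: leq_mul; first exact: leq_trans XI nL.
    by apply: leq_trans XI _; apply: leq_trans In _; exact: leq_mul.
  by rewrite [X in X <= _](_ : _ = L ^ 3 * (N A * N B)) //; move: (N A) (N B) => c d; lia.
have cnt2 : N A * N B <= L ^ 40 * N H ^ 2.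
  apply: (@leq_trans (L ^ 11 * N H ^ 2)); last by rewrite leq_mul2r Le ?orbT.
  apply: (@leq_trans (#|'I_n| * #|'I_m|)); first by rewrite !card_ord leq_mul.
  have nX' : #|'I_n| <= L * (L ^ 4 * N H).
    by apply: leq_trans nX _; apply: leq_mul => //; exact: K2e.
  apply: (@leq_trans (L * (L ^ 4 * N H) * (L * (L * (L ^ 4 * N H))))).
    by apply: leq_mul => //; apply: leq_trans Im _; exact: leq_mul.
  by rewrite [X in X <= _](_ : _ = L ^ 11 * N H ^ 2) //; move: (N H) => c; lia.
exists H, x, y; split.
- split => //.
  + apply: leq_trans nA _; rewrite -{1}[n]card_ord; apply: leq_trans nX1 _.
    apply: (@leq_trans (L ^ 13 * (L * N (A `&` mulset [set x] H)))); first exact: leq_mul.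
    by rewrite mulnA -expnSr leq_mul2r Le ?orbT.
  + apply: leq_trans mB _; rewrite -{1}[m]card_ord; apply: leq_trans mJ1 _.
    apply: (@leq_trans (L ^ 18 * (L * N (B `&` mulset H [set y])))); first exact: leq_mul.
    by rewrite mulnA -expnSr leq_mul2r Le ?orbT.
- by apply: op_mul; exact: op_near.
- have [_ h _] := hKt; apply: subset_trans h.
  by apply: mulsetS; exact: dY.
- by have [h _ _] := hKt; apply: h; exact: Ap.
- have [_ _ h] := hKt; rewrite /y; have [[i j] _ <-] := Pz t; apply: h; [exact: Ap|exact: Ap|exact: Bq].
Qed.
End implications.

(** * The cycle of implications *)

Section equivalence.
Context {G : groupType} (S : multiscale G).
Local Notation near := (near S).
Local Notation dom := (dom S).
Local Notation M := (mult S).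
Local Notation N := (covnum (near 30)).
Variables (b2 : G * G -> G * G -> Prop)
  (b4 : (G * G) * (G * G) -> (G * G) * (G * G) -> Prop) (cl : G -> G -> Prop).
Hypothesis b2_near : forall c p, b2 c p -> near 30 c.1 p.1 /\ near 30 c.2 p.2.
Hypothesis near_b2 : forall c p, near 20 c.1 p.1 -> near 20 c.2 p.2 -> b2 c p.
Hypothesis b4_near : forall c p, b4 c p ->
  [/\ near 30 c.1.1 p.1.1, near 30 c.1.2 p.1.2, near 30 c.2.1 p.2.1
    & near 30 c.2.2 p.2.2].
Hypothesis near_b4 : forall c p, near 20 c.1.1 p.1.1 -> near 20 c.1.2 p.1.2 ->
  near 20 c.2.1 p.2.1 -> near 20 c.2.2 p.2.2 -> b4 c p.
Hypothesis cl_near : forall x y, cl x y -> near 31 x y.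
Hypothesis near_cl : forall x y, near 20 x y -> cl x y.
Variables (A B : set G).
Hypotheses (dA : A `<=` dom 0) (dB : B `<=` dom 0) (A0 : A !=set0) (B0 : B !=set0).
Variables (op : set G -> Prop) (Y0 Kt : set G).
Hypothesis op_near : forall (T : Type) (P : T -> bool) (z z' : T -> G) r,
  op [set g | exists2 q, P q & near r g (z q) /\ near r (g^-1)%g (z' q)].
Hypothesis op_mul : forall U V, op U -> op V -> op (mulset U V).
Hypothesis hY0 : forall x y g, A x -> A y -> near 20 g (x^-1 * y)%g ->
  near 20 (g^-1)%g (y^-1 * x)%g -> Y0 g.
Hypothesis dY0 : Y0 `<=` dom 0.
Hypothesis hKt : [/\ A `<=` Kt, mulset Y0 Y0 `<=` Kt
  & forall x a b, A x -> A a -> B b -> Kt (x^-1 * (a * b))%g].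
Hypothesis dKt : Kt `<=` dom 0.

Definition energy_set : set ((G * G) * (G * G)) :=
  [set q | [/\ (A `*` B) q.1, (A `*` B) q.2
    & cl (q.1.1 * q.1.2)%g (q.2.1 * q.2.2)%g]].

Definition has_large_energy (k : nat) : Prop :=
  (N A) ^ 3 * (N B) ^ 3 <= k * covnum b4 energy_set ^ 2.

(** The longest way, from (iv), raises [k] to the powers 5, 4 and 8 in turn, whence
    [160 = 5 * 4 * 8]. *)
Lemma large_energy_of_any (k : nat) : M <= k -> 1 < k ->
  [\/ has_large_energy k, exists E, partial_product S b2 k A B E,
      exists A' B', small_product S k A B A' B'
    | exists H x y, [/\ controlled S k A B H x y, H `<=` dom 0, dom 0 x & dom 0 y]] ->
  has_large_energy ((k ^ 160) ^ 2).
Proof.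
move=> Mk k1; have k0 : 0 < k by exact: ltnW.
have ke e : 0 < e -> M <= k ^ e /\ 1 < k ^ e.
  move=> e0; split; last by rewrite -(exp1n e) ltn_exp2r.
  by apply: leq_trans Mk _; rewrite -{1}(expn1 k) leq_exp2l.
have up e c : e <= 320 -> c <= k ^ e * covnum b4 energy_set ^ 2 ->
    c <= (k ^ 160) ^ 2 * covnum b4 energy_set ^ 2.
  by move=> e320 /leq_trans; apply; rewrite -expnM leq_mul2r leq_exp2l // e320 orbT.
have part e E : 0 < e -> e <= 20 -> partial_product S b2 (k ^ e) A B E ->
    has_large_energy ((k ^ 160) ^ 2).
  move=> e0 e20 hE; have [Me e1] := ke _ e0.
  have := energy_of_partial_product near_b2 b4_near near_b4 cl_near near_cl dA dB A0 B0 Me e1 hE.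
  by move=> h; apply: (@up (e * 8 * 2)); [lia|rewrite !expnM].
have small e A' B' : 0 < e -> e <= 5 -> small_product S (k ^ e) A B A' B' ->
    has_large_energy ((k ^ 160) ^ 2).
  move=> e0 e5 hE; have [Me e1] := ke _ e0.
  have := partial_product_of_small b2_near near_b2 dA dB Me e1 hE.
  by rewrite -expnM; apply: part; lia.
case=> [h|[E hE]|[A' [B' h]]|[H [x [y [h dH dx dy]]]]].
- by apply: (@up 1) => //; rewrite expn1.
- by apply: (@part 1 E) => //; rewrite expn1.
- by apply: (@small 1 A' B') => //; rewrite expn1.
- have [A' [B' h2]] := small_product_of_controlled dA dB A0 B0 Mk k1 dH dx dy h.
  exact: (@small 5 A' B').
Qed.

Lemma small_product_le k k' A' B' : k <= k' -> small_product S k A B A' B' ->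
  small_product S k' A B A' B'.
Proof.
move=> kk [h1 h2 h3 h4 [h5 h6]].
have up c d : c <= k * d -> c <= k' * d.
  by move=> /leq_trans; apply; rewrite leq_mul2r kk orbT.
by split => //; [exact: up|exact: up|split; exact: up].
Qed.

Lemma partial_product_le k k' E : k <= k' -> partial_product S b2 k A B E ->
  partial_product S b2 k' A B E.
Proof.
move=> kk [h1 h2 h3].
have up c d : c <= k * d -> c <= k' * d.
  by move=> /leq_trans; apply; rewrite leq_mul2r kk orbT.
by split => //; exact: up.
Qed.

Lemma controlled_le k k' H x y : k <= k' -> controlled S k A B H x y ->
  controlled S k' A B H x y.
Proof.
move=> kk [h1 [n [p [nk h2 h2']]] [h3 h3'] h4 h5].
have up c d : c <= k * d -> c <= k' * d.
  by move=> /leq_trans; apply; rewrite leq_mul2r kk orbT.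
split => //; [|by split; exact: up|exact: up|exact: up].
by exists n, p; split => //; exact: leq_trans kk.
Qed.

(** The group obtained from the energy lies in [Kt], hence in [dom 0], so the easy implications
    apply to it. The exponent 320 is a common bound for their losses. *)
Lemma all_of_large_energy (k : nat) : M <= k -> 1 < k -> has_large_energy (k ^ 2) ->
  let k' := (((k ^ 21) ^ 40) ^ 40) ^ 320 in
  [/\ has_large_energy k', exists E, partial_product S b2 k' A B E,
      exists A' B', small_product S k' A B A' B'
    & exists H x y, [/\ controlled S k' A B H x y, op H, H `<=` Kt, Kt x & Kt y]].
Proof.
move=> Mk k1 hE.
have ge1 e c : 1 < c -> 0 < e -> M <= c -> M <= c ^ e /\ 1 < c ^ e.
  move=> c1 e0 Mc; split; last by rewrite -(exp1n e) ltn_exp2r.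
  by apply: leq_trans Mc _; rewrite -{1}(expn1 c) leq_exp2l.
have := controlled_of_energy near_b4 cl_near dA dB A0 B0 Mk k1 op_near op_mul hY0 dY0 hKt hE.
have [M1 c1] := ge1 21 k k1 isT Mk; have [M2 c2] := ge1 40 _ c1 isT M1.
have [M3 c3] := ge1 40 _ c2 isT M2.
have k3 : k <= ((k ^ 21) ^ 40) ^ 40.
  apply: (@leq_trans (k ^ 21)); first by rewrite -{1}(expn1 k) leq_exp2l.
  apply: (@leq_trans ((k ^ 21) ^ 40)); first by rewrite -{1}(expn1 (k ^ 21)) leq_exp2l.
  by rewrite -{1}(expn1 ((k ^ 21) ^ 40)) leq_exp2l.
move: (((k ^ 21) ^ 40) ^ 40) M3 c3 k3 => c Mc c3 kc [H [x [y [hH oH HK Kx Ky]]]].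
have cle e : e <= 320 -> c ^ e <= c ^ 320 by move=> ?; rewrite leq_exp2l.
have [A' [B' h2]] := small_product_of_controlled dA dB A0 B0 Mc c3
  (subset_trans HK dKt) (dKt Kx) (dKt Ky) hH.
have [M5 c5] := ge1 5 _ c3 isT Mc.
have h3 := partial_product_of_small b2_near near_b2 dA dB M5 c5 h2.
split.
- apply: leq_trans hE _; rewrite leq_mul2r; apply/orP; right.
  by apply: (@leq_trans (c ^ 2)); rewrite ?leq_sqr // cle.
- by exists (A' `*` B'); apply: partial_product_le h3; rewrite -expnM cle.
- by exists A', B'; apply: small_product_le h2; exact: cle.
- exists H, x, y; split => //; apply: controlled_le hH.
  by rewrite -{1}(expn1 c) cle.
Qed.

End equivalence.

Import Order.TTheory GRing.Theory Num.Theory.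
Local Open Scope ring_scope.

(** * Locally reasonable metric groups *)

(* [compact_cover] is stated for pointed spaces only. *)
HB.instance Definition _ (G : topologicalGroupType) :=
  Topological.copy (pointed_group G) G.

Section metric_group.
Context {R : realType} {G : metricGroupType R}.
Implicit Types (A U V : set G) (r : R).

Definition cball r : set G := [set y | mdist (1%g : G) y <= r].

Lemma open_mdist_lt (x : G) r : open [set y | mdist x y < r].
Proof.
rewrite openE => y /= xy; apply/nbhs_ballP; exists (r - mdist x y) => /=.
  by rewrite subr_gt0.
move=> z; rewrite ballEmdist /= => yz.
by apply: le_lt_trans (metric_triangle x y z) _; rewrite -ltrBrDl.
Qed.

Lemma compact_finite_cover (A : set G) r : 0 < r -> compact A ->
  exists n (c : 'I_n -> G), forall x, A x -> exists i, mdist (c i) x < r.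
Proof.
move=> r0 cA; have : @compact (pointed_group G) A by [].
rewrite compact_cover => /(_ G setT (fun x => [set y : G | mdist x y < r])).
case=> [x _|x Ax|D _ hD]; first exact: open_mdist_lt.
  by exists x => //=; rewrite mdistxx.
exists (size (enum_fset D)), (fun i => tnth (in_tuple (enum_fset D)) i) => x /hD[y yD xy].
have iy : (index y (enum_fset D) < size (enum_fset D))%N by rewrite index_mem.
by exists (Ordinal iy); rewrite (tnth_nth y) /= nth_index.
Qed.

Lemma compact_sub_cball A : compact A -> exists r, A `<=` cball r.
Proof.
move=> cA; have [n [c hc]] := compact_finite_cover ltr01 cA.
exists (\sum_i mdist 1%g (c i) + 1) => x /hc[i hi].
apply: le_trans (metric_triangle _ (c i) _) _; apply: lerD; last exact: ltW.
by rewrite (bigD1 i) //= lerDl sumr_ge0 // => j _; exact: mdist_ge0.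
Qed.

Lemma continuous_lmul (g : G) : continuous (fun x : G => (g * x)%g).
Proof.
move=> x; apply: (@continuous_comp _ _ _ (fun x => (g, x)) (fun p : G * G => (p.1 * p.2)%g)).
  by apply: cvg_pair => //; exact: cvg_cst.
exact: mulg_continuous.
Qed.

Lemma continuous_rmul (g : G) : continuous (fun x : G => (x * g)%g).
Proof.
move=> x; apply: (@continuous_comp _ _ _ (fun x => (x, g)) (fun p : G * G => (p.1 * p.2)%g)).
  by apply: cvg_pair => //; exact: cvg_cst.
exact: mulg_continuous.
Qed.

Lemma open_mulset U V : open U -> open (mulset U V).
Proof.
move=> oU; rewrite (_ : mulset U V = \bigcup_(v in V) ((fun x => (x * v^-1)%g) @^-1` U)).
  apply: bigcup_open => v _; by move/continuousP: (@continuous_rmul v^-1%g); apply.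
apply/seteqP; split => [_ [u Uu [v Vv <-]]|x [v Vv Uv]].
  by exists v => //=; rewrite mulgK.
by exists (x * v^-1)%g => //; exists v => //; rewrite mulgVK.
Qed.

Lemma open_mulset1 (g : G) U : open U -> open (mulset [set g] U).
Proof.
move=> oU; rewrite (_ : mulset _ _ = (fun x => (g^-1 * x)%g) @^-1` U).
  by move/continuousP: (@continuous_lmul g^-1%g); apply.
apply/seteqP; split => [_ [_ -> [u Uu <-]]|x Ux] /=; first by rewrite mulKg.
by exists g => //; exists (g^-1 * x)%g => //; rewrite mulVKg.
Qed.

Lemma compact_mulset A V : compact A -> compact V -> compact (mulset A V).
Proof.
move=> cA cV; rewrite (_ : mulset A V = (fun p : G * G => (p.1 * p.2)%g) @` (A `*` V)).
  apply: continuous_compact; last exact: compact_setX.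
  by apply: continuous_subspaceT; exact: mulg_continuous.
apply/seteqP; split => [_ [a Aa [v Vv <-]]|_ [[a v] [/= Aa Vv] <-]].
  by exists (a, v).
by exists a => //; exists v.
Qed.

Lemma compact_invset A : compact A -> compact (invset A).
Proof.
move=> cA; apply: continuous_compact => //.
by apply: continuous_subspaceT; exact: invg_continuous.
Qed.

Variable mu : {measure set (borelType G) -> \bar R}.
Hypothesis hG : locally_reasonable mu.

Lemma compact_cball r : compact (cball r).
Proof. by have [_ h _ _] := hG; exact: h. Qed.

(** One function serves all closure properties of balls around 1, so its iterates can be the domains
    of a multiscale. The clause [r + R0 <= f r] makes room for a perturbation of size below [R0]. *)
Lemma next_radius (R0 : R) : exists f : R -> R, forall r,
  [/\ 0 <= f r, r <= f r, r + R0 <= f r, forall x y, cball r x -> cball r y -> cball (f r) (x * y)%g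
    & forall x, cball r x -> cball (f r) (x^-1)%g].
Proof.
suff /choice[f hf] : forall r, exists s, [/\ 0 <= s, r <= s, r + R0 <= s,
    forall x y, cball r x -> cball r y -> cball s (x * y)%g
  & forall x, cball r x -> cball s (x^-1)%g] by exists f.
move=> r.
have [s1 h1] := compact_sub_cball (compact_mulset (@compact_cball r) (@compact_cball r)).
have [s2 h2] := compact_sub_cball (compact_invset (@compact_cball r)).
pose s := `|s1| + `|s2| + `|r| + `|R0|.
have b1 : s1 <= s by rewrite /s -!addrA (le_trans (ler_norm _)) // lerDl !addr_ge0.
have b2 : s2 <= s.
  by rewrite /s addrAC -!addrA addrC (le_trans (ler_norm _)) // -!addrA lerDl !addr_ge0.
have b3 : r + R0 <= s.
  by rewrite /s -addrA (le_trans (lerD (ler_norm _) (ler_norm _))) // lerDr addr_ge0.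
exists s; split => //.
- by rewrite !addr_ge0.
- by apply: le_trans (ler_norm _) _; rewrite /s -addrA addrCA lerDl !addr_ge0.
- move=> x y hx hy; apply: le_trans b1; apply: h1; exists x => //; by exists y.
- by move=> x hx; apply: le_trans b2; apply: h2; exists x.
Qed.

Let ball1 r : set (borelType G) := [set y : G | mdist (1%g : G) y < r].

Lemma measurable_open (U : set (borelType G)) : open (U : set G) -> measurable U.
Proof. by move=> oU; exact: sub_sigma_algebra. Qed.

Lemma mu_ball_gt0 r : 0 < r -> (0 < mu (ball1 r))%E.
Proof.
move=> r0; have [[_ _ _ h] _ _ _] := hG; apply: h; first exact: open_mdist_lt.
by exists 1%g; rewrite /ball1 /= mdistxx.
Qed.

Lemma mu_ball_fin r : (mu (ball1 r) < +oo)%E.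
Proof.
have [[[h _ _] _ _ _] hc _ _] := hG.
apply: le_lt_trans (h _ (hc 1%g r)).
apply: le_measure; rewrite ?inE.
- by apply: measurable_open; exact: open_mdist_lt.
- rewrite -[X in measurable X]setCK; apply: measurableC; apply: measurable_open.
  apply: closed_openC; apply: compact_closed (hc 1%g r); exact: metric_hausdorff.
- by move=> y /= /ltW.
Qed.

Lemma doubling_iter (r1 : R) (s : nat) : 0 < r1 -> exists2 C : R, 1 <= C &
  forall r, 0 < r -> 2 ^+ s * r < r1 ->
  (mu (ball1 (2 ^+ s * r)) <= (C ^+ s)%:E * mu (ball1 r))%E.
Proof.
move=> r10; have [_ _ _ h] := hG; have [C hC] := h _ r10.
(* The doubling constant is not assumed nonnegative; the maximum allows multiplying inequalities by
   it. *)
exists (Num.max 1 C); first by rewrite le_max lexx.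
elim: s => [|s IH] r r0 hr; first by rewrite !expr0 mul1r mul1e.
have hs : 2 ^+ s * r < r1.
  by apply: le_lt_trans hr; rewrite ler_wpM2r ?(ltW r0) // ler_eXn2l // ltr1n.
have s0 : 0 < 2 ^+ s * r by rewrite mulr_gt0 // exprn_gt0.
rewrite exprS -mulrA; have := hC (2 ^+ s * r); rewrite s0 hs => /(_ isT).
rewrite !ballEmdist => /le_trans; apply.
rewrite exprS EFinM -muleA; apply: (@le_trans _ _ ((Num.max 1 C)%:E * mu (ball1 (2 ^+ s * r)))%E).
  by rewrite lee_wpmul2r // lee_fin le_max lexx orbT.
by rewrite lee_wpmul2l ?IH // lee_fin le_max ler01.
Qed.

(** Left translation by the inverse of one point brings the cluster to the identity, where doubling
    is assumed. Translates of a small ball by the moved points are disjoint, have equal measure by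
    invariance, and lie in one ball larger by a factor [2 ^+ s]. Since [s] depends on [L] alone, the
    bound is uniform in [eps]. *)
Lemma packing_bound (R0 r0 L : R) (D : set G) : 4 <= L -> R0 <= r0 -> 0 < R0 ->
  cball r0 `<=` D ->
  (forall x y g, D x -> D y -> D g -> L^-1 * mdist x y <= mdist (g * x)%g (g * y)%g <= L * mdist x y) ->
  exists M : nat, forall (eps : R) (I : finType) (p : I -> G) (A : {set I}),
    0 < eps < R0 ->
    (forall i, i \in A -> D (p i)) -> (forall i, i \in A -> D (p i)^-1%g) ->
    (forall i j, i \in A -> j \in A -> D ((p i)^-1 * p j)%g) ->
    (forall i j, i \in A -> j \in A -> i != j -> ~ mdist (p i) (p j) < eps * L ^+ 0 / L ^+ 30) ->
    (forall i j, i \in A -> j \in A -> mdist (p i) (p j) < eps * L ^+ 60 / L ^+ 30) ->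
  (#|A| <= M)%N.
Proof.
move=> L4 Rr R00 rD hL.
have L0 : 0 < L by apply: lt_le_trans L4.
have [s hs] : exists s : nat, L ^+ 66 <= 2 ^+ s.
  exists (Num.bound (L ^+ 66)); apply: (@le_trans _ _ (Num.bound (L ^+ 66))%:R).
    by apply: ltW; apply: archi_boundP; rewrite exprn_ge0 // ltW.
  by rewrite -natrX ler_nat ltnW // ltn_expl.
have [C C1 hC] := @doubling_iter (2 ^+ s * R0) s (mulr_gt0 (exprn_gt0 s (ltr0n _ 2)) R00).
exists (Num.bound (C ^+ s)) => eps I p A /andP[e0 eR] hD hDV hDD sp np.
have [->|/finset.set0Pn[i0 i0A]] := eqVneq A finset.set0; first by rewrite cards0.
(* After translation the points are [eps / L ^+ 31 = L ^+ 3 * rho] apart, which exceeds the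
   [2 * L * rho] needed for disjointness. They lie within [eps * L ^+ 31 = L ^+ 65 * rho] of 1,
   whence the power 66 above. *)
pose rho := eps / L ^+ 34.
have rho0 : 0 < rho by rewrite divr_gt0 // exprn_gt0.
have L1 : 1 <= L by apply: le_trans L4; rewrite ler1n.
have rhoe : rho <= eps by rewrite ler_pdivrMr ?exprn_gt0 // ler_peMr ?(ltW e0) // exprn_ege1.
have rhoR : rho < R0 by exact: le_lt_trans eR.
pose q i := ((p i0)^-1 * p i)%g.
have Dball h : mdist 1%g h < rho -> D h.
  by move=> hh; apply: rD; apply/ltW/(lt_le_trans hh)/(le_trans _ Rr)/ltW.
have D1 : D 1%g by apply: Dball; rewrite mdistxx.
have qh i h : i \in A -> mdist 1%g h < rho -> mdist (q i) (q i * h)%g < L * rho.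
  move=> iA hh; have := hL 1%g h (q i) D1 (Dball _ hh) (hDD _ _ i0A iA).
  rewrite mulg1 => /andP[_ /le_lt_trans]; apply; by rewrite ltr_pM2l.
have qsep i j : i \in A -> j \in A -> i != j -> eps / L ^+ 31 <= mdist (q i) (q j).
  move=> iA jA ij; have /andP[+ _] := hL _ _ _ (hD _ iA) (hD _ jA) (hDV _ i0A).
  apply: le_trans; have /negP := sp _ _ iA jA ij; rewrite -leNgt => h.
  rewrite [leRHS]mulrC ler_pdivlMr //; apply: le_trans h.
  by rewrite expr0 mulr1 -mulrA ler_wpM2l ?(ltW e0) // (exprS L 30) invfM mulrAC mulVf ?gt_eqF // mul1r.
have qnear i : i \in A -> mdist 1%g (q i) < eps * L ^+ 31.
  move=> iA; have /andP[_ +] := hL _ _ _ (hD _ i0A) (hD _ iA) (hDV _ i0A).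
  rewrite mulVg => /le_lt_trans; apply; rewrite exprS mulrCA ltr_pM2l //.
  have := np _ _ i0A iA; rewrite (_ : 60 = 30 + 30)%N // exprD mulrA mulfK //.
  by rewrite gt_eqF // exprn_gt0.
pose U i : set (borelType G) := mulset [set q i] (ball1 rho).
have oU i : open (U i : set G) by apply: open_mulset1; exact: open_mdist_lt.
have mU i : mu (U i) = mu (ball1 rho).
  have mb : measurable (ball1 rho) by apply: measurable_open; exact: open_mdist_lt.
  by have [[_ h _ _] _ _ _] := hG; have [] := h (q i) _ mb.
have LL a b : (a <= b)%N -> L ^+ a <= L ^+ b by move=> ab; rewrite ler_weXn2l.
have tU : trivIset setT (fun k : 'I_#|A| => U (enum_val k)).
  apply/trivIsetP => k k' _ _ kk'; apply/seteqP; split => // z [[_ -> [h hh e]] [_ -> [h' hh' e']]].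
  have kA := enum_valP k; have k'A := enum_valP k'.
  have : mdist (q (enum_val k)) (q (enum_val k')) < L * rho + L * rho.
    apply: le_lt_trans (metric_triangle _ z _) _; apply: ltrD.
      by rewrite -e; apply: qh.
    by rewrite metric_sym -e'; apply: qh.
  rewrite ltNge => /negP; apply; apply: le_trans (qsep _ _ kA k'A _); last first.
    by apply: contraNneq kk' => /enum_val_inj ->.
  rewrite (_ : eps / L ^+ 31 = L ^+ 3 * rho); last first.
    have key (x a b : R) : b != 0 -> x / a = b * (x / (b * a)).
      by move=> b0; rewrite invfM mulrCA [b * _]mulrA mulfV // mul1r.
    rewrite /rho (exprD L 3 31 : L ^+ 34 = _); apply: key.
    by rewrite gt_eqF // exprn_gt0.
  rewrite -mulrDl ler_wpM2r ?(ltW rho0) // !exprS expr0 mulr1 mulrA.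
  apply: (@le_trans _ _ (4 * 1 * L)); last by rewrite ler_wpM2r ?(ltW L0) // ler_pM.
  by rewrite mulr1 -[L + L]mulr2n -[L *+ 2]mulr_natl ler_wpM2r ?(ltW L0) // ler_nat.
have sub (k : 'I_#|A|) : U (enum_val k) `<=` ball1 (2 ^+ s * rho).
  move=> _ [_ -> [h hh <-]] /=; have kA := enum_valP k.
  apply: (@lt_le_trans _ _ (eps * L ^+ 31 + L * rho)).
    apply: le_lt_trans (metric_triangle _ (q (enum_val k)) _) _; apply: ltrD.
      exact: qnear.
    exact: qh.
  apply: (@le_trans _ _ (L ^+ 66 * rho)); last by rewrite ler_wpM2r // (ltW rho0).
  have -> : eps * L ^+ 31 = L ^+ 65 * rho.
    have key (x c d : R) : d != 0 -> x * c = c * d * (x / d).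
      by move=> d0; rewrite mulrACA mulfV // mulr1 mulrC.
    rewrite /rho (exprD L 31 34 : L ^+ 65 = _); apply: key.
    by rewrite gt_eqF // exprn_gt0.
  rewrite -mulrDl ler_wpM2r ?(ltW rho0) // (exprS L 65).
  apply: (@le_trans _ _ (2 * L ^+ 65)).
    by rewrite mulr2n mulrDl mul1r lerD2l -{1}(expr1 L) LL.
  by rewrite ler_wpM2r ?exprn_ge0 ?(ltW L0) // (le_trans _ L4) // ler_nat.
have hmu : (\sum_(k < #|A|) mu (U (enum_val k)) <= (C ^+ s)%:E * mu (ball1 rho))%E.
  apply: le_trans (hC rho rho0 _); last by rewrite ltr_pM2l // exprn_gt0.
  have mUk k : measurable (U (enum_val k : I)) by apply: measurable_open; exact: oU.
  rewrite -(measure_bigsetU_ord mu xpredT) //.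
  apply: le_measure; rewrite ?inE.
  - by apply: bigsetU_measurable => k _; exact: mUk.
  - by apply: measurable_open; exact: open_mdist_lt.
  - by elim/big_ind: _ => [z []|X Y sX sY z [/sX|/sY]|k _]; last exact: sub.
have m0 := mu_ball_gt0 rho0; have mf := mu_ball_fin rho.
move: hmu; rewrite (eq_bigr (fun=> mu (ball1 rho))); last by move=> k _; exact: mU.
rewrite -[X in (_ <= _ * X)%E -> _](@fineK _ (mu (ball1 rho))); last by rewrite ge0_fin_numE.
rewrite (eq_bigr (fun=> (fine (mu (ball1 rho)))%:E)); last first.
  by move=> k _; rewrite fineK // ge0_fin_numE.
rewrite sumEFin -EFinM lee_fin sumr_const card_ord -mulr_natl ler_pM2r; last first.
  by apply: fine_gt0; rewrite m0 mf.
rewrite -(ler_nat R) => /le_trans; apply; apply: ltW; apply: archi_boundP.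
by rewrite exprn_ge0 // (le_trans ler01).
Qed.

(** * The multiscale structure of a locally reasonable metric group *)

Section multiscale_of_metric.
Variables (R0 r0 : R) (f : R -> R).
Hypotheses (R00 : 0 < R0) (Rr : R0 <= r0).
Hypothesis hf : forall r,
  [/\ 0 <= f r, r <= f r, r + R0 <= f r,
      forall x y, cball r x -> cball r y -> cball (f r) (x * y)%g
    & forall x, cball r x -> cball (f r) (x^-1)%g].

Lemma iter_radius_le m n : (m <= n)%N -> iter m f r0 <= iter n f r0.
Proof.
move=> /subnK <-; elim: (n - m)%N => // k IH; rewrite addSn iterS.
by apply: le_trans IH _; have [_ + _ _ _] := hf (iter (k + m) f r0).
Qed.

Lemma cball_iter_le m n x : (m <= n)%N -> cball (iter m f r0) x -> cball (iter n f r0) x.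
Proof. by move=> mn h; apply: le_trans h _; exact: iter_radius_le. Qed.

(** [L] and [M] are chosen before [eps]: they come from the Lipschitz and doubling constants on one
    fixed compact ball. This makes the final constants independent of the scale. *)
Lemma exists_multiscale : exists (L : R) (M : nat), 4 <= L /\
  forall eps, 0 < eps < R0 -> exists S : multiscale G, [/\ mult S = M,
    near S = (fun m x y => mdist x y < eps * L ^+ m / L ^+ 30 : Prop)
  & dom S = (fun k => cball (iter k f r0))].
Proof.
(* Radius 20 exceeds the 16 of the domain because packing also needs inverses and quotients of its
   points, at levels 17 and 18. *)
pose D := cball (iter 20 f r0).
have [_ _ hLip _] := hG; have [C C0 hC] := hLip _ (@compact_cball (iter 20 f r0)).
pose L := Num.max C 4.
have L4 : 4 <= L by rewrite le_max lexx orbT.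
have L0 : 0 < L by apply: lt_le_trans L4.
have L1 : 1 <= L by apply: le_trans L4; rewrite ler1n.
have CL : C <= L by rewrite le_max lexx.
have CLV : L^-1 <= C^-1 by rewrite lef_pV2.
have hL x y g : D x -> D y -> D g ->
    [/\ L^-1 * mdist x y <= mdist (g * x)%g (g * y)%g <= L * mdist x y,
        mdist (x * g)%g (y * g)%g <= L * mdist x y
      & mdist (x^-1)%g (y^-1)%g <= L * mdist x y].
  move=> hx hy hg; have d0 := mdist_ge0 x y.
  have [/andP[l1 u1] /andP[_ u2] /andP[_ u3]] := hC _ _ _ hx hy hg; split.
  - rewrite (le_trans _ l1) ?(le_trans u1) //; exact: ler_wpM2r.
  - by rewrite (le_trans u2) // ler_wpM2r.
  - by rewrite (le_trans u3) // ler_wpM2r.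
have [|M hM] := @packing_bound R0 r0 L D L4 Rr R00 _ (fun x y g hx hy hg => let: And3 h _ _ := hL x y g hx hy hg in h).
  by move=> x; exact: (@cball_iter_le 0 20).
exists L, M; split => // eps e0R; have /andP[e0 eR] := e0R.
pose sc m := eps * L ^+ m / L ^+ 30.
have sc0 m : 0 < sc m by rewrite divr_gt0 ?mulr_gt0 ?exprn_gt0.
have scS m : sc m.+1 = L * sc m by rewrite /sc exprS mulrCA -!mulrA.
have scD m : sc m + sc m <= sc m.+1.
  rewrite scS -mulr2n -mulr_natl ler_wpM2r ?(ltW (sc0 m)) //.
  by apply: le_trans L4; rewrite ler_nat.
have scle m n : (m <= n)%N -> sc m <= sc n.
  move=> mn; rewrite /sc ler_wpM2r ?invr_ge0 ?exprn_ge0 ?(ltW L0) //.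
  by rewrite ler_wpM2l ?(ltW e0) // ler_weXn2l.
have D16 x : cball (iter 16 f r0) x -> D x by exact: (@cball_iter_le 16 20).
have lip m a b : a <= L * b -> b < sc m -> a < sc m.+1.
  by move=> ab bm; rewrite scS (le_lt_trans ab) // ltr_pM2l.
unshelve eexists (@Multiscale G (fun m x y => mdist x y < sc m : Prop)
  (fun k => cball (iter k f r0)) M _ _ _ _ _ _ _ _ _ _ _ _ _); last by split.
- by move=> m x /=; rewrite mdistxx.
- by move=> m x y /=; rewrite metric_sym.
- by move=> m n x y mn /lt_le_trans; apply; exact: scle.
- move=> m x y z xy yz; apply: (lt_le_trans _ (scD m)).
  by apply: le_lt_trans (metric_triangle _ y _) _; exact: ltrD.
- by move=> m n x; exact: cball_iter_le.
- by rewrite /cball /= mdistxx (le_trans (ltW R00)).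
- by move=> m x y hx hy; have [_ _ _ + _] := hf (iter m f r0); apply.
- by move=> m x hx; have [_ _ _ _] := hf (iter m f r0); apply.
- move=> m g x y /D16 hg /D16 hx /D16 hy; apply: lip.
  by have [/andP[]] := hL _ _ _ hx hy hg.
- move=> m g x y /D16 hg /D16 hx /D16 hy; apply: lip.
  by have [] := hL _ _ _ hx hy hg.
- move=> m x y /D16 hx /D16 hy; apply: lip.
  by have [] := hL _ _ _ hx hy hx.
- by have [n [c hc]] := compact_finite_cover (sc0 0%N) (@compact_cball (iter 16 f r0)); exists n, c.
- move=> I p A hp sp np; apply: hM e0R _ _ _ sp np.
  + by move=> i /hp /D16.
  + move=> i /hp h; apply: (@cball_iter_le 17 20) => //.
    by have [_ _ _ _] := hf (iter 16 f r0); apply.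
  + move=> i j /hp h1 /hp h2; apply: (@cball_iter_le 18 20) => //.
    have [_ _ _ + _] := hf (iter 17 f r0); apply; last exact: (@cball_iter_le 16 17).
    by have [_ _ _ _] := hf (iter 16 f r0); apply.
Qed.
End multiscale_of_metric.

End metric_group.

(** * Entropies *)

Lemma entropy_covnum (R : realType) (T : Type) (d : T -> T -> R) (eps : R) (X : set T) :
  (exists n, covered (fun c x => d c x < eps) X n) ->
  entropy d eps X = ((covnum (fun c x => d c x < eps) X)%:R)%:E.
Proof.
move=> [n /covered_covnum hX]; apply/eqP; rewrite eq_le; apply/andP; split.
  by apply: ereal_inf_lbound; exists (covnum (fun c x => d c x < eps) X).
apply: le_ereal_inf_tmp => _ [m hm <-]; rewrite lee_fin ler_nat; exact: covnum_le.
Qed.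

Section asymptotic_notation.
Context {R : realType}.
Implicit Types (C K x y g : R).

Lemma lesssim_fin C K x y : lesssim C K x%:E y%:E = (x <= C * K `^ C * y) :> Prop.
Proof. by rewrite /lesssim -EFinM lee_fin. Qed.

Lemma gtrsim_fin C K x y : 0 < C -> 1 <= K ->
  gtrsim C K x%:E y%:E = (y <= C * K `^ C * x) :> Prop.
Proof.
move=> C0 K1; rewrite /gtrsim -EFinM lee_fin powRN -invfM mulrC ler_pdivrMr 1?mulrC //.
by rewrite mulr_gt0 // powR_gt0 // (lt_le_trans ltr01).
Qed.

(** The right side of (i) is the cube of the geometric mean [g], and [g ^+ 2] is an integer;
    squaring turns every condition into one on natural numbers. *)
Lemma geometric_mean (a b : nat) : exists2 g : R, 0 <= g &
  [/\ (a%:R%:E `^ (1 / 2) * b%:R%:E `^ (1 / 2) = g%:E)%E,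
      (a%:R%:E `^ (3 / 2) * b%:R%:E `^ (3 / 2) = (g ^+ 3)%:E)%E
    & g ^+ 2 = (a * b)%:R].
Proof.
exists (a%:R `^ (1 / 2) * b%:R `^ (1 / 2)); first by rewrite mulr_ge0 ?powR_ge0.
have h (c : nat) : (c%:R : R) `^ (1 / 2) = Num.sqrt c%:R by rewrite div1r powR12_sqrt.
have h3 (c : nat) : (c%:R : R) `^ (3 / 2) = (c%:R `^ (1 / 2)) ^+ 3.
  rewrite -powR_mulrn ?powR_ge0 // -powRrM; congr (_ `^ _).
  by rewrite div1r mulrC.
split; first by rewrite !poweR_EFin -EFinM.
  by rewrite !poweR_EFin -EFinM !h3 exprMn.
by rewrite !h exprMn !sqr_sqrtr // natrM.
Qed.

(** Taking roots is harmless because [t <= c] and [1 <= c] give [t <= c ^+ 2]. *)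
Lemma ler_of_sqr x y (t c : R) : 0 <= y -> 1 <= t -> t <= c ->
  x ^+ 2 <= t * y ^+ 2 -> x <= c * y.
Proof.
move=> y0 t1 tc h; have c1 : 1 <= c by exact: le_trans tc.
have c0 : 0 <= c by exact: le_trans c1.
have [x0|x0] := leP 0 x; last by apply: le_trans (ltW x0) _; rewrite mulr_ge0.
rewrite -ler_sqr ?nnegrE ?mulr_ge0 // exprMn; apply: le_trans h _.
by rewrite ler_wpM2r ?sqr_ge0 // (le_trans tc) // expr2 ler_peMr.
Qed.

End asymptotic_notation.

(* The combinatorial argument bounds everything by a fixed power of a natural
   number [kappa]; such a power is again of the form [C' * K `^ C']. *)
Lemma power_bound (R : realType) (C : R) (m P : nat) : 0 < C -> exists2 C' : R, 0 < C' &
  forall K : R, 1 <= K -> exists kappa : nat,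
    [/\ (m <= kappa)%N, (1 < kappa)%N, C * K `^ C <= kappa%:R
      & (kappa ^ P)%:R <= C' * K `^ C'].
Proof.
(* Since [K]^ C[is at least 1,]kappa[below is at most]b * K [^ C]; the two arguments of the maximum
   bound the base and the exponent of its power. *)
move=> C0; pose b := C + (m + 2)%:R; pose C' := Num.max (b ^+ P) (C * P%:R).
have b0 : 0 < b by rewrite /b addr_gt0 // ltr0n addn2.
exists C'; first by rewrite lt_max exprn_gt0.
move=> K K1; have K0 : 0 < K by exact: lt_le_trans K1.
have x0 : 0 <= C * K `^ C by rewrite mulr_ge0 ?powR_ge0 // ltW.
exists (Num.truncn (C * K `^ C) + (m + 2))%N; split; [by lia|by lia| |].
- have h : C * K `^ C < (Num.truncn (C * K `^ C)).+1%:R by rewrite -truncn_le_nat.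
  apply: le_trans (ltW h) _.
  by rewrite ler_nat -addn1 leq_add2l addn2.
- apply: (@le_trans _ _ ((b * K `^ C) ^+ P)).
    rewrite natrX lerXn2r ?nnegrE ?mulr_ge0 ?powR_ge0 ?ler0n ?(ltW b0) //.
    have h : (Num.truncn (C * K `^ C))%:R <= C * K `^ C by rewrite -truncn_ge_nat.
    rewrite natrD mulrDl lerD // ler_peMr ?ler0n //.
    by rewrite -(powRr0 K) ler_powR // ltW.
  rewrite exprMn ler_pM ?exprn_ge0 ?powR_ge0 ?(ltW b0) //.
    by rewrite le_max lexx.
  rewrite -powR_mulrn ?powR_ge0 // -powRrM ler_powR //.
  by rewrite le_max lexx orbT.
Qed.

(** * Translation between entropies and covering numbers *)

Section translation.
Context {R : realType} {G : metricGroupType R} (S : multiscale G) (eps L : R).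
Hypotheses (eps0 : 0 < eps) (L4 : 4 <= L).
Hypothesis nearS : near S = (fun m x y => mdist x y < eps * L ^+ m / L ^+ 30 : Prop).
Local Notation N := (covnum (near S 30)).

Let L0 : 0 < L. Proof. by apply: lt_le_trans L4. Qed.
Let L1 : 1 <= L. Proof. by apply: le_trans L4; rewrite ler1n. Qed.

Definition ball2 (c p : G * G) : Prop := sumdist (@mdist R G) (@mdist R G) c p < eps.
Definition ball4 (c p : (G * G) * (G * G)) : Prop :=
  sumdist (sumdist (@mdist R G) (@mdist R G)) (sumdist (@mdist R G) (@mdist R G)) c p < eps.
Definition close (x y : G) : Prop := mdist x y <= eps.

Lemma near30 : near S 30 = (fun x y => mdist x y < eps : Prop).
Proof.
by rewrite nearS; apply/funext => x; apply/funext => y; rewrite mulfK // gt_eqF // exprn_gt0.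
Qed.

(** Ten levels gain far more than the factor 4 that keeps a sum of four coordinate distances below
    [eps]. *)
Lemma near20 x y : near S 20 x y -> mdist x y < eps / 4.
Proof.
rewrite nearS => /lt_le_trans; apply.
rewrite ler_pdivrMr ?exprn_gt0 // -mulrA ler_wpM2l ?(ltW eps0) //.
rewrite -(@ler_pM2l _ 4) // mulVKf // (exprD L 10 20 : L ^+ 30 = _).
rewrite ler_wpM2r ?exprn_ge0 ?(ltW L0) // (le_trans L4) //.
by rewrite -{1}(expr1 L) ler_weXn2l.
Qed.

Lemma ball2_near c p : ball2 c p -> near S 30 c.1 p.1 /\ near S 30 c.2 p.2.
Proof.
rewrite near30 /ball2 /sumdist => h; split; apply: le_lt_trans h.
  by rewrite lerDl mdist_ge0.
by rewrite lerDr mdist_ge0.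
Qed.

Lemma near_ball2 c p : near S 20 c.1 p.1 -> near S 20 c.2 p.2 -> ball2 c p.
Proof. by move=> /near20 h1 /near20 h2; rewrite /ball2 /sumdist; move: h1 h2 eps0; lra. Qed.

Lemma ball4_near c p : ball4 c p -> [/\ near S 30 c.1.1 p.1.1,
  near S 30 c.1.2 p.1.2, near S 30 c.2.1 p.2.1 & near S 30 c.2.2 p.2.2].
Proof.
rewrite near30 /ball4 /sumdist.
have := mdist_ge0 c.1.1 p.1.1; have := mdist_ge0 c.1.2 p.1.2.
have := mdist_ge0 c.2.1 p.2.1; have := mdist_ge0 c.2.2 p.2.2.
by move=> *; split; lra.
Qed.

Lemma near_ball4 c p : near S 20 c.1.1 p.1.1 -> near S 20 c.1.2 p.1.2 ->
  near S 20 c.2.1 p.2.1 -> near S 20 c.2.2 p.2.2 -> ball4 c p.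
Proof.
move=> /near20 h1 /near20 h2 /near20 h3 /near20 h4; rewrite /ball4 /sumdist.
by move: h1 h2 h3 h4; lra.
Qed.

Lemma close_near x y : close x y -> near S 31 x y.
Proof.
rewrite nearS /close => /le_lt_trans; apply.
rewrite (exprD L 30 1 : L ^+ 31 = _) expr1 mulrA mulrAC mulfK; last by rewrite gt_eqF // exprn_gt0.
by rewrite ltr_pMr // (lt_le_trans _ L4) // ltr1n.
Qed.

Lemma near_close x y : near S 20 x y -> close x y.
Proof. by move=> /near20; rewrite /close; move: eps0; lra. Qed.

Lemma open_near (T : Type) (P : T -> bool) (z z' : T -> G) r :
  open [set g : G | exists2 q, P q & near S r g (z q) /\ near S r (g^-1)%g (z' q)].
Proof.
rewrite nearS; set e := eps * _ / _.
rewrite (_ : [set g | _] = \bigcup_(q in [set q | P q])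
    ([set g | mdist (z q) g < e] `&` (fun g : G => g^-1)%g @^-1` [set g | mdist (z' q) g < e])).
  apply: bigcup_open => q _; apply: openI; first exact: open_mdist_lt.
  by move/continuousP: (@invg_continuous G); apply; exact: open_mdist_lt.
apply/seteqP; split => [g [q Pq [h1 h2]]|g [q Pq [h1 h2]]]; exists q => //.
  by split; rewrite /= metric_sym.
by rewrite ![_ (z _)]metric_sym [_ (z' _)]metric_sym.
Qed.

Lemma ent1_covnum X : X `<=` dom S 16 -> ent1 eps X = ((N X)%:R)%:E.
Proof.
by move=> /coveredP h; rewrite /ent1 near30 entropy_covnum // -near30.
Qed.

Variables (A B : set G).
Hypotheses (dA : A `<=` dom S 0) (dB : B `<=` dom S 0).

Lemma ent2_covnum E : E `<=` A `*` B -> ent2 eps E = ((covnum ball2 E)%:R)%:E.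
Proof.
by move=> sE; rewrite /ent2 entropy_covnum //; exact: (covered_b2 near_ball2 dA dB sE).
Qed.

Lemma energy_covnum : energy eps A B = ((covnum ball4 (energy_set close A B))%:R)%:E.
Proof.
by rewrite /energy entropy_covnum //; exact: (covered_energy_set near_ball4 close_near dA dB).
Qed.

Let dom16 X : X `<=` dom S 0 -> X `<=` dom S 16.
Proof. by move=> dX x /dX; exact: dom_le. Qed.

Section to_nat.
Variables (Kt : set G) (C K : R) (k : nat).
Hypotheses (dKt : Kt `<=` dom S 0) (C0 : 0 < C) (K1 : 1 <= K) (Ck : C * K `^ C <= k%:R).

Let ck0 : 0 <= C * K `^ C. Proof. by rewrite mulr_ge0 ?powR_ge0 // ltW. Qed.

Let up (x y : nat) : x%:R <= C * K `^ C * y%:R :> R -> (x <= k * y)%N.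
Proof.
by move=> /le_trans h; rewrite -(ler_nat R) natrM h // ler_wpM2r.
Qed.

Let kk : (k <= k ^ 2)%N. Proof. by case: k => // n; rewrite -mulnn leq_pmull. Qed.

Let up2 (x y : nat) : (x <= k * y)%N -> (x <= k ^ 2 * y)%N.
Proof. by move=> /leq_trans; apply; rewrite leq_mul2r kk orbT. Qed.

Let sq (x y : R) : 0 <= x -> x <= C * K `^ C * y -> 0 <= y -> x ^+ 2 <= k%:R ^+ 2 * y ^+ 2.
Proof.
move=> x0 xy y0; rewrite -exprMn lerXn2r ?nnegrE ?mulr_ge0 //.
by apply: le_trans xy _; rewrite ler_wpM2r.
Qed.

Lemma nat_of_conditions :
  [\/ large_energy C eps K A B, small_partial_product C eps K A B,
      small_subset_product C eps K A B
    | approximate_group_control Kt C eps K A B] ->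
  [\/ has_large_energy S ball4 close A B (k ^ 2),
      exists E, partial_product S ball2 (k ^ 2) A B E,
      exists A' B', small_product S (k ^ 2) A B A' B'
    | exists H x y, [/\ controlled S (k ^ 2) A B H x y, H `<=` dom S 0, dom S 0 x & dom S 0 y]].
Proof.
have eA := ent1_covnum (dom16 dA); have eB := ent1_covnum (dom16 dB).
have [g g0 [g1 g3 g2]] := @geometric_mean R (N A) (N B).
have upg (x : nat) : x%:R <= C * K `^ C * g -> (x ^ 2 <= k ^ 2 * (N A * N B))%N.
  by move=> h; rewrite -(ler_nat R) natrM !natrX -g2; exact: sq.
have upg' (x : nat) : g <= C * K `^ C * x%:R -> (N A * N B <= k ^ 2 * x ^ 2)%N.
  by move=> h; rewrite -(ler_nat R) -g2 natrM !natrX; exact: sq.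
case.
- rewrite /large_energy eA eB energy_covnum g3 gtrsim_fin // => h; apply: Or41.
  rewrite /has_large_energy -expnMn -(ler_nat R) natrX -g2 natrM !natrX.
  by rewrite -exprM mulnC exprM; apply: sq => //; rewrite exprn_ge0.
- move=> [E [sE h1 h2]]; apply: Or42; exists E; split => //.
    by move: h1; rewrite ent2_covnum // eA eB -EFinM gtrsim_fin // -natrM => /up /up2.
  apply: upg; move: h2; rewrite /geom_mean eA eB g1 ent1_covnum ?lesssim_fin //.
  by move=> _ [[u v] /sE[/= Au Bv] <-] /=; have d1 := dA Au; have d2 := dB Bv; dom_tac.
- move=> [A' [B' [sA sB [_ h1] [_ h2] [h3 h4]]]]; apply: Or43; exists A', B'.
  have dA' : A' `<=` dom S 0 by move=> u /sA; exact: dA.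
  have dB' : B' `<=` dom S 0 by move=> u /sB; exact: dB.
  have dAB : mulset A' B' `<=` dom S 16.
    by move=> _ [u Au [v Bv <-]]; have d1 := dA' _ Au; have d2 := dB' _ Bv; dom_tac.
  move: h1 h2 h3 h4; rewrite /geom_mean eA eB g1 (ent1_covnum dAB).
  rewrite (ent1_covnum (dom16 dA')) (ent1_covnum (dom16 dB')).
  rewrite !gtrsim_fin // lesssim_fin => h1 h2 h3 h4.
  by split => //; [exact/up2/up|exact/up2/up|split; [exact: upg|exact: upg']].
- move=> [H [x [y [[[H0 _ _] Hinv [X [_ XHH cX HX]]] [h1 h2] [_ h3] [_ h4] [HK Kx Ky]]]]].
  apply: Or44; exists H, x, y.
  have dH : H `<=` dom S 0 by move=> u /HK; exact: dKt.
  have dx : dom S 0 x by exact: dKt.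
  have dy : dom S 0 y by exact: dKt.
  split => //.
  have dAx : A `&` mulset [set x] H `<=` dom S 0 by move=> u [/dA].
  have dBy : B `&` mulset H [set y] `<=` dom S 0 by move=> u [/dB].
  move: h1 h2 h3 h4; rewrite /geom_mean eA eB g1 (ent1_covnum (dom16 dH)).
  rewrite (ent1_covnum (dom16 dAx)) (ent1_covnum (dom16 dBy)).
  rewrite !gtrsim_fin // lesssim_fin => h1 h2 h3 h4.
  split; [|..|exact/up2/up|exact/up2/up].
  + by split => // h Hh; rewrite -Hinv; exists h.
  + exists (size (enum_fset X)), (fun i => tnth (in_tuple (enum_fset X)) i); split.
    * by apply: leq_trans kk; rewrite -(ler_nat R) (le_trans cX).
    * by move=> i; apply: XHH; exact: mem_tnth.
    * move=> g' /HX[z zX [h Hh <-]].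
      have iz : (index z (enum_fset X) < size (enum_fset X))%N by rewrite index_mem.
      exists (Ordinal iz); rewrite (tnth_nth z) /= nth_index //.
      by rewrite mulKg.
  + by split; [exact: upg|exact: upg'].
Qed.
End to_nat.

Section of_nat.
Variables (Kt : set G) (C K : R) (t : nat).
Hypotheses (dKt : Kt `<=` dom S 0) (cKt : compact Kt) (C0 : 0 < C) (K1 : 1 <= K).
Hypotheses (t0 : (0 < t)%N) (tC : (2 * t)%:R <= C * K `^ C).

Let c := C * K `^ C.
Let t1 : 1 <= t%:R :> R. Proof. by rewrite ler1n. Qed.
Let tc : t%:R <= c. Proof. by apply: le_trans tC; rewrite ler_nat leq_pmull. Qed.
Let c0 : 0 <= c. Proof. by apply: le_trans tc. Qed.

Let down (x y : nat) : (x <= t * y)%N -> x%:R <= c * y%:R :> R.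
Proof.
rewrite -(ler_nat R) natrM => /le_trans; apply; rewrite ler_wpM2r //.
Qed.

Lemma conditions_of_nat :
  [/\ has_large_energy S ball4 close A B t, exists E, partial_product S ball2 t A B E,
      exists A' B', small_product S t A B A' B'
    & exists H x y, [/\ controlled S t A B H x y, open H, H `<=` Kt, Kt x & Kt y]] ->
  [/\ large_energy C eps K A B, small_partial_product C eps K A B,
      small_subset_product C eps K A B
    & approximate_group_control Kt C eps K A B].
Proof.
have eA := ent1_covnum (dom16 dA); have eB := ent1_covnum (dom16 dB).
have [g g0 [g1 g3 g2]] := @geometric_mean R (N A) (N B).
have dng (x : nat) : (x ^ 2 <= t * (N A * N B))%N -> x%:R <= c * g.
  by move=> h; apply: (ler_of_sqr g0 t1 tc); rewrite g2 -natrX -natrM ler_nat.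
have dng' (x : nat) : (N A * N B <= t * x ^ 2)%N -> g <= c * x%:R.
  by move=> h; apply: (ler_of_sqr _ t1 tc) => //; rewrite g2 -natrX -natrM ler_nat.
(* The upper halves of the comparisons of a subset with [A] or [B] follow from monotonicity
   alone. *)
have mono X Y : X `<=` Y -> Y `<=` dom S 0 -> (N X)%:R <= c * (N Y)%:R :> R.
  move=> XY dY; apply: (@le_trans _ _ (N Y)%:R).
    by rewrite ler_nat; apply: N_sub => //; exact: dom16.
  by rewrite ler_peMl // (le_trans t1).
move=> [h1 [E [sE E1 E2]] [A' [B' [sA sB hA' hB' [hP1 hP2]]]]
  [H [x [y [[[H0 Hinv] [n [p [nt Hp cp]]] [hH1 hH2] hA hB] oH HK Kx Ky]]]]].
split.
- rewrite /large_energy eA eB energy_covnum g3 gtrsim_fin //.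
  apply: (ler_of_sqr _ t1 tc) => //; rewrite -exprM mulnC exprM g2 -!natrX -natrM ler_nat.
  by rewrite expnMn.
- exists E; split => //.
    by rewrite ent2_covnum // eA eB -EFinM gtrsim_fin // -natrM; exact: down.
  rewrite /geom_mean eA eB g1 ent1_covnum ?lesssim_fin //; first exact: dng.
  by move=> _ [[u v] /sE[/= Au Bv] <-] /=; have d1 := dA Au; have d2 := dB Bv; dom_tac.
- exists A', B'.
  have dA' : A' `<=` dom S 0 by move=> u /sA; exact: dA.
  have dB' : B' `<=` dom S 0 by move=> u /sB; exact: dB.
  have dAB : mulset A' B' `<=` dom S 16.
    by move=> _ [u Au [v Bv <-]]; have d1 := dA' _ Au; have d2 := dB' _ Bv; dom_tac.
  rewrite /geom_mean eA eB g1 /simeq (ent1_covnum dAB).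
  rewrite (ent1_covnum (dom16 dA')) (ent1_covnum (dom16 dB')).
  rewrite !gtrsim_fin // !lesssim_fin.
  by split => //; split; [exact: mono|exact: down|exact: mono|exact: down|exact: dng|exact: dng'].
- exists H, x, y.
  have dH : H `<=` dom S 0 by move=> u /HK; exact: dKt.
  have dAx : A `&` mulset [set x] H `<=` dom S 0 by move=> u [/dA].
  have dBy : B `&` mulset H [set y] `<=` dom S 0 by move=> u [/dB].
  rewrite /geom_mean eA eB g1 /simeq (ent1_covnum (dom16 dH)).
  rewrite (ent1_covnum (dom16 dAx)) (ent1_covnum (dom16 dBy)).
  rewrite !gtrsim_fin // !lesssim_fin.
  split => //; last 3 first.
  + by split; [exact: dng|exact: dng'].
  + by split; [apply: mono => // u []|exact: down].
  + by split; [apply: mono => // u []|exact: down].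
  have HE : invset H = H.
    apply/seteqP; split => [_ [h Hh <-]|h Hh]; first exact: Hinv.
    by exists (h^-1)%g; [exact: Hinv|rewrite invgK].
  split => //.
    split => //; apply: precompact_subset HK _.
    by rewrite precompact_closed //; apply: compact_closed cKt; exact: metric_hausdorff.
  (* Adjoining inverses makes the covering set symmetric. It stays inside [H H], which is symmetric,
     and the doubled size is why [tC] concerns [2 * t]. *)
  pose s := [seq p i | i <- enum 'I_n] ++ [seq (p i)^-1%g | i <- enum 'I_n].
  exists [fset z in s]%fset.
  have sP z : z \in s -> z^-1%g \in s.
    rewrite !mem_cat => /orP[] /mapP[i _ ->]; apply/orP; [right|left].
      by apply: map_f; rewrite mem_enum.
    by rewrite invgK; apply: map_f; rewrite mem_enum.
  have XE z : z \in [fset z in s]%fset = (z \in s) by rewrite in_fset.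
  split.
  + apply/seteqP; split => [_ [z zX <-]|z zX].
      have {}zX : z \in [fset z in s]%fset by [].
      by suff : z^-1%g \in [fset z in s]%fset by []; rewrite XE sP // -XE.
    have {}zX : z \in [fset z in s]%fset by [].
    exists (z^-1)%g; last by rewrite invgK.
    by suff : z^-1%g \in [fset z in s]%fset by []; rewrite XE sP // -XE.
  + move=> z zX; have : z \in [fset z in s]%fset by [].
    rewrite XE mem_cat => /orP[] /mapP[i _ ->]; first exact: Hp.
    have [h Hh [h' Hh' <-]] := Hp i; exists (h'^-1)%g; first exact: Hinv.
    by exists (h^-1)%g; [exact: Hinv|rewrite invgM].
  + apply: le_trans tC; rewrite ler_nat card_fseq (leq_trans (size_undup _)) //.
    by rewrite size_cat !size_map -enumT size_enum_ord mul2n -addnn leq_add.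
  + move=> z /cp[i hi]; exists (p i).
      suff : p i \in [fset z in s]%fset by [].
      by rewrite XE mem_cat map_f // mem_enum.
    by exists ((p i)^-1 * z)%g => //; rewrite mulVKg.
Qed.
End of_nat.
End translation.

(** A disjunction implying a conjunction contains every implication between the four conditions. As
    a hypothesis (iv) may use any compact [Kt], on which [C'] then depends; as a conclusion it uses
    [Kt0], fixed beforehand from [Kc] and [R0]. *)
Theorem theorem6p10 (R : realType) (G : metricGroupType R)
  (mu : {measure set (borelType G) -> \bar R}) (hG : locally_reasonable mu)
  (Kc : set G) (hKc : compact Kc) (R0 : R) :
  exists2 Kt0 : set G, compact Kt0 &
  forall Kt : set G, compact Kt ->
  forall C : R, 0 < C -> exists2 C' : R, 0 < C' &
  forall (eps K : R) (A B : set G),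
    0 < eps < R0 -> 1 <= K ->
    A `<=` Kc -> A !=set0 -> B `<=` Kc -> B !=set0 ->
    [\/ large_energy C eps K A B,
        small_partial_product C eps K A B,
        small_subset_product C eps K A B
      | approximate_group_control Kt C eps K A B] ->
    [/\ large_energy C' eps K A B,
        small_partial_product C' eps K A B,
        small_subset_product C' eps K A B
      & approximate_group_control Kt0 C' eps K A B].
Proof.
have [R0le|R00] := leP R0 0.
  exists set0; first exact: compact0.
  move=> Kt _ C _; exists 1 => // eps K A B /andP[e0 eR].
  by have := lt_le_trans (lt_trans e0 eR) R0le; rewrite ltxx.
have [f hf] := next_radius hG R0.
have [rK hrK] := compact_sub_cball hKc.
pose r1 := Num.max rK R0.
have Kr1 : Kc `<=` cball r1.
  by move=> x /hrK; rewrite /cball /= => /le_trans; apply; rewrite le_max lexx.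
(* Quotients [x^-1 * y] of points of [Kc] lie at level 2, their neighbourhoods at level 3, which is
   [Y0], and products of two of these, hence [H], at level 4. *)
exists (cball (iter 4 f r1)); first exact: (compact_cball hG).
move=> Kt cKt C C0; have [rt hrt] := compact_sub_cball cKt.
(* The domain must also contain the group and the translating elements given by hypothesis (iv). *)
pose r0 := Num.max (iter 4 f r1) rt.
have r1le : r1 <= iter 4 f r1 by exact: (@iter_radius_le _ _ R0 r1 f hf 0 4 isT).
have R0r0 : R0 <= r0 by rewrite le_max (le_trans _ r1le) // le_max lexx orbT.
have [L [M [L4 hS]]] := exists_multiscale hG R00 R0r0 hf.
have [P hP] : exists P : nat, forall k : nat,
    (2 * ((((((k ^ 2) ^ 160) ^ 21) ^ 40) ^ 40) ^ 320) <= 2 * k ^ P)%N.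
  exists (2 * 160 * 21 * 40 * 40 * 320)%N => k.
  by rewrite 5!expnM leqnn.
(* The bound [kappa] also dominates the packing constant [M], and the extra power in [P.+1] absorbs
   the factor 2 of the symmetrization. *)
have [C' C'0 hC'] := @power_bound R C M P.+1 C0.
exists C' => // eps K A B eR K1 AK A0 BK B0 hyp.
have [S [Smult Snear Sdom]] := hS _ eR; have /andP[e0 _] := eR.
have [k [Mk k1 Ck kC']] := hC' _ K1.
have dK : cball (iter 4 f r1) `<=` dom S 0.
  by move=> x hx; rewrite Sdom /cball /= le_max; apply/orP; left.
have dKt : Kt `<=` dom S 0.
  by move=> x /hrt hx; rewrite Sdom /cball /= le_max; apply/orP; right.
have iter4 m (x : G) : (m <= 4)%N -> cball (iter m f r1) x -> cball (iter 4 f r1) x.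
  by move=> h1 h2; apply: (@cball_iter_le _ _ R0 r1 f hf m 4 x h1 h2).
have dA : A `<=` dom S 0 by move=> x /AK /Kr1 h; exact/dK/(iter4 0).
have dB : B `<=` dom S 0 by move=> x /BK /Kr1 h; exact/dK/(iter4 0).
have hmul m (x y : G) : cball (iter m f r1) x -> cball (iter m f r1) y ->
    cball (iter m.+1 f r1) (x * y)%g.
  by have [_ _ _ + _] := hf (iter m f r1); apply.
have hinv m (x : G) : cball (iter m f r1) x -> cball (iter m.+1 f r1) (x^-1)%g.
  by have [_ _ _ _] := hf (iter m f r1); apply.
have hle m (x : G) : cball (iter m f r1) x -> cball (iter m.+1 f r1) x.
  by have [_ h _ _ _] := hf (iter m f r1); move=> /le_trans; apply.
have hyp2 := nat_of_conditions e0 L4 Snear dA dB dKt C0 K1 Ck hyp.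
have kk : (k <= k ^ 2)%N by rewrite -mulnn leq_pmull // ltnW.
have k0 : (0 < k)%N by exact: ltnW.
have Mk2 : (mult S <= k ^ 2)%N by rewrite Smult (leq_trans Mk).
have k12 : (1 < k ^ 2)%N by exact: leq_trans kk.
have hE := large_energy_of_any (ball2_near L4 Snear) (near_ball2 e0 L4 Snear)
  (ball4_near L4 Snear) (near_ball4 e0 L4 Snear) (close_near e0 L4 Snear)
  (near_close e0 L4 Snear) dA dB A0 B0 Mk2 k12 hyp2.
have [Mk3 k13] : (mult S <= (k ^ 2) ^ 160)%N /\ (1 < (k ^ 2) ^ 160)%N.
  have h : (k ^ 2 <= (k ^ 2) ^ 160)%N by rewrite -{1}(expn1 (k ^ 2)) leq_exp2l.
  by split; [exact: leq_trans Mk2 h|exact: leq_trans k12 h].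
have hY0 (x y g : G) : A x -> A y -> near S 20 g (x^-1 * y)%g ->
    near S 20 (g^-1)%g (y^-1 * x)%g -> cball (iter 3 f r1) g.
  move=> /AK /Kr1 hx /AK /Kr1 hy /(near20 e0 L4 Snear) h _.
  have h2 : cball (iter 2 f r1) (x^-1 * y)%g.
    by apply: hmul; [exact: (hinv 0)|exact: (hle 0)].
  have [_ _ h3 _ _] := hf (iter 2 f r1).
  apply: le_trans (metric_triangle _ (x^-1 * y)%g _) _; apply: le_trans h3.
  rewrite lerD // metric_sym; apply: ltW; apply: lt_trans h _.
  by have /andP[_] := eR; move: e0; lra.
have dY0 : cball (iter 3 f r1) `<=` dom S 0 by move=> x /(iter4 3 _ isT) /dK.
have hKt0 : [/\ A `<=` cball (iter 4 f r1),
    mulset (cball (iter 3 f r1) : set G) (cball (iter 3 f r1)) `<=` cball (iter 4 f r1)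
  & forall x a b : G, A x -> A a -> B b -> cball (iter 4 f r1) (x^-1 * (a * b))%g].
  split.
  - by move=> x /AK /Kr1; exact: (iter4 0).
  - by move=> _ [x hx [y hy <-]]; exact: (hmul 3%N).
  - move=> x a b /AK /Kr1 hx /AK /Kr1 ha /BK /Kr1 hb; apply: (iter4 2) => //.
    by apply: (hmul 1%N); [exact: (hinv 0)|exact: (hmul 0)].
have [c1 c2 c3 c4] := all_of_large_energy (ball2_near L4 Snear) (near_ball2 e0 L4 Snear)
  (near_ball4 e0 L4 Snear) (close_near e0 L4 Snear) dA dB A0 B0
  (open_near Snear) (fun U V oU _ => open_mulset V oU) hY0 dY0 hKt0 dK Mk3 k13 hE.
set t := (_ ^ 320)%N in c1 c2 c3 c4.
have t0 : (0 < t)%N by rewrite !expn_gt0 k0.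
have tC : (2 * t)%:R <= C' * K `^ C'.
  apply: le_trans kC'; rewrite ler_nat; apply: leq_trans (hP k) _.
  by rewrite expnS leq_mul2r k1 orbT.
exact: (conditions_of_nat e0 L4 Snear dA dB dK (@compact_cball _ _ _ hG (iter 4 f r1))
  C'0 K1 t0 tC (And4 c1 c2 c3 c4)).
Qed.
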